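(* The following statements are equivalent. (i) Problem (P1$'$) (stated in the context) is uniformly convex in $f$. (ii) There exists $\delta>0$ such that for all $f\in\mathcal U_c^{\rm F}$ $$\mathbb E\int_0^T\Big(-\mathbf y^T\hat{\mathbf Q}\mathbf y+Nf^TR_2f\Big)dt-\mathbb E\|\mathbf y(T)\|_{\mathbf H}^2\ge\delta\,\mathbb E\int_0^T\|f\|^2dt,$$ where $d\mathbf y=(\check{\mathbf A}\mathbf y+\mathbf 1\otimes f)dt$, $\mathbf y(0)=0$. (iii) The equation $$\dot{\mathbf P}+\check{\mathbf A}^T\mathbf P+\mathbf P\check{\mathbf A}-\hat{\mathbf Q}-\mathbf P(\mathbf 1\otimes I)(NR_2)^{-1}(\mathbf 1^T\otimes I)\mathbf P=0,\quad\mathbf P(T)=-\mathbf H,$$ admits a solution in $C([0,T];\mathbb R^{nN\times nN})$. (iv) The equation $$\dot P+(A+G)^TP+P(A+G)-PR_2^{-1}P-(I-\Gamma)^TQ(I-\Gamma)=0,\quad P(T)=-H,$$ admits a solution in $C([0,T];\mathbb R^{n\times n})$. (v) For any $t\in[0,T]$, $\det\big[(0,I)e^{\mathbb At}(0,I)^T\big]>0$, where $$\mathbb A=\begin{pmatrix}A+G+R_2^{-1}H&-R_2^{-1}\\ \mathbb A_{21}&-(A+G+R_2^{-1}H)^T\end{pmatrix},$$ $$\mathbb A_{21}=HR_2^{-1}H+(I-\Gamma)^TQ(I-\Gamma)+(A+G)^TH+H(A+G).$$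
   Context: **Model.** Fix $T>0$, $N\ge1$, $A,G,\Gamma\in\mathbb R^{n\times n}$, $B\in\mathbb R^{n\times r}$, $\sigma\in\mathbb R^{n\times d}$, $\eta\in\mathbb R^n$, symmetric $Q,R_2,H\in\mathbb R^{n\times n}$ with $Q\ge0$, $R_2>0$, $H\ge0$. Agent $i$, $1\le i\le N$, satisfies $$dx_i=[Ax_i+B\check u_i+Gx^{(N)}+f]dt+\sigma dW_i,\quad x_i(0)=x_{i0},\qquad x^{(N)}=\frac1N\sum_{j=1}^Nx_j,$$ with mutually independent $d$-dimensional Brownian motions $W_i$, independent of the independent square-integrable initial states $x_{i0}$ which have a common mean. $\mathcal U_c^{\rm F}$ is the set of processes ($\mathbb R^r$-valued for controls, $\mathbb R^n$-valued for $f$) adapted to $\sigma(x_i(0),W_i(s),0\le s\le t,1\le i\le N)$ with $\mathbb E\int_0^T\|\cdot\|^2dt<\infty$. The controls $\check u_i\in\mathcal U_c^{\rm F}$ are fixed. $\|z\|_M^2=z^TMz$. **Problem (P1$'$):** minimize over $f\in\mathcal U_c^{\rm F}$ $$\check J_{\rm soc}^{\rm F}(f)=\frac12\sum_{i=1}^N\Big(\mathbb E\int_0^T\{-\|x_i-\Gamma x^{(N)}-\eta\|_Q^2+\|f\|_{R_2}^2\}dt-\mathbb E\|x_i(T)\|_H^2\Big).$$ Uniformly convex means: for some $\delta>0$, $f\mapsto\check J_{\rm soc}^{\rm F}(f)-\delta\,\mathbb E\int_0^T\|f\|^2dt$ is convex on $\mathcal U_c^{\rm F}$. **Notation.** $\Psi=\Gamma^TQ+Q\Gamma-\Gamma^TQ\Gamma$;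 $\mathbf 1=(1,\dots,1)^T\in\mathbb R^N$; $\otimes$ is the Kronecker product; $I=I_n$; $\hat{\mathbf Q}=\mathrm{diag}(Q,\dots,Q)-\frac1N\mathbf 1\mathbf 1^T\otimes\Psi$; $\mathbf H=\mathrm{diag}(H,\dots,H)$; $\check{\mathbf A}=\mathrm{diag}(A,\dots,A)+\frac1N(\mathbf 1\mathbf 1^T\otimes G)$ ($N$ diagonal blocks each). *)

(* Defs.v *)
From HB Require Import structures.
From mathcomp Require Import all_boot all_order all_algebra.
From mathcomp Require Import all_classical all_reals all_analysis.
From mathcomp Require Export mxtens.

Set Implicit Arguments.
Unset Strict Implicit.
Unset Printing Implicit Defensive.

Import Order.TTheory GRing.Theory Num.Theory.
Import numFieldNormedType.Exports.

Local Open Scope classical_set_scope.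
Local Open Scope ring_scope.

Section Matrices.
Context {R : realType}.

Definition qform (k : nat) (M : 'M[R]_k) (z : 'cV[R]_k) : R :=
  (z^T *m M *m z) 0 0.

Definition sqnorm (k : nat) (z : 'cV[R]_k) : R := \sum_(j < k) (z j 0) ^+ 2.

Definition symmetric_mx (k : nat) (M : 'M[R]_k) : Prop := M^T = M.

Definition psd_mx (k : nat) (M : 'M[R]_k) : Prop :=
  forall z : 'cV[R]_k, 0 <= qform M z.

Definition pd_mx (k : nat) (M : 'M[R]_k) : Prop :=
  forall z : 'cV[R]_k, z != 0 -> 0 < qform M z.

Definition expmx (k : nat) (M : 'M[R]_k) : 'M[R]_k :=
  lim (series (fun m : nat => (m`!%:R)^-1 *: M ^+ m) @ \oo).

Definition ones (N : nat) : 'cV[R]_N := const_mx 1.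

(* [*t] is the Kronecker product. The cast only identifies the [1 * q] columns
   of [ones N *t M] with [q] columns. *)
Definition ones_tens (N p q : nat) (M : 'M[R]_(p, q)) : 'M[R]_(N * p, q) :=
  castmx (erefl, mul1n q) (ones N *t M).

(* diag(M, ..., M) with N blocks, i.e. the Kronecker product of I_N with M. *)
Definition repdiag (N p : nat) (M : 'M[R]_p) : 'M[R]_(N * p) := 1%:M *t M.

Definition Psi_mx (n : nat) (Q Gamma : 'M[R]_n) : 'M[R]_n :=
  Gamma^T *m Q + Q *m Gamma - Gamma^T *m Q *m Gamma.

Definition Qhat (N n : nat) (Q Gamma : 'M[R]_n) : 'M[R]_(N * n) :=
  repdiag N Q - N%:R^-1 *: ((ones N *m (ones N)^T) *t Psi_mx Q Gamma).

Definition Acheck (N n : nat) (A G : 'M[R]_n) : 'M[R]_(N * n) :=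
  repdiag N A + N%:R^-1 *: ((ones N *m (ones N)^T) *t G).

Definition A21 (n : nat) (A G Gamma Q R2 H : 'M[R]_n) : 'M[R]_n :=
  H *m invmx R2 *m H + (1%:M - Gamma)^T *m Q *m (1%:M - Gamma)
  + (A + G)^T *m H + H *m (A + G).

Definition bbA (n : nat) (A G Gamma Q R2 H : 'M[R]_n) : 'M[R]_(n + n) :=
  block_mx (A + G + invmx R2 *m H) (- invmx R2)
           (A21 A G Gamma Q R2 H) (- (A + G + invmx R2 *m H)^T).

(* A continuous solution on [0, T] of the terminal value problem
   P' = F(P), P(T) = PT: continuous on the closed interval and satisfying the
   equation in its interior. When F is continuous the equation then also holds
   at 0 and T with one-sided derivatives. *)
Definition solves_terminal (k : nat) (T : R) (F : 'M[R]_k -> 'M[R]_k)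
    (PT : 'M[R]_k) (P : R -> 'M[R]_k) : Prop :=
  [/\ {within `[0, T], continuous P},
      forall t, t \in `]0, T[ -> is_derive t 1 P (F (P t))
    & P T = PT].

End Matrices.

Section Stochastic.
Context {d0 : measure_display} {Omega : measurableType d0} {R : realType}.
Variable P : probability Omega R.

Definition process (k : nat) := R -> Omega -> 'cV[R]_k.

Definition sigma_rv (k : nat) (v : Omega -> 'cV[R]_k) : set_system Omega :=
  <<s \bigcup_(j in [set: 'I_k])
        preimage_set_system setT (fun w => v w j 0) measurable >>.

Definition sigma_process (k : nat) (D : set R) (Z : process k) :
    set_system Omega :=
  <<s \bigcup_(s in D) sigma_rv (Z s) >>.

Definition indep2 (F1 F2 : set_system Omega) : Prop :=
  forall E1 E2, F1 E1 -> F2 E2 -> P (E1 `&` E2) = (P E1 * P E2)%E.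

Definition mutual_indep (I : finType) (F : I -> set_system Omega) : Prop :=
  forall (J : {set I}) (E : I -> set Omega),
    (forall i, i \in J -> F i (E i)) ->
    P (\bigcap_(i in [set` J]) E i) = (\prod_(i in J) P (E i))%E.

(* [normal_prob m s] has mean m and standard deviation s. *)
Record brownian_motion (T : R) (k : nat) (W : process k) : Prop := {
  bm_measurable : forall t, t \in `[0, T] -> sigma_rv (W t) `<=` measurable ;
  bm_start : {ae P, forall w, W 0 w = 0} ;
  bm_continuous : {ae P, forall w, {within `[0, T], continuous (W ^~ w)}} ;
  bm_indep_increments : forall s t, 0 <= s -> s < t -> t <= T ->
    indep2 (sigma_rv (fun w => W t w - W s w)) (sigma_process `[0, s] W) ;
  bm_indep_components : forall s t, 0 <= s -> s < t -> t <= T ->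
    mutual_indep (fun j : 'I_k =>
      preimage_set_system setT (fun w => (W t w - W s w) j 0) measurable) ;
  bm_gaussian : forall s t, 0 <= s -> s < t -> t <= T ->
    forall (j : 'I_k) (B : set R), measurable B ->
    P ((fun w => (W t w - W s w) j 0) @^-1` B)
      = normal_prob 0 (Num.sqrt (t - s)) B
}.

Definition jointly_measurable (T : R) (k : nat) (Z : process k) : Prop :=
  forall j : 'I_k,
    measurable_fun (`[0, T] `*` setT : set (measurableTypeR R * Omega))
                   (fun z => Z z.1 z.2 j 0).

(* E \int_0^T g dt. It is extended-real valued at both levels: a real-valued
   inner integral would count a divergent one as 0. *)
Definition Eint (T : R) (g : R -> Omega -> R) : \bar R :=
  (\int[P]_w \int[lebesgue_measure]_(t in `[0%R, T]) (g t w)%:E)%E.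

Definition filtration (N n d : nat) (x0 : 'I_N -> Omega -> 'cV[R]_n)
    (W : 'I_N -> process d) (t : R) : set_system Omega :=
  <<s \bigcup_(i in [set: 'I_N])
        (sigma_rv (x0 i) `|` sigma_process `[0, t] (W i)) >>.

(* Membership in U_c^F. Joint measurability in (t, omega) is implicit in the
   condition E \int_0^T |f|^2 dt < oo. *)
Record admissible (T : R) (N n d : nat) (x0 : 'I_N -> Omega -> 'cV[R]_n)
    (W : 'I_N -> process d) (k : nat) (f : process k) : Prop := {
  adm_measurable : jointly_measurable T f ;
  adm_adapted : forall t, t \in `[0, T] ->
    sigma_rv (f t) `<=` filtration x0 W t ;
  adm_square_integrable : (Eint T (fun t w => sqnorm (f t w)) < +oo)%E
}.

(* dz = b dt + dM, z(0) = z0, in integral form. The noise enters additively,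
   with M = sigma W or M = 0, so that no stochastic integral is needed. *)
Definition solves_sde (T : R) (k : nat) (z0 : Omega -> 'cV[R]_k)
    (b M z : process k) : Prop :=
  jointly_measurable T z /\
  {ae P, forall w, {within `[0, T], continuous (z ^~ w)} /\
    forall t, t \in `[0, T] ->
      z t w = z0 w
        + \col_j (\int[lebesgue_measure]_(s in `[0, t]) (b s w j 0))
        + M t w}.

Definition average (N n : nat) (x : 'I_N -> process n) : process n :=
  fun t w => N%:R^-1 *: \sum_(i < N) x i t w.

Definition state_eq (T : R) (N n r d : nat) (A G : 'M[R]_n) (B : 'M[R]_(n, r))
    (sigma : 'M[R]_(n, d)) (x0 : 'I_N -> Omega -> 'cV[R]_n)
    (W : 'I_N -> process d) (u : 'I_N -> process r) (f : process n)
    (x : 'I_N -> process n) : Prop :=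
  forall i, solves_sde T (x0 i)
    (fun t w => A *m x i t w + B *m u i t w + G *m average x t w + f t w)
    (fun t w => sigma *m W i t w)
    (x i).

Definition Jsoc (T : R) (N n : nat) (Gamma : 'M[R]_n) (eta : 'cV[R]_n)
    (Q R2 H : 'M[R]_n) (x : 'I_N -> process n) (f : process n) : \bar R :=
  ((2^-1)%:E * \sum_(i < N)
     (Eint T (fun t w =>
        - qform Q (x i t w - Gamma *m average x t w - eta)
        + qform R2 (f t w))%R
      - 'E_P[fun w => qform H (x i T w)]))%E.

Definition convex_on (k : nat) (U : set (process k)) (F : process k -> \bar R)
    : Prop :=
  forall f g (a : R), U f -> U g -> 0 <= a -> a <= 1 ->
    (F (fun t w => a *: f t w + (1 - a) *: g t w)%R
     <= a%:E * F f + (1 - a)%:E * F g)%E.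

Definition uniformly_convex (T : R) (k : nat) (U : set (process k))
    (J : process k -> \bar R) : Prop :=
  exists2 delta : R, 0 < delta &
    convex_on U
      (fun f => J f - delta%:E * Eint T (fun t w => sqnorm (f t w)))%E.

End Stochastic.

(* Main.v *)
Require Import Defs.
From HB Require Import structures.
From mathcomp Require Import all_boot all_order all_algebra.
From mathcomp Require Import all_classical all_reals all_analysis.
From mathcomp Require Import measurable_realfun.
From mathcomp Require Import ring lra.
Import Order.TTheory GRing.Theory Num.Theory.
Import numFieldNormedType.Exports.
Local Open Scope classical_set_scope.
Local Open Scope ring_scope.

Set Implicit Arguments.
Unset Strict Implicit.
Unset Printing Implicit Defensive.

(* The second variation of the cost only sees differences of solutions. For two
   controls f and g driving the same noise, the differences of all agents' states
   coincide with a single path xi solving xi' = (A + G) xi + (f - g), xi(0) = 0,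
   pathwise, and 1 (x) xi is the solution y of (ii). So (i) and (ii) both reduce to
   the coercivity of the deterministic cost
     \int_0^T (- |(I - Gamma) xi|_Q^2 + |f|_R2^2) dt - |xi(T)|_H^2 .
   Completing the square with a solution of (iv) gives this coercivity. Conversely,
   let (X, Y) be the solution of the Hamiltonian system linearizing the shifted
   Riccati equation for P + H; up to time reversal and transposition X is the
   matrix in (v). If X(t) is singular, an extremal starting from 0 at time t is
   a nonzero deterministic control of zero cost. If X is invertible throughout,
   Y X^-1 solves the Riccati equation; since det X(T) = 1, invertibility is
   positivity of the determinant. The matrix equation (iii) splits along the
   projection N^-1 1 1^T into (iv) and a Lyapunov equation, always solvable. *)

(** * Primitives of integrable functions *)

(** Controls are only square integrable in time, so differences of states are absolutely continuous
    and satisfy their equations in integral form. Calculus is therefore done on pairs [prim f F];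
    integration by parts and Gronwall estimates take the place of pointwise derivatives, and paths
    are identified by uniqueness for linear equations. The shift by [H] turns the terminal value
    [- H] into 0, the value carried by a Hamiltonian path with X = 1 and Y = 0 at time T. The cost
    is extended-real, and its convexity inequality can be rearranged only when every term is finite.
    This calls for second moments of the states, over the whole interval and at T itself, although
    the noise cancels in every difference. Brownian motion comes without joint measurability in time
    and sample, so its moments are taken at fixed times and transferred to a measurable version read
    off the state equation. Costs are compared sample by sample, off a null set, and only then
    integrated; this is how a deterministic inequality governs random controls. *)

Section RealIntegrable.
Context d (X : measurableType d) (R : realType) (nu : {measure set X -> \bar R}).
Context (D : set X) (mD : measurable D).
Implicit Types f g : X -> R.

Lemma rintegrableD f g : nu.-integrable D (EFin \o f) ->
  nu.-integrable D (EFin \o g) -> nu.-integrable D (EFin \o (fun x => f x + g x)).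
Proof.
by move=> hf hg; apply: eq_integrable (integrableD mD hf hg).
Qed.

Lemma rintegrableZ (c : R) f : nu.-integrable D (EFin \o f) ->
  nu.-integrable D (EFin \o (fun x => c * f x)).
Proof.
by move=> hf; apply: eq_integrable (integrableZl mD c hf).
Qed.

Lemma rintegrableN f : nu.-integrable D (EFin \o f) ->
  nu.-integrable D (EFin \o (fun x => - f x)).
Proof.
by move=> hf; apply: eq_integrable (integrableN hf).
Qed.

Lemma rintegrableB f g : nu.-integrable D (EFin \o f) ->
  nu.-integrable D (EFin \o g) -> nu.-integrable D (EFin \o (fun x => f x - g x)).
Proof. by move=> hf hg; apply: rintegrableD => //; apply: rintegrableN. Qed.

Lemma rintegrable_sum (I : Type) (s : seq I) (f : I -> X -> R) :
  (forall i, nu.-integrable D (EFin \o f i)) ->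
  nu.-integrable D (EFin \o (fun x => \sum_(i <- s) f i x)).
Proof.
move=> hf.
have := integrable_sum mD s (P := xpredT) (h := fun i => EFin \o f i) (fun i _ => hf i).
by apply: eq_integrable => // x _; rewrite /= sumEFin.
Qed.

Lemma Rintegral_sum (I : Type) (s : seq I) (f : I -> X -> R) :
  (forall i, nu.-integrable D (EFin \o f i)) ->
  (\int[nu]_(x in D) (\sum_(i <- s) f i x) =
   \sum_(i <- s) \int[nu]_(x in D) f i x)%R.
Proof.
move=> hf; elim: s => [|i s IH].
  rewrite big_nil; under eq_Rintegral do rewrite big_nil.
  by rewrite /Rintegral integral0.
rewrite big_cons; under eq_Rintegral do rewrite big_cons.
by rewrite RintegralD// ?IH//; apply: rintegrable_sum.
Qed.

Lemma rintegrableM_bounded f g (M : R) : measurable_fun D f ->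
  (forall x, D x -> `|f x| <= M) -> nu.-integrable D (EFin \o g) ->
  nu.-integrable D (EFin \o (fun x => f x * g x)).
Proof.
move=> mf fM ig.
have mg : measurable_fun D g by apply/measurable_EFinP; case/integrableP: ig.
apply: (@le_integrable _ _ _ _ _ mD _ (EFin \o (fun x => M * g x))).
- by apply/measurable_EFinP; apply: measurable_funM.
- move=> x Dx /=; rewrite lee_fin !normrM ler_wpM2r//.
  by apply: (le_trans (fM _ Dx)); exact: ler_norm.
- exact: rintegrableZ.
Qed.

Lemma integrable_measurable_restrict f : nu.-integrable D (EFin \o f) ->
  measurable_fun setT (f \_ D).
Proof.
move=> /(integrable_mkcond _ mD); rewrite restrict_EFin.
by case/integrableP => /measurable_EFinP.
Qed.

Lemma rintegrable_le f g : measurable_fun D f ->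
  (forall x, D x -> `|f x| <= g x) -> nu.-integrable D (EFin \o g) ->
  nu.-integrable D (EFin \o f).
Proof.
move=> mf fg; apply: le_integrable => //; first exact/measurable_EFinP.
move=> x Dx /=; rewrite lee_fin; apply: (le_trans (fg _ Dx)); exact: ler_norm.
Qed.

End RealIntegrable.

(** * Absolutely continuous functions on [0, T] *)

Section Prim.
Context {R : realType}.
Notation mu := (@lebesgue_measure R).
Variable T : R.
Implicit Types f g F G : R -> R.

(** Absolute continuity of [F] with almost everywhere derivative [f], in integral form. A control
    that is merely integrable gives no derivative at a prescribed time, so [is_derive] would be too
    strong. *)
Definition prim f F : Prop :=
  mu.-integrable `[0, T] (EFin \o f) /\
  forall t, t \in `[0, T] -> F t = F 0 + \int[mu]_(s in `[0, t]) f s.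

Lemma prim_int f F t : prim f F -> t \in `[0, T] ->
  mu.-integrable `[0, t] (EFin \o f).
Proof.
move=> [hf _]; rewrite in_itv/= => /andP[t0 tT].
by apply: integrableS hf => //; apply: subset_itvl; rewrite bnd_simp.
Qed.

Lemma eq_prim f g F G : {in `[0, T], f =1 g} -> {in `[0, T], F =1 G} ->
  prim f F -> prim g G.
Proof.
move=> fg FG [hf hF]; split.
  by apply: eq_integrable hf => // x; rewrite inE/= => xT; rewrite fg.
move=> t tT; have T0 : 0 \in `[0, T].
  by move: tT; rewrite !in_itv/= lexx => /andP[/le_trans h /h].
rewrite -(FG _ tT) -(FG _ T0) (hF _ tT).
congr (_ + _); apply: eq_Rintegral => s; rewrite inE/= in_itv/= => /andP[s0 st].
rewrite fg//; move: tT; rewrite !in_itv/= s0 => /andP[_] /=; exact: le_trans.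
Qed.

Lemma primD f F g G : prim f F -> prim g G ->
  prim (fun t => f t + g t) (fun t => F t + G t).
Proof.
move=> pf pg; split; first by apply: rintegrableD => //; [case: pf|case: pg].
move=> t tT; rewrite RintegralD//; [|exact: prim_int pf tT|exact: prim_int pg tT].
by rewrite (pf.2 t tT) (pg.2 t tT) addrACA.
Qed.

Lemma primZ (c : R) f F : prim f F -> prim (fun t => c * f t) (fun t => c * F t).
Proof.
move=> pf; split; first by apply: rintegrableZ => //; case: pf.
move=> t tT; rewrite RintegralZl//; last exact: prim_int pf tT.
by rewrite (pf.2 t tT) mulrDr.
Qed.

Lemma primN f F : prim f F -> prim (fun t => - f t) (fun t => - F t).
Proof.
by move=> /(primZ (-1)); apply: eq_prim => t _; rewrite mulN1r.
Qed.

Lemma prim_cst (c : R) : prim (fun=> 0) (fun=> c).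
Proof.
split; first exact: integrable0.
by move=> t tT; rewrite /Rintegral integral0 addr0.
Qed.

Lemma prim_sum (I : Type) (s : seq I) (f F : I -> R -> R) :
  (forall i, prim (f i) (F i)) ->
  prim (fun t => \sum_(i <- s) f i t) (fun t => \sum_(i <- s) F i t).
Proof.
move=> h; elim: s => [|i s IH].
  by apply: eq_prim (prim_cst 0) => t _; rewrite big_nil.
by apply: eq_prim (primD (h i) IH) => t _; rewrite big_cons.
Qed.

Lemma prim_within_continuous f F : 0 <= T -> prim f F ->
  {within `[0, T], continuous F}.
Proof.
move=> T0 [hf hF].
have h := parameterized_integral_continuous T0 hf.
have h2 : {within `[0, T], continuous
    (fun x => F 0 + parameterized_integral mu 0 x f)}.
  apply: within_continuousD => //.
  by apply: continuous_subspaceT => x; exact: cst_continuous.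
apply: (@subspace_eq_continuous _ _ _ (fun x => F 0 + parameterized_integral mu 0 x f)) => //.
by move=> x; rewrite inE/= => xT; rewrite /from_subspace/= /parameterized_integral -hF.
Qed.

Lemma within_continuous_bounded F : 0 <= T -> {within `[0, T], continuous F} ->
  exists M : R, 0 < M /\ forall t, t \in `[0, T] -> `|F t| <= M.
Proof.
move=> T0 cF.
have cN : {within `[0, T], continuous (fun t => `|F t|)}.
  by move=> t; apply: cvg_norm; exact: cF.
have [c _ hc] := EVT_max T0 cN.
exists (`|F c| + 1); split; first by rewrite ltr_wpDl.
by move=> t /hc /= h; apply: (le_trans h); rewrite lerDl.
Qed.

End Prim.

Section PrimMul.
Context {R : realType}.
Notation mu := (@lebesgue_measure R).

Lemma mem_seg (a b x : R) : (x \in `[a, b]%classic) = (a <= x <= b).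
Proof. by rewrite mem_setE in_itv. Qed.

(* Fubini on the triangle [r <= s]: the part of [f (x) g] below the diagonal,
   integrated in both orders. *)
Lemma integral_triangle (t : R) (f g : R -> R) :
  mu.-integrable `[0, t] (EFin \o f) -> mu.-integrable `[0, t] (EFin \o g) ->
  \int[mu]_(s in `[0, t]) (f s * \int[mu]_(r in `[0, s]) g r)
  = \int[mu]_(r in `[0, t]) (g r * \int[mu]_(s in `[r, t]) f s).
Proof.
move=> hf hg; pose I := `[0, t]%classic : set R.
have mI : measurable (I : set (measurableTypeR R)) by exact: measurable_itv.
pose K := fun z : R * R =>
  (f \_ I) z.1 * ((g \_ I) z.2 * (z.2 <= z.1)%R%:R).
have mf : measurable_fun setT (f \_ I) by exact: integrable_measurable_restrict hf.
have mg : measurable_fun setT (g \_ I) by exact: integrable_measurable_restrict hg.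
have mK : measurable_fun setT K.
  apply: measurable_funM; first exact: measurableT_comp.
  apply: measurable_funM; first exact: measurableT_comp.
  rewrite (_ : (fun z : R * R => (z.2 <= z.1)%R%:R) =
    (fun z : R * R => if (z.2 <= z.1)%R then 1 else 0 : R)); last first.
    by apply/funext => z; case: ifP.
  by apply: measurable_fun_ifT => //; apply: measurable_fun_ler.
have iT h : mu.-integrable I (EFin \o h) ->
    (\int[mu]_x `|(h \_ I) x|%:E < +oo)%E.
  move=> /integrableP[mh]; rewrite [X in (X < _)%E]integral_mkcond.
  congr (_ < +oo)%E; apply: eq_integral => x _.
  by rewrite !patchE; case: ifP => //= _; rewrite normr0.
(* Tonelli: [K] is dominated in absolute value by the product of the two restricted functions, whose
   integral factors into two finite ones. *)
have iK : (mu \x mu)%E.-integrable setT (EFin \o K).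
  apply/integrable12ltyP; first exact/measurable_EFinP.
  apply: (@le_lt_trans _ _ (\int[mu]_x (`|(f \_ I) x|%:E * \int[mu]_y `|(g \_ I) y|%:E))%E).
    apply: ge0_le_integral => //.
    - by move=> x _; apply: integral_ge0.
    - have maK : measurable_fun setT (abse \o (EFin \o K)).
        by apply: measurableT_comp => //; exact/measurable_EFinP.
      refine (@measurable_fun_fubini_tonelli_F _ _ _ _ R mu _ maK (fun z => abse_ge0 ((EFin \o K) z))).
    - apply: emeasurable_funM => //.
      by apply/measurable_EFinP; exact: measurableT_comp.
    move=> x _; rewrite -ge0_integralZl//; last first.
      by apply/measurable_EFinP; exact: measurableT_comp.
    apply: ge0_le_integral => //.
    - apply: measurableT_comp => //; apply/measurable_EFinP.
      exact: (measurableT_comp mK (measurable_pair1 x)).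
    - by apply: measurable_funeM; apply/measurable_EFinP; exact: measurableT_comp.
    move=> y _; rewrite /K/= lee_fin !normrM ler_wpM2l// ler_piMr//.
    by case: (y <= x)%R; rewrite ?normr1 ?normr0.
  rewrite ge0_integralZr//; last 2 first.
    by apply/measurable_EFinP; exact: measurableT_comp.
    exact: integral_ge0.
  apply: lte_mul_pinfty; last exact: iT.
    exact: integral_ge0.
  by rewrite ge0_fin_numE ?iT// integral_ge0.
have hF := Fubini iK.
have -> : \int[mu]_(s in `[0, t]) (f s * \int[mu]_(r in `[0, s]) g r) =
   fine (\int[mu]_x \int[mu]_y (EFin \o K) (x, y))%E.
  rewrite /Rintegral [in LHS]integral_mkcond; congr fine.
  apply: eq_integral => x _; rewrite patchE.
  case: ifPn => xI; last first.
    rewrite integral0_eq// => y _.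
    by rewrite /K/= patchE (negbTE xI) mul0r.
  have hx : (`[0, x] `<=` I)%classic.
    by move: xI; rewrite inE/= ?in_itv/= => /andP[_ xt]; apply: subset_itvl; rewrite bnd_simp.
  have mx : measurable (`[0, x]%classic : set (measurableTypeR R)) by exact: measurable_itv.
  have hgx : mu.-integrable `[0, x] (EFin \o g) by exact: integrableS hg.
  have -> : (\int[mu]_y (EFin \o K) (x, y))%E =
     (\int[mu]_y ((f x)%:E * ((g \_ `[0, x]) y)%:E))%E.
    apply: eq_integral => y _; rewrite /K/= patchE xI -EFinM; congr (_ * _)%:E.
    move: xI; rewrite !patchE !mem_seg => /andP[x0 xt].
    have [yx|xy] := leP y x; rewrite ?mulr1 ?mulr0 ?andbF ?andbT//.
    by rewrite (le_trans yx xt) andbT.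
  rewrite integralZl//; last first.
    by have := (integrable_mkcond _ mx).1 hgx; rewrite restrict_EFin.
  rewrite EFinM; congr (_ * _)%E; rewrite /Rintegral fineK; last exact: integrable_fin_num.
  by rewrite integral_mkcond; under eq_integral do rewrite restrict_EFin.
have -> : \int[mu]_(r in `[0, t]) (g r * \int[mu]_(s in `[r, t]) f s) =
   fine (\int[mu]_y \int[mu]_x (EFin \o K) (x, y))%E.
  rewrite /Rintegral [in LHS]integral_mkcond; congr fine.
  apply: eq_integral => x _; rewrite patchE.
  case: ifPn => xI; last first.
    rewrite integral0_eq// => y _.
    by rewrite /K/= (patchE g) (negbTE xI) mul0r mulr0.
  have hx : (`[x, t] `<=` I)%classic.
    by move: xI; rewrite inE/= ?in_itv/= => /andP[xt _]; apply: subset_itvr; rewrite bnd_simp.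
  have mx : measurable (`[x, t]%classic : set (measurableTypeR R)) by exact: measurable_itv.
  have hgx : mu.-integrable `[x, t] (EFin \o f) by exact: integrableS hf.
  have -> : (\int[mu]_y (EFin \o K) (y, x))%E =
     (\int[mu]_y ((g x)%:E * ((f \_ `[x, t]) y)%:E))%E.
    apply: eq_integral => y _; rewrite /K/= (patchE g) xI -EFinM; congr (_%:E).
    rewrite mulrCA; congr (_ * _).
    move: xI; rewrite !patchE !mem_seg => /andP[x0 xt].
    have [xy|yx] := leP x y; rewrite ?mulr1 ?mulr0//=.
    by rewrite (le_trans x0 xy).
  rewrite integralZl//; last first.
    by have := (integrable_mkcond _ mx).1 hgx; rewrite restrict_EFin.
  rewrite EFinM; congr (_ * _)%E; rewrite /Rintegral fineK; last exact: integrable_fin_num.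
  by rewrite integral_mkcond; under eq_integral do rewrite restrict_EFin.
by rewrite hF.
Qed.

End PrimMul.

(** * Integration by parts and Gronwall estimates *)

Section PrimCalculus.
Context {R : realType}.
Notation mu := (@lebesgue_measure R).
Variables (T : R) (T0 : 0 <= T).
Implicit Types f g F G : R -> R.

Let mIT : measurable (`[0, T]%classic : set (measurableTypeR R)).
Proof. exact: measurable_itv. Qed.

Lemma measurable_seg (a b : R) : measurable (`[a, b]%classic : set (measurableTypeR R)).
Proof. exact: measurable_itv. Qed.

Lemma mem0_seg : 0 \in `[0, T].
Proof. by rewrite in_itv/= lexx. Qed.

Lemma memT_seg : T \in `[0, T].
Proof. by rewrite in_itv/= lexx andbT. Qed.

Lemma sub_seg (t : R) : t \in `[0, T] -> (`[0, t] `<=` `[0, T])%classic.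
Proof. by rewrite in_itv/= => /andP[_ tT]; apply: subset_itvl; rewrite bnd_simp. Qed.

Lemma prim_itvB f F s t : prim T f F -> s \in `[0, T] -> t \in `[0, T] -> s <= t ->
  F t - F s = \int[mu]_(x in `[s, t]) f x.
Proof.
move=> pf sT tT st; rewrite (pf.2 t tT) (pf.2 s sT) opprD addrACA subrr add0r.
have it := prim_int pf tT.
move: sT; rewrite in_itv/= => /andP[s0 _].
rewrite Rintegral_itvB ?bnd_simp// Rintegral_itv_obnd_cbnd//.
by apply: integrableS it => //; apply: subset_itvScc; rewrite bnd_simp.
Qed.

Lemma rintegrable_mul_cont f g : mu.-integrable `[0, T] (EFin \o f) ->
  {within `[0, T], continuous g} ->
  mu.-integrable `[0, T] (EFin \o (fun t => g t * f t)).
Proof.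
move=> hf cg; have [M [_ hM]] := within_continuous_bounded T0 cg.
apply: (@rintegrableM_bounded _ _ _ _ _ mIT _ _ M) => //.
exact: subspace_continuous_measurable_fun.
Qed.

(** In f G, expand G from time 0 ([E1]); in F g, expand F backwards from time t ([E2]). The two
    double integrals that appear run over the same triangle with opposite signs, and
    [integral_triangle] cancels them. *)
Lemma primM f g F G : prim T f F -> prim T g G ->
  prim T (fun t => f t * G t + F t * g t) (fun t => F t * G t).
Proof.
move=> pf pg.
have cF := prim_within_continuous T0 pf; have cG := prim_within_continuous T0 pg.
have iFg : mu.-integrable `[0, T] (EFin \o (fun t => F t * g t)).
  by apply: rintegrable_mul_cont => //; case: pg.
have ifG : mu.-integrable `[0, T] (EFin \o (fun t => f t * G t)).
  have : mu.-integrable `[0, T] (EFin \o (fun t => G t * f t)).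
    by apply: rintegrable_mul_cont => //; case: pf.
  by apply: eq_integrable => // x _ /=; rewrite mulrC.
split; first exact: rintegrableD.
move=> t tT; have sT := sub_seg tT.
have mt := measurable_seg 0 t.
have iFgt : mu.-integrable `[0, t] (EFin \o (fun t => F t * g t)).
  exact: integrableS iFg.
have ifGt : mu.-integrable `[0, t] (EFin \o (fun t => f t * G t)).
  exact: integrableS ifG.
have ift := prim_int pf tT; have igt := prim_int pg tT.
rewrite RintegralD//.
have sub s : s \in `[0, t]%classic -> s \in `[0, T].
  by move=> /set_mem /sT.
have E1 : \int[mu]_(x in `[0, t]) (f x * G x) =
    \int[mu]_(x in `[0, t]) (f x * \int[mu]_(r in `[0, x]) g r)
    + G 0 * \int[mu]_(x in `[0, t]) f x.
  rewrite -RintegralZl// -RintegralD//; last 2 first.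
    have : mu.-integrable `[0, t] (EFin \o (fun x => f x * G x - G 0 * f x)).
      by apply: rintegrableB => //; exact: rintegrableZ.
    apply: eq_integrable => // x /sub xt /=; congr EFin.
    by rewrite [in LHS](pg.2 x xt) mulrDr [f x * G 0]mulrC addrAC subrr add0r.
    exact: rintegrableZ.
  by apply: eq_Rintegral => x /sub xt; rewrite (pg.2 x xt) mulrDr addrC [f x * G 0]mulrC.
have E2 : \int[mu]_(x in `[0, t]) (F x * g x) =
    F t * \int[mu]_(x in `[0, t]) g x
    - \int[mu]_(r in `[0, t]) (g r * \int[mu]_(s in `[r, t]) f s).
  rewrite -RintegralZl// -RintegralB//; last 2 first.
    exact: rintegrableZ.
    have : mu.-integrable `[0, t] (EFin \o (fun x => F t * g x - F x * g x)).
      by apply: rintegrableB => //; exact: rintegrableZ.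
    apply: eq_integrable => // x xt /=; congr EFin.
    rewrite -(prim_itvB pf (sub _ xt) tT); first by rewrite mulrBr !(mulrC (g x)).
    by move: xt; rewrite mem_seg => /andP[].
  apply: eq_Rintegral => x xt; rewrite -(prim_itvB pf (sub _ xt) tT).
    by rewrite mulrBr !(mulrC (g x)) subKr.
  by move: xt; rewrite mem_seg => /andP[].
rewrite E1 E2 (integral_triangle ift igt).
rewrite (pf.2 t tT) (pg.2 t tT).
set a := \int[mu]_(x in _) f x; set b := \int[mu]_(x in _) g x; set c := \int[mu]_(r in _) _.
by ring.
Qed.

(** The fundamental theorem of calculus needs the derivative only inside the interval when [F] and
    [f] are continuous up to its ends. This is the information that [solves_terminal] provides. *)
Lemma prim_C1 f F : {within `[0, T], continuous F} ->
  {within `[0, T], continuous f} ->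
  (forall t, t \in `]0, T[ -> is_derive t (1 : R) F (f t)) -> prim T f F.
Proof.
move=> cF cf dF; split.
  by apply: continuous_compact_integrable => //; exact: segment_compact.
move=> t tT; have sT := sub_seg tT.
move: (tT); rewrite in_itv/= => /andP[]; rewrite le_eqVlt => /predU1P[<- _|t0 tT'].
  by rewrite set_itv1 Rintegral_set1 addr0.
have cFt : {within `[0, t], continuous F} by exact: continuous_subspaceW cF.
have dt x : x \in `]0, t[ -> is_derive x (1 : R) F (f x).
  move=> xt; apply: dF; move: xt; rewrite !in_itv/= => /andP[-> /=] /lt_le_trans; exact.
rewrite /Rintegral (@continuous_FTC2 _ f F 0 t t0)//.
- by rewrite -EFinB /= subrKC.
- exact: continuous_subspaceW cf.
- move/(continuous_within_itvP _ t0): cFt => [_ c0 c1]; split => //.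
  by move=> x /dt[].
- by move=> x /dt dx; rewrite derive1E; case: dx.
Qed.

Lemma prim_le f F g t : prim T f F -> mu.-integrable `[0, T] (EFin \o g) ->
  (forall s, s \in `[0, T] -> f s <= g s) -> t \in `[0, T] ->
  F t <= F 0 + \int[mu]_(s in `[0, t]) g s.
Proof.
move=> pf ig fg tT; rewrite (pf.2 t tT) lerD2l.
have mt := measurable_seg 0 t.
apply: le_Rintegral => //; first exact: prim_int pf tT.
  by apply: integrableS ig => //; exact: sub_seg.
by move=> x /(sub_seg tT); exact: fg.
Qed.

Lemma prim_nondecreasing f F s t : prim T f F ->
  (forall s, s \in `[0, T] -> 0 <= f s) -> s \in `[0, T] -> t \in `[0, T] ->
  s <= t -> F s <= F t.
Proof.
move=> pf f0 sT tT st; rewrite -subr_ge0 (prim_itvB pf)//.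
apply: Rintegral_ge0 => x; rewrite /= in_itv/= => /andP[sx xt]; apply: f0.
move: sT tT; rewrite !in_itv/= => /andP[s0 _] /andP[_ tT].
by rewrite (le_trans s0 sx) (le_trans xt tT).
Qed.

Lemma prim_expR (c : R) : prim T (fun t => c * expR (c * t)) (fun t => expR (c * t)).
Proof.
have dE (t : R) : is_derive t (1 : R) (fun t => expR (c * t)) (c * expR (c * t)).
  have h1 : is_derive t (1 : R) (fun t => c * t) c.
    by apply: trigger_derive; rewrite scaler1.
  have := @is_derive1_comp _ expR (fun t => c * t) t _ _ (is_derive_expR _) h1.
  by rewrite mulrC.
have cE : continuous (fun t : R => expR (c * t)).
  by move=> t; apply: differentiable_continuous; apply/derivable1_diffP; case: (dE t).
apply: prim_C1 => //; first exact: continuous_subspaceT.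
by apply: continuous_subspaceT => t; apply: cvgMr; exact: cE.
Qed.

(** Gronwall: the derivative of exp(- M t) e(t) is at most exp(- M t) h(t), hence at most h(t),
    because the weight does not exceed 1 on [0, T]. *)
Lemma energy_bound e' e h (M : R) t : 0 <= M -> prim T e' e ->
  mu.-integrable `[0, T] (EFin \o h) ->
  (forall s, s \in `[0, T] -> 0 <= h s) ->
  (forall s, s \in `[0, T] -> e' s <= M * e s + h s) -> t \in `[0, T] ->
  0 <= e 0 ->
  e t <= expR (M * T) * (e 0 + \int[mu]_(s in `[0, T]) h s).
Proof.
move=> M0 pe ih h0 le tT e0.
have pE := primM (prim_expR (- M)) pe.
have leE s : s \in `[0, T] ->
    - M * expR (- M * s) * e s + expR (- M * s) * e' s <= h s.
  move=> sT; have E1 : expR (- M * s) <= 1.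
    rewrite expR_le1 mulNr oppr_le0 mulr_ge0//.
    by move: sT; rewrite in_itv/= => /andP[].
  have := h0 s sT; have := le s sT; have := expR_ge0 (- M * s).
  move: (expR _) E1 (e s) (e' s) (h s) => E E1 a b c E0 hb c0.
  apply: (@le_trans _ _ (E * c)); last by rewrite ler_piMl.
  have : 0 <= E * (M * a + c - b) by rewrite mulr_ge0// subr_ge0.
  by lra.
have := prim_le pE ih leE tT; rewrite mulr0 expR0 mul1r => h1.
have h2 : \int[mu]_(s in `[0, t]) h s <= \int[mu]_(s in `[0, T]) h s.
  have pH : prim T h (fun t => \int[mu]_(s in `[0, t]) h s).
    by split => // s sT; rewrite set_itv1 Rintegral_set1 add0r.
  apply: (prim_nondecreasing pH) => //; first exact: memT_seg.
  by move: tT; rewrite in_itv/= => /andP[].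
have h3 : e t <= expR (M * t) * (e 0 + \int[mu]_(s in `[0, T]) h s).
  have E0 := expR_gt0 (M * t).
  rewrite -ler_pdivrMl// -expRN -mulNr; apply: (le_trans h1); by rewrite lerD2l.
apply: (le_trans h3); apply: ler_wpM2r; rewrite ?ler_expR.
- by rewrite addr_ge0// Rintegral_ge0// => x /h0.
- by rewrite ler_wpM2l//; move: tT; rewrite in_itv/= => /andP[].
Qed.

(** Gronwall in both time directions, which the two-sided bound on [e'] allows. Equations with data
    at T or at an interior time then need no time reversal. *)
Lemma energy_zero e' e (M t0 t : R) : prim T e' e ->
  (forall s, s \in `[0, T] -> 0 <= e s) ->
  (forall s, s \in `[0, T] -> `|e' s| <= M * e s) ->
  t0 \in `[0, T] -> e t0 = 0 -> t \in `[0, T] -> e t = 0.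
Proof.
move=> pe e0 le t0T et0 tT.
(* The sign [c] is the direction of time: 1 propagates the zero forward with weight exp(- M s), -1
   backward with weight exp(M s). *)
have mono (c : R) : `|c| = 1 -> (c * t0 <= c * t) -> e t <= 0.
  move=> c1 ct.
  have pE := primM (prim_expR (- c * M)) pe.
  have key s : s \in `[0, T] ->
     c * (- c * M * expR (- c * M * s) * e s + expR (- c * M * s) * e' s) <= 0.
    move=> sT; have := le s sT; have := expR_ge0 (- c * M * s).
    move: (expR _) (e s) (e' s) => E a b E0 hb.
    have cc : c * c = 1.
      by rewrite -expr2 -real_normK ?num_real// c1 expr1n.
    rewrite (_ : _ * _ = E * (c * b - (c * c) * (M * a))); last by ring.
    rewrite cc mul1r mulr_ge0_le0// subr_le0 (le_trans _ hb)//.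
    by rewrite (le_trans (ler_norm _))// normrM c1 mul1r.
  have := primZ (- c) pE => pc.
  have {pc key}pc s : s \in `[0, T] ->
      0 <= - c * (- c * M * expR (- c * M * s) * e s + expR (- c * M * s) * e' s).
    by move=> /key; rewrite -oppr_ge0 -mulNr.
  have Ep := expR_gt0 (- c * M * t).
  have [c0|c0] := leP 0 c.
    have c1' : c = 1 by rewrite -c1 ger0_norm.
    have tt : t0 <= t by move: ct; rewrite c1' !mul1r.
    have := prim_nondecreasing (primZ (- c) pE) pc t0T tT tt.
    by rewrite et0 mulr0 mulr0 c1' mulN1r oppr_ge0 pmulr_rle0// -c1'.
  have c1' : c = -1 by rewrite -[LHS]opprK -(ltr0_norm c0) c1.
  have tt : t <= t0 by move: ct; rewrite c1' !mulN1r lerN2.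
  have := prim_nondecreasing (primZ (- c) pE) pc tT t0T tt.
  by rewrite et0 mulr0 mulr0 {1}c1' opprK mul1r pmulr_rle0.
apply/eqP; rewrite eq_le e0// andbT.
have [tt|/ltW tt] := leP t0 t.
  by apply: (mono 1); rewrite ?normr1// !mul1r.
by apply: (mono (-1)); rewrite ?normrN1// !mulN1r lerN2.
Qed.

End PrimCalculus.

(** * Matrix-valued paths and linear differential equations *)

Section MatrixPaths.
Context {R : realType}.
Notation mu := (@lebesgue_measure R).
Variables (T : R) (T0 : 0 <= T).

(** Entrywise, so that the scalar lemmas apply as they are; [mcont_mx] relates it to continuity for
    the matrix topology. *)
Definition mcont {p q : nat} (F : R -> 'M[R]_(p, q)) : Prop :=
  forall i j, {within `[0, T], continuous (fun t => F t i j)}.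

Definition mprim {p q : nat} (f F : R -> 'M[R]_(p, q)) : Prop :=
  forall i j, prim T (fun t => f t i j) (fun t => F t i j).

Lemma within_continuousM (f g : R -> R) : {within `[0, T], continuous f} ->
  {within `[0, T], continuous g} -> {within `[0, T], continuous (fun t => f t * g t)}.
Proof. by move=> cf cg x; apply: cvgM; [exact: cf|exact: cg]. Qed.

Lemma within_continuous_sum (I : Type) (s : seq I) (f : I -> R -> R) :
  (forall i, {within `[0, T], continuous (f i)}) ->
  {within `[0, T], continuous (fun t => \sum_(i <- s) f i t)}.
Proof.
move=> cf; elim: s => [|i s IH].
  rewrite (_ : (fun _ => _) = cst 0); last by apply/funext => x; rewrite big_nil.
  by apply: continuous_subspaceT => x; exact: cst_continuous.
rewrite (_ : (fun _ => _) = f i + (fun t => \sum_(i <- s) f i t)).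
  exact: within_continuousD.
by apply/funext => x; rewrite big_cons.
Qed.

Lemma mcont_cst p q (A : 'M[R]_(p, q)) : mcont (fun=> A).
Proof. by move=> i j; apply: continuous_subspaceT => x; exact: cst_continuous. Qed.

Lemma mcontD p q (F G : R -> 'M[R]_(p, q)) :
  mcont F -> mcont G -> mcont (fun t => F t + G t).
Proof.
move=> cF cG i j; rewrite (_ : (fun _ => _) = (fun t => F t i j) + (fun t => G t i j)).
  exact: within_continuousD.
by apply/funext => x; rewrite mxE.
Qed.

Lemma mcontN p q (F : R -> 'M[R]_(p, q)) : mcont F -> mcont (fun t => - F t).
Proof.
move=> cF i j; rewrite (_ : (fun _ => _) = (fun t => - (F t i j))).
  by move=> x; apply: cvgN; exact: cF.
by apply/funext => x; rewrite mxE.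
Qed.

Lemma mcontM p q r (F : R -> 'M[R]_(p, q)) (G : R -> 'M[R]_(q, r)) :
  mcont F -> mcont G -> mcont (fun t => F t *m G t).
Proof.
move=> cF cG i j; rewrite (_ : (fun _ => _) = (fun t => \sum_k F t i k * G t k j)).
  by apply: within_continuous_sum => k; apply: within_continuousM.
by apply/funext => x; rewrite mxE.
Qed.

Lemma mcont_bounded p q (F : R -> 'M[R]_(p, q)) : mcont F ->
  exists M : R, 0 < M /\ forall t i j, t \in `[0, T] -> `|F t i j| <= M.
Proof.
move=> cF.
have /(_ _)/cid-/all_sig[B BP] : forall ij : 'I_p * 'I_q, exists M : R, 0 < M /\
    forall t, t \in `[0, T] -> `|F t ij.1 ij.2| <= M.
  by move=> ij; apply: within_continuous_bounded => //; exact: cF.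
exists (1 + \sum_ij B ij); split.
  by rewrite ltr_wpDr// sumr_ge0// => ij _; apply: ltW; case: (BP ij).
move=> t i j tT; apply: (le_trans ((BP (i, j)).2 t tT)).
rewrite (bigD1 (i, j))//= addrCA lerDl addr_ge0// sumr_ge0// => ij _.
by apply: ltW; case: (BP ij).
Qed.

Lemma mcont_prim p q (f F : R -> 'M[R]_(p, q)) : mprim f F -> mcont F.
Proof. by move=> h i j; apply: prim_within_continuous (h i j). Qed.

Lemma eq_mprim p q (f g F G : R -> 'M[R]_(p, q)) :
  {in `[0, T], f =1 g} -> {in `[0, T], F =1 G} -> mprim f F -> mprim g G.
Proof.
move=> fg FG h i j; apply: eq_prim (h i j) => t tT; first by rewrite fg.
by rewrite FG.
Qed.

Lemma mprim_cst p q (A : 'M[R]_(p, q)) : mprim (fun=> 0) (fun=> A).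
Proof. by move=> i j; apply: eq_prim (prim_cst T (A i j)) => t _; rewrite ?mxE. Qed.

Lemma mprimD p q (f F g G : R -> 'M[R]_(p, q)) : mprim f F -> mprim g G ->
  mprim (fun t => f t + g t) (fun t => F t + G t).
Proof.
move=> hf hg i j; apply: eq_prim (primD (hf i j) (hg i j)) => t _; by rewrite mxE.
Qed.

Lemma mprimN p q (f F : R -> 'M[R]_(p, q)) : mprim f F ->
  mprim (fun t => - f t) (fun t => - F t).
Proof. by move=> hf i j; apply: eq_prim (primN (hf i j)) => t _; rewrite mxE. Qed.

Lemma mprimB p q (f F g G : R -> 'M[R]_(p, q)) : mprim f F -> mprim g G ->
  mprim (fun t => f t - g t) (fun t => F t - G t).
Proof. by move=> hf hg; apply: mprimD => //; exact: mprimN. Qed.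

Lemma mprimZ p q (c : R) (f F : R -> 'M[R]_(p, q)) : mprim f F ->
  mprim (fun t => c *: f t) (fun t => c *: F t).
Proof. by move=> hf i j; apply: eq_prim (primZ c (hf i j)) => t _; rewrite mxE. Qed.

Lemma mprim_tr p q (f F : R -> 'M[R]_(p, q)) : mprim f F ->
  mprim (fun t => (f t)^T) (fun t => (F t)^T).
Proof. by move=> hf i j; apply: eq_prim (hf j i) => t _; rewrite mxE. Qed.

Lemma mprimM p q r (f F : R -> 'M[R]_(p, q)) (g G : R -> 'M[R]_(q, r)) :
  mprim f F -> mprim g G ->
  mprim (fun t => f t *m G t + F t *m g t) (fun t => F t *m G t).
Proof.
move=> hf hg i j.
apply: eq_prim (prim_sum (index_enum 'I_q) (fun k => primM T0 (hf i k) (hg k j))) => t _.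
  by rewrite big_split/= !mxE.
by rewrite mxE.
Qed.

Lemma mprimMl p q r (A : 'M[R]_(p, q)) (g G : R -> 'M[R]_(q, r)) : mprim g G ->
  mprim (fun t => A *m g t) (fun t => A *m G t).
Proof.
move=> hg; apply: eq_mprim (mprimM (mprim_cst A) hg) => t _ //.
by rewrite mul0mx add0r.
Qed.

Lemma mprimMr p q r (f F : R -> 'M[R]_(p, q)) (A : 'M[R]_(q, r)) : mprim f F ->
  mprim (fun t => f t *m A) (fun t => F t *m A).
Proof.
move=> hf; apply: eq_mprim (mprimM hf (mprim_cst A)) => t _ //.
by rewrite mulmx0 addr0.
Qed.

Lemma mprim_constant p q (F : R -> 'M[R]_(p, q)) s t : mprim (fun=> 0) F ->
  s \in `[0, T] -> t \in `[0, T] -> F s = F t.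
Proof.
move=> h.
suff E r : r \in `[0, T] -> F r = F 0 by move=> /E -> /E ->.
move=> rT; apply/matrixP => i j; rewrite ((h i j).2 r rT).
under eq_Rintegral do rewrite mxE.
by rewrite /Rintegral integral0 addr0.
Qed.

(** The squared Frobenius norm, used as energy because the product rule makes it absolutely
    continuous along a path. *)
Definition sqF {p q : nat} (D : 'M[R]_(p, q)) : R := \sum_i \sum_j D i j ^+ 2.

Lemma sqF_ge0 p q (D : 'M[R]_(p, q)) : 0 <= sqF D.
Proof. by apply: sumr_ge0 => i _; apply: sumr_ge0 => j _; exact: sqr_ge0. Qed.

Lemma sqF_ge p q (D : 'M[R]_(p, q)) i j : D i j ^+ 2 <= sqF D.
Proof.
rewrite /sqF (bigD1 i)//= (bigD1 j)//= -addrA lerDl addr_ge0//.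
  by apply: sumr_ge0 => k _; exact: sqr_ge0.
by apply: sumr_ge0 => k _; apply: sumr_ge0 => l _; exact: sqr_ge0.
Qed.

Lemma sqF_eq0 p q (D : 'M[R]_(p, q)) : sqF D = 0 -> D = 0.
Proof.
move=> D0; apply/matrixP => i j; rewrite mxE; apply/eqP.
by rewrite -sqrf_eq0 eq_le sqr_ge0 andbT -D0 sqF_ge.
Qed.

Lemma prim_sqF p q (f F : R -> 'M[R]_(p, q)) : mprim f F ->
  prim T (fun t => \sum_i \sum_j 2 * (F t i j * f t i j)) (fun t => sqF (F t)).
Proof.
move=> h; apply: prim_sum => i; apply: prim_sum => j.
apply: eq_prim (primM T0 (h i j) (h i j)) => t _; last by rewrite expr2.
by rewrite mulrC -mulr2n mulr_natl.
Qed.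

(** Each of the [p] products [D i j * D k j] is at most [sqF D] in absolute value, by the inequality
    between arithmetic and geometric means. *)
Lemma linear_mx_entry_bound p q (A : 'M[R]_p) (D : 'M[R]_(p, q)) (M : R) i j :
  (forall i j, `|A i j| <= M) ->
  `|2 * (D i j * (A *m D) i j)| <= 2 * p%:R * M * sqF D.
Proof.
move=> AM; rewrite mxE mulr_sumr mulr_sumr.
apply: (le_trans (ler_norm_sum _ _ _)).
have -> : 2 * p%:R * M * sqF D = \sum_(k < p) 2 * M * sqF D.
  by rewrite sumr_const card_ord -mulr_natl; ring.
apply: ler_sum => k _.
have h1 := sqF_ge D i j; have h2 := sqF_ge D k j; have h3 := AM i k.
have M0 : 0 <= M := le_trans (normr_ge0 _) h3.
rewrite !normrM (ger0_norm (ler0n R 2)) -mulrA ler_wpM2l//.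
have : `|D i j| * `|D k j| <= sqF D.
  have : 0 <= (`|D i j| - `|D k j|) ^+ 2 by exact: sqr_ge0.
  rewrite sqrrB !real_normK ?num_real// => ?; lra.
move=> h4; rewrite mulrCA; apply: ler_pM => //; exact: mulr_ge0.
Qed.

(** [energy_zero] for the energy [sqF D]. Applied to a difference, this is the usual way below to
    show that two paths coincide. *)
Lemma linear_unique p q (A : R -> 'M[R]_p) (D : R -> 'M[R]_(p, q)) t0 t :
  mcont A -> mprim (fun t => A t *m D t) D -> t0 \in `[0, T] -> D t0 = 0 ->
  t \in `[0, T] -> D t = 0.
Proof.
move=> /mcont_bounded[M [M0 AM]] hD t0T D0 tT; apply: sqF_eq0.
apply: (energy_zero T0 (M := \sum_(i < p) \sum_(j < q) (2 * p%:R * M)) (prim_sqF hD) _ _ t0T) => //.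
- by move=> s _; exact: sqF_ge0.
- move=> s sT; rewrite mulr_suml; apply: (le_trans (ler_norm_sum _ _ _)).
  apply: ler_sum => i _; rewrite mulr_suml; apply: (le_trans (ler_norm_sum _ _ _)).
  by apply: ler_sum => j _; apply: linear_mx_entry_bound => k l; exact: AM.
by rewrite D0 /sqF big1// => i _; rewrite big1// => j _; rewrite mxE expr0n.
Qed.

Lemma sqF_sqnorm k (z : 'cV[R]_k) : sqF z = sqnorm z.
Proof. by apply: eq_bigr => i _; rewrite big_ord1. Qed.

(** The order of quantifiers is the point: [C] depends on [A] and [T] but not on the forcing [g], so
    it can enter a coercivity constant or a bound uniform in the sample. *)
Lemma linear_energy_bound k (A : R -> 'M[R]_k) : mcont A ->
  exists C : R, 0 < C /\ forall (z g : R -> 'cV[R]_k),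
    mprim (fun t => A t *m z t + g t) z -> z 0 = 0 ->
    mu.-integrable `[0, T] (EFin \o (fun t => sqnorm (g t))) ->
    forall t, t \in `[0, T] ->
      sqnorm (z t) <= C * \int[mu]_(s in `[0, T]) sqnorm (g s).
Proof.
move=> /mcont_bounded[M [M0 AM]].
(* The double sum bounds the contribution of [A]; the last 1 comes from splitting the forcing term
   as 2 z g <= z^2 + g^2. *)
pose K : R := \sum_(i < k) \sum_(j < 1) (2 * k%:R * M) + 1.
exists (expR (K * T)); split; first exact: expR_gt0.
move=> z g hz z0 ig t tT.
rewrite -[X in X <= _]sqF_sqnorm.
have K0 : 0 <= K.
  rewrite addr_ge0// sumr_ge0// => i _; apply: sumr_ge0 => j _.
  by rewrite mulr_ge0// ltW.
have gn0 s : 0 <= sqnorm (g s) by rewrite -sqF_sqnorm sqF_ge0.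
have := energy_bound T0 (t := t) K0 (prim_sqF hz) ig (fun s _ => gn0 s).
rewrite z0 (_ : sqF 0 = 0); last first.
  by rewrite /sqF big1// => i _; rewrite big1// => j _; rewrite mxE expr0n.
rewrite add0r; apply => // s sT.
rewrite [X in X + sqnorm _]mulrDl mul1r -addrA mulr_suml {2}/sqF -sqF_sqnorm -!big_split/=.
apply: ler_sum => i _; rewrite mulr_suml -!big_split/=.
apply: ler_sum => j _; rewrite [X in z s i j * X]mxE !mulrDr; apply: lerD.
  apply: (le_trans (ler_norm _)); apply: linear_mx_entry_bound => a b; exact: AM.
have : 0 <= (z s i j - g s i j) ^+ 2 by exact: sqr_ge0.
rewrite sqrrB => ?; lra.
Qed.

End MatrixPaths.

(** * Matrix exponential and derivatives *)

Section MatrixExponential.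
Context {R : realType}.

Lemma cvgn_sum (I : Type) (s : seq I) (f : I -> nat -> R) (l : I -> R) :
  (forall i, f i n @[n --> \oo] --> l i) ->
  (\sum_(i <- s) f i n) @[n --> \oo] --> \sum_(i <- s) l i.
Proof.
move=> h; elim: s => [|i s IH].
  rewrite big_nil; under eq_fun do rewrite big_nil; exact: cvg_cst.
rewrite big_cons; under eq_fun do rewrite big_cons; exact: cvgD.
Qed.

Lemma cvg_mx_entry p q (u : nat -> 'M[R]_(p, q)) (L : 'M[R]_(p, q)) :
  (forall i j, u n i j @[n --> \oo] --> L i j) -> u n @[n --> \oo] --> L.
Proof.
move=> h; apply/cvgrPdist_le => /= e e0; near=> n.
have hn : forall ij : 'I_p * 'I_q, `|L ij.1 ij.2 - u n ij.1 ij.2| <= e.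
  near: n; apply: filter_forall => -[a b] /=.
  exact: ((cvgrPdist_le _ _).1 (h a b) e e0).
rewrite /Num.Def.normr/= mx_normrE (bigmax_le _ (ltW e0))//= => ij _.
by rewrite !mxE.
Unshelve. all: by end_near. Qed.

(** Comparison with C times the exponential series at B |x|. *)
Lemma geometric_pseries_cvg (v : nat -> R) (C B x : R) : 0 <= B ->
  (forall m, `|v m| <= C * B ^+ m) ->
  cvgn (pseries (fun m => (m`!%:R)^-1 * v m) x).
Proof.
move=> B0 hv; apply: normed_cvg.
have C0 : 0 <= C by have := le_trans (normr_ge0 _) (hv 0); rewrite expr0 mulr1.
apply: (@series_le_cvg _ (fun m => `|(m`!%:R)^-1 * v m * x ^+ m|) (fun m => C * exp_coeff (B * `|x|) m)).
- by move=> m; exact: normr_ge0.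
- by move=> m; rewrite mulr_ge0// exp_coeff_ge0// mulr_ge0.
- move=> m; rewrite !normrM normfV normr_nat normrX /exp_coeff/= exprMn.
  rewrite -mulrA mulrC ler_pdivrMr ?ltr0n ?fact_gt0//.
  rewrite mulrA divfK ?pnatr_eq0 -?lt0n ?fact_gt0// mulrA ler_wpM2r// ?exprn_ge0//.
have := @is_cvg_series_exp_coeff R (B * `|x|).
rewrite /series/=; under [X in _ -> cvgn X]eq_fun do rewrite -mulr_sumr.
exact: is_cvgMr.
Qed.

Section fixed_matrix.
Variables (k : nat) (M : 'M[R]_k).

(** Coefficients of one entry of the exponential as a scalar power series in [s], so that scalar
    termwise differentiation applies. [B] dominates the absolute row sums of [M], hence [B ^+ m] the
    entries of [M ^+ m]. *)
Let c i j m : R := (m`!%:R)^-1 * (M ^+ m) i j.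
Let B := 1 + \sum_i \sum_j `|M i j|.

Let B0 : 0 <= B.
Proof. by rewrite addr_ge0// sumr_ge0// => i _; rewrite sumr_ge0. Qed.

Let powZ s m : (s *: M) ^+ m = s ^+ m *: M ^+ m.
Proof.
elim: m => [|m IH]; first by rewrite !expr0 scale1r.
by rewrite !exprS IH -[LHS]/((s *: M) *m (s ^+ m *: M ^+ m)) -scalemxAl -scalemxAr scalerA.
Qed.

Let powB m i j : `|(M ^+ m) i j| <= B ^+ m.
Proof.
elim: m i j => [|m IH] i j.
  by rewrite !expr0 mxE; case: (i == j); rewrite ?normr1 ?normr0.
rewrite !exprS mxE; apply: (le_trans (ler_norm_sum _ _ _)).
apply: (@le_trans _ _ (\sum_l `|M i l| * B ^+ m)).
  by apply: ler_sum => l _; rewrite normrM ler_wpM2l.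
rewrite -mulr_suml ler_wpM2r ?exprn_ge0//.
rewrite /B [X in _ <= 1 + X](bigD1 i)//= addrCA lerDl addr_ge0//.
by rewrite sumr_ge0// => a _; rewrite sumr_ge0.
Qed.

Let seriesE s n i j :
  (series (fun m : nat => (m`!%:R)^-1 *: (s *: M) ^+ m) n) i j = pseries (c i j) s n.
Proof.
rewrite /series/= summxE; apply: eq_bigr => m _.
by rewrite powZ !mxE /c mulrA [X in _ = X]mulrAC.
Qed.

Let cvg_c i j s : cvgn (pseries (c i j) s).
Proof. by apply: (@geometric_pseries_cvg _ 1 B) => // m; rewrite mul1r. Qed.

(** Formal differentiation only raises the matrix power by one and leaves the factorial at [m], so
    the geometric bound persists. Termwise differentiation asks for convergence of the first and
    second formal derivatives. *)
Let cvg_dc i j s : cvgn (pseries (pseries_diffs (c i j)) s).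
Proof.
rewrite (_ : pseries_diffs _ = fun m => (m`!%:R)^-1 * (M ^+ m.+1) i j).
  by apply: (@geometric_pseries_cvg _ B B) => // m; rewrite -exprS.
apply/funext => m; rewrite /pseries_diffs /c factS natrM invfM !mulrA divff ?mul1r//.
Qed.

Let cvg_ddc i j s : cvgn (pseries (pseries_diffs (pseries_diffs (c i j))) s).
Proof.
rewrite (_ : pseries_diffs _ = fun m => (m`!%:R)^-1 * (M ^+ m.+2) i j).
  by apply: (@geometric_pseries_cvg _ (B * B) B) => // m; rewrite -mulrA -!exprS.
apply/funext => m; rewrite /pseries_diffs /c !factS !natrM.
have f0 : m`!%:R != 0 :> R by rewrite pnatr_eq0 -lt0n fact_gt0.
by field; rewrite f0 /= !lt0r_neq0 ?ltr_wpDr.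
Qed.

Lemma expmxE s i j : expmx (s *: M) i j = limn (pseries (c i j) s).
Proof.
rewrite /expmx.
have -> : lim (series (fun m : nat => (m`!%:R)^-1 *: (s *: M) ^+ m) @ \oo) =
    \matrix_(i, j) limn (pseries (c i j) s).
  apply/cvg_lim => //; apply: cvg_mx_entry => a b; rewrite mxE.
  by under eq_fun do rewrite seriesE; exact: cvg_c.
by rewrite mxE.
Qed.

Lemma expmx0 : expmx (0 *: M) = 1%:M.
Proof.
apply/matrixP => i j; rewrite expmxE.
apply/cvg_lim => //; rewrite -(cvg_shiftS (pseries (c i j) 0)).
apply: cvg_near_cst; near=> n; rewrite /pseries /series/= big_nat_recl//= big1.
  by rewrite /c expr0 fact0 invr1 !mul1r mulr1 addr0.
by move=> m _; rewrite exprS mul0r mulr0.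
Unshelve. all: by end_near. Qed.

Lemma is_derive_expmx s i j :
  is_derive s (1 : R) (fun s => expmx (s *: M) i j) ((expmx (s *: M) *m M) i j).
Proof.
rewrite (_ : (fun s => _) = fun s => limn (pseries (c i j) s)); last first.
  by apply/funext => x; exact: expmxE.
have -> : (expmx (s *: M) *m M) i j = limn (pseries (pseries_diffs (c i j)) s).
  apply/esym/cvg_lim => //; rewrite mxE.
  have -> : pseries (pseries_diffs (c i j)) s = fun n => \sum_l pseries (c i l) s n * M l j.
    apply/funext => n; rewrite /pseries/=.
    under [RHS]eq_bigr do rewrite mulr_suml.
    rewrite exchange_big/=; apply: eq_bigr => m _.
    rewrite /pseries_diffs /c factS natrM invfM !mulrA divff ?mul1r//.
    rewrite exprSr [X in _ * X * _]mxE mulr_sumr mulr_suml.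
    by apply: eq_bigr => l _; ring.
  apply: cvgn_sum => l; apply: cvgMl; rewrite expmxE; exact: cvg_c.
(* Convergence holds at every point, so any radius larger than |s| serves. *)
apply: (@pseries_snd_diffs _ _ (`|s| + 1)); [exact: cvg_c|exact: cvg_dc|exact: cvg_ddc|].
by rewrite [X in _ < X]ger0_norm ?addr_ge0// ltrDl.
Qed.

End fixed_matrix.
End MatrixExponential.

(** * Entrywise derivatives of matrix paths *)

Section MatrixDerivative.
Context {R : realType}.

Definition mderiv {p q : nat} (F : R -> 'M[R]_(p, q)) (t : R) (D : 'M[R]_(p, q)) :=
  forall i j, is_derive t (1 : R) (fun t => F t i j) (D i j).

Lemma is_derive_mderiv p q (F : R -> 'M[R]_(p, q)) t D :
  is_derive t (1 : R) F D <-> mderiv F t D.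
Proof.
split=> [[dF <-] i j|h].
  split; first exact: (derivable_mxP F t 1).1.
  by rewrite derive_mx// mxE.
have dF : derivable F t 1 by apply/derivable_mxP => i j; case: (h i j).
split=> //; rewrite derive_mx//; apply/matrixP => i j; rewrite mxE.
by case: (h i j).
Qed.

Lemma mderiv_cst p q (A : 'M[R]_(p, q)) t : mderiv (fun=> A) t 0.
Proof. by move=> i j; rewrite mxE; exact: is_derive_cst. Qed.

Lemma is_derive_bigsum (I : Type) (s : seq I) (f : I -> R -> R) (d : I -> R) t :
  (forall i, is_derive t (1 : R) (f i) (d i)) ->
  is_derive t (1 : R) (fun t => \sum_(i <- s) f i t) (\sum_(i <- s) d i).
Proof.
move=> h; elim: s => [|i s IH].
  rewrite big_nil (_ : (fun _ => _) = cst 0); first exact: is_derive_cst.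
  by apply/funext => x; rewrite big_nil.
rewrite big_cons (_ : (fun _ => _) = f i + (fun t => \sum_(i <- s) f i t)).
  exact: is_deriveD.
by apply/funext => x; rewrite big_cons.
Qed.

Lemma mderivD p q (F G : R -> 'M[R]_(p, q)) t D E :
  mderiv F t D -> mderiv G t E -> mderiv (fun t => F t + G t) t (D + E).
Proof.
move=> hF hG i j; rewrite mxE (_ : (fun _ => _) = (fun t => F t i j) + (fun t => G t i j)).
  exact: is_deriveD.
by apply/funext => x; rewrite mxE.
Qed.

Lemma mderivN p q (F : R -> 'M[R]_(p, q)) t D :
  mderiv F t D -> mderiv (fun t => - F t) t (- D).
Proof.
move=> hF i j; rewrite mxE (_ : (fun _ => _) = - (fun t => F t i j)).
  exact: is_deriveN.
by apply/funext => x; rewrite mxE.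
Qed.

Lemma mderiv_tr p q (F : R -> 'M[R]_(p, q)) t D :
  mderiv F t D -> mderiv (fun t => (F t)^T) t D^T.
Proof.
move=> hF i j; rewrite mxE (_ : (fun _ => _) = (fun t => F t j i)); first exact: hF.
by apply/funext => x; rewrite mxE.
Qed.

Lemma mderivM p q r (F : R -> 'M[R]_(p, q)) (G : R -> 'M[R]_(q, r)) t D E :
  mderiv F t D -> mderiv G t E ->
  mderiv (fun t => F t *m G t) t (D *m G t + F t *m E).
Proof.
move=> hF hG i j; rewrite (_ : (fun _ => _) = (fun t => \sum_k F t i k * G t k j)); last first.
  by apply/funext => x; rewrite mxE.
rewrite !mxE -big_split/=; apply: is_derive_bigsum => k.
have := is_deriveM (hF i k) (hG k j).
by rewrite /GRing.scale/= addrC [G t k j * _]mulrC.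
Qed.

Lemma mderivMl p q r (A : 'M[R]_(p, q)) (G : R -> 'M[R]_(q, r)) t E :
  mderiv G t E -> mderiv (fun t => A *m G t) t (A *m E).
Proof. by move=> /(mderivM (mderiv_cst A t)); rewrite mul0mx add0r. Qed.

Lemma mderivMr p q r (F : R -> 'M[R]_(p, q)) (A : 'M[R]_(q, r)) t D :
  mderiv F t D -> mderiv (fun t => F t *m A) t (D *m A).
Proof. by move=> /(mderivM)/(_ (mderiv_cst A t)); rewrite mulmx0 addr0. Qed.

Lemma mderivZ p q (f : R -> R) (F : R -> 'M[R]_(p, q)) t d D :
  is_derive t (1 : R) f d -> mderiv F t D ->
  mderiv (fun t => f t *: F t) t (d *: F t + f t *: D).
Proof.
move=> hf hF i j; rewrite (_ : (fun _ => _) = (fun t => f t * F t i j)); last first.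
  by apply/funext => x; rewrite mxE.
rewrite !mxE; have := is_deriveM hf (hF i j).
by rewrite /GRing.scale/= addrC [F t i j * _]mulrC.
Qed.

Lemma mderiv_rev p q (F : R -> 'M[R]_(p, q)) (T t : R) D :
  mderiv F (T - t) D -> mderiv (fun t => F (T - t)) t (- D).
Proof.
move=> hF i j.
have h1 : is_derive t (1 : R) (fun t => T - t) (- 1).
  by have := is_deriveB (is_derive_cst T t (1 : R)) (is_derive_id t (1 : R)); rewrite sub0r.
have := @is_derive1_comp _ (fun t => F t i j) (fun t => T - t) t _ _ (hF i j) h1.
by rewrite mulrN1 mxE.
Qed.

Lemma mderiv_uniq p q (F : R -> 'M[R]_(p, q)) t D E :
  mderiv F t D -> mderiv F t E -> D = E.
Proof.
move=> hD hE; apply/matrixP => i j; case: (hD i j) => _ <-; by case: (hE i j).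
Qed.

Lemma eq_mderiv p q (F G : R -> 'M[R]_(p, q)) t D E :
  F =1 G -> D = E -> mderiv F t D -> mderiv G t E.
Proof. by move=> /funext -> ->. Qed.

Lemma derivable_bigprod (I : Type) (s : seq I) (f : I -> R -> R) t :
  (forall i, derivable (f i) t (1 : R)) ->
  derivable (fun t => \prod_(i <- s) f i t) t (1 : R).
Proof.
move=> h; elim: s => [|i s IH].
  rewrite (_ : (fun _ => _) = cst 1); first exact: derivable_cst.
  by apply/funext => x; rewrite big_nil.
rewrite (_ : (fun _ => _) = f i * (fun t => \prod_(i <- s) f i t)).
  exact: derivableM.
by apply/funext => x; rewrite big_cons.
Qed.

Lemma derivable_bigsum (I : Type) (s : seq I) (f : I -> R -> R) t :
  (forall i, derivable (f i) t (1 : R)) ->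
  derivable (fun t => \sum_(i <- s) f i t) t (1 : R).
Proof.
move=> h; have /(is_derive_bigsum s)[] // : forall i, is_derive t (1 : R) (f i) ('D_1 (f i) t).
by move=> i; split.
Qed.

Lemma derivable_det k (F : R -> 'M[R]_k) t :
  (forall i j, derivable (fun t => F t i j) t (1 : R)) ->
  derivable (fun t => \det (F t)) t (1 : R).
Proof.
move=> h; rewrite /determinant; apply: derivable_bigsum => s.
apply: derivableM; first exact: derivable_cst.
by apply: derivable_bigprod => i; exact: h.
Qed.

(** Cofactors are determinants of submatrices. Together with [derivable_det] this makes the inverse,
    written by Cramer's rule, differentiable. *)
Lemma derivable_adj k (F : R -> 'M[R]_k) t :
  (forall i j, derivable (fun t => F t i j) t (1 : R)) ->
  forall i j, derivable (fun t => \adj (F t) i j) t (1 : R).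
Proof.
move=> h i j.
rewrite (_ : (fun _ => _) = fun t => cofactor (F t) j i); last first.
  by apply/funext => x; rewrite mxE.
rewrite /cofactor; apply: derivableM; first exact: derivable_cst.
apply: derivable_det => a b.
rewrite (_ : (fun _ => _) = fun t => F t (lift j a) (lift i b)); first exact: h.
by apply/funext => x; rewrite !mxE.
Qed.

Lemma mderiv_continuous p q (F : R -> 'M[R]_(p, q)) t D :
  mderiv F t D -> forall i j, {for t, continuous (fun t => F t i j)}.
Proof.
by move=> h i j; apply: differentiable_continuous; apply/derivable1_diffP; case: (h i j).
Qed.

Lemma mderiv_mcont (T : R) p q (F f : R -> 'M[R]_(p, q)) :
  (forall t, t \in `[0, T] -> mderiv F t (f t)) -> mcont T F.
Proof.
move=> h i j; apply: continuous_in_subspaceT => t tT.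
exact: mderiv_continuous (h t (set_mem tT)) i j.
Qed.

Lemma mprim_C1 (T : R) p q (f F : R -> 'M[R]_(p, q)) : 0 <= T ->
  mcont T F -> mcont T f ->
  (forall t, t \in `]0, T[ -> mderiv F t (f t)) -> mprim T f F.
Proof. by move=> T0 cF cf h i j; apply: prim_C1 => // t /h. Qed.

Lemma mcont_mx (T : R) p q (F : R -> 'M[R]_(p, q)) :
  {within `[0, T], continuous F} <-> mcont T F.
Proof.
split=> [cF i j|cF].
  apply: (@within_continuous_comp _ _ _ _ F (fun M : 'M[R]_(p, q) => M i j)) => //.
  by move=> M _; exact: coord_continuous.
move=> t; apply/cvgrPdist_le => /= e e0; near=> s.
have hn : forall ij : 'I_p * 'I_q, `|F t ij.1 ij.2 - F s ij.1 ij.2| <= e.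
  near: s; apply: filter_forall => -[a b] /=.
  exact: ((cvgrPdist_le _ _).1 (cF a b t) e e0).
rewrite /Num.Def.normr/= mx_normrE (bigmax_le _ (ltW e0))//= => ij _.
by rewrite !mxE.
Unshelve. all: by end_near. Qed.

End MatrixDerivative.

(** * Hamiltonian systems and Riccati equations *)

Section Hamiltonian.
Context {R : realType}.
Variables (T : R) (T0 : 0 <= T) (k : nat) (a b c : 'M[R]_k).
Hypotheses (bsym : b^T = b) (csym : c^T = c).

Definition ham_mx : 'M[R]_(k + k) := block_mx a b c (- a^T).

Definition ham_V (s : R) : 'M[R]_k :=
  row_mx 0 1%:M *m expmx (s *: ham_mx) *m (row_mx 0 1%:M)^T.

Definition ham_X (t : R) : 'M[R]_k := (ham_V (T - t))^T.

(** The lower block row of the exponential satisfies E' = E [ham_mx]. Reversing time and transposing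
    turns right multiplication into left multiplication; the minus sign on the lower left block then
    gives X' = a X + b Y and Y' = c X - a^T Y. *)
Definition ham_Y (t : R) : 'M[R]_k :=
  - (row_mx 0 1%:M *m expmx ((T - t) *: ham_mx) *m (row_mx 1%:M 0)^T)^T.

(** The derivative of Y X^-1, expressed through P = Y X^-1, when (X, Y) solves the Hamiltonian
    system. *)
Definition riccati (P : 'M[R]_k) : 'M[R]_k :=
  - a^T *m P - P *m a - P *m b *m P + c.

Let mderiv_exp s : mderiv (fun s => expmx (s *: ham_mx)) s (expmx (s *: ham_mx) *m ham_mx).
Proof. by move=> i j; exact: is_derive_expmx. Qed.

Let ham2 : ham_mx *m (row_mx 0 1%:M)^T = (row_mx 1%:M 0)^T *m b - (row_mx 0 1%:M)^T *m a^T.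
Proof.
rewrite /ham_mx !tr_row_mx !trmx1 !trmx0 mul_block_col !mul_col_mx !mul1mx !mul0mx.
by rewrite !mulmx0 !mulmx1 !add0r opp_col_mx add_col_mx oppr0 addr0 add0r.
Qed.

Let ham1 : ham_mx *m (row_mx 1%:M 0)^T = (row_mx 1%:M 0)^T *m a + (row_mx 0 1%:M)^T *m c.
Proof.
rewrite /ham_mx !tr_row_mx !trmx1 !trmx0 mul_block_col !mul_col_mx !mul1mx !mul0mx.
by rewrite !mulmx0 !mulmx1 !addr0 add_col_mx addr0 add0r.
Qed.

Lemma ham_X_deriv t : mderiv ham_X t (a *m ham_X t + b *m ham_Y t).
Proof.
have h := mderiv_tr (mderiv_rev (mderivMr (row_mx 0 1%:M)^T
  (mderivMl (row_mx 0 1%:M) (mderiv_exp (T - t))))).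
apply: eq_mderiv h => //.
rewrite -!mulmxA ham2 /ham_X /ham_V /ham_Y !mulmxDr !mulmxN.
rewrite opprD opprK !linearD/= !linearN/= !mulmxA !trmx_mul !trmxK bsym.
by rewrite addrC !mulmxA.
Qed.

Lemma ham_Y_deriv t : mderiv ham_Y t (c *m ham_X t - a^T *m ham_Y t).
Proof.
have h := mderivN (mderiv_tr (mderiv_rev (mderivMr (row_mx 1%:M 0)^T
  (mderivMl (row_mx 0 1%:M) (mderiv_exp (T - t)))))).
apply: eq_mderiv h => //.
rewrite -!mulmxA ham1 /ham_X /ham_V /ham_Y !mulmxDr !mulmxN.
rewrite !linearN/= opprK !linearD/= !mulmxA !trmx_mul !trmxK csym opprK.
by rewrite addrC !mulmxA.
Qed.

Lemma ham_V0 : ham_V 0 = 1%:M.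
Proof.
by rewrite /ham_V expmx0 mulmx1 tr_row_mx trmx0 trmx1 mul_row_col mul0mx mul1mx add0r.
Qed.

Lemma ham_XT : ham_X T = 1%:M.
Proof. by rewrite /ham_X subrr ham_V0 trmx1. Qed.

Lemma ham_YT : ham_Y T = 0.
Proof.
rewrite /ham_Y subrr expmx0 mulmx1 tr_row_mx trmx0 trmx1 mul_row_col mul0mx mulmx0 add0r.
by rewrite trmx0 oppr0.
Qed.

Lemma ham_X_mcont : mcont T ham_X.
Proof. by apply: mderiv_mcont => t _; exact: ham_X_deriv. Qed.

Lemma ham_Y_mcont : mcont T ham_Y.
Proof. by apply: mderiv_mcont => t _; exact: ham_Y_deriv. Qed.

Lemma ham_X_mprim : mprim T (fun t => a *m ham_X t + b *m ham_Y t) ham_X.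
Proof.
apply: mprim_C1 => //; first exact: ham_X_mcont; last by move=> t _; exact: ham_X_deriv.
by apply: mcontD; apply: mcontM; [exact: mcont_cst|exact: ham_X_mcont|exact: mcont_cst|exact: ham_Y_mcont].
Qed.

Lemma ham_Y_mprim : mprim T (fun t => c *m ham_X t - a^T *m ham_Y t) ham_Y.
Proof.
apply: mprim_C1 => //; first exact: ham_Y_mcont; last by move=> t _; exact: ham_Y_deriv.
apply: mcontD; last apply: mcontN.
  by apply: mcontM; [exact: mcont_cst|exact: ham_X_mcont].
by apply: mcontM; [exact: mcont_cst|exact: ham_Y_mcont].
Qed.

(** X^T Y - Y^T X is the symplectic form evaluated on the columns of (X, Y): it is conserved, and it
    vanishes at T because Y(T) = 0. It makes Y X^-1 symmetric. *)
Lemma ham_sym t : t \in `[0, T] -> (ham_X t)^T *m ham_Y t = (ham_Y t)^T *m ham_X t.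
Proof.
move=> tT; apply/eqP; rewrite -subr_eq0; apply/eqP.
have h := mprimB (mprimM T0 (mprim_tr ham_X_mprim) ham_Y_mprim)
                 (mprimM T0 (mprim_tr ham_Y_mprim) ham_X_mprim).
have := mprim_constant (F := fun t => (ham_X t)^T *m ham_Y t - (ham_Y t)^T *m ham_X t)
  _ (memT_seg T0) tT.
rewrite ham_XT ham_YT trmx0 mul0mx mulmx0 subr0 => <- //.
apply: eq_mprim h => // s sT; move: (ham_X s) (ham_Y s) => X Y.
rewrite !linearD/= !linearN/= !trmx_mul !trmxK.
rewrite bsym csym ?(mulmxDl, mulmxDr, mulNmx, mulmxN, mulmxBl, mulmxBr) !mulmxA.
set A1 := _ *m a^T *m _; set A2 := _ *m b *m _; set A3 := _ *m c *m _.
set A4 := _ *m a *m _.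
by apply/matrixP => i j; rewrite !mxE; ring.
Qed.

(** (X v, Y v) solves a homogeneous linear equation. If it vanishes at one time it vanishes at T,
    where X v = v. *)
Lemma ham_inj t (v : 'cV[R]_k) : t \in `[0, T] ->
  ham_X t *m v = 0 -> ham_Y t *m v = 0 -> v = 0.
Proof.
move=> tT X0 Y0; pose Z s := col_mx (ham_X s *m v) (ham_Y s *m v).
have hZ : mprim T (fun s => ham_mx *m Z s) Z.
  have hX := mprimMr T0 v ham_X_mprim; have hY := mprimMr T0 v ham_Y_mprim.
  move=> i j; rewrite /Z /ham_mx.
  case: (split_ordP i) => l ->.
    apply: eq_prim (hX l j) => s sT; rewrite ?mul_block_col ?col_mxEu //.
    by rewrite mulmxDl !mulmxA.
  apply: eq_prim (hY l j) => s sT; rewrite ?mul_block_col ?col_mxEd //.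
  by rewrite mulmxBl mulNmx !mulmxA.
have Zt0 : Z t = 0 by rewrite /Z X0 Y0 col_mx0.
have := linear_unique T0 (@mcont_cst _ T _ _ ham_mx) hZ tT Zt0 (memT_seg T0).
by rewrite /Z ham_XT mul1mx -[RHS]vsubmxK => /eq_col_mx[] ->; rewrite linear0.
Qed.

Lemma riccati_mcont P : mcont T P -> mcont T (fun t => riccati (P t)).
Proof.
move=> cP; rewrite /riccati.
have cc A : mcont T (fun=> A : 'M[R]_k) := @mcont_cst _ T _ _ A.
apply: mcontD => //; apply: mcontD; [apply: mcontD|]; [|apply: mcontN..].
- exact: mcontM.
- exact: mcontM.
- by apply: mcontM => //; apply: mcontM.
Qed.

Lemma riccati_mprim P PT : solves_terminal T riccati PT P ->
  mprim T (fun t => riccati (P t)) P.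
Proof.
move=> [/mcont_mx cP dP _]; apply: mprim_C1 => //; first exact: riccati_mcont.
by move=> t /dP /is_derive_mderiv.
Qed.

(* For a solution P, the difference Y - P X solves a linear equation and
   vanishes at T. *)
Lemma riccati_ham_Y P : solves_terminal T riccati 0 P ->
  forall t, t \in `[0, T] -> ham_Y t = P t *m ham_X t.
Proof.
move=> sP t tT; apply/eqP; rewrite -subr_eq0; apply/eqP.
have hP := riccati_mprim sP; have PT : P T = 0 by case: sP.
have cP : mcont T P by apply/mcont_mx; case: sP.
have h := mprimB ham_Y_mprim (mprimM T0 hP ham_X_mprim).
have hD : mprim T (fun s => (- a^T - P s *m b) *m (ham_Y s - P s *m ham_X s))
    (fun s => ham_Y s - P s *m ham_X s).
  apply: eq_mprim h => // s sT; rewrite /riccati.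
  rewrite !(mulmxBl, mulmxDl, mulmxDr, mulmxBr, mulNmx, mulmxN, opprD, opprK, mulmxA).
  set A1 := c *m _; set A2 := a^T *m ham_Y s; set A3 := a^T *m _ *m _.
  set A4 := P s *m a *m _; set A5 := _ *m P s *m _; set A6 := P s *m b *m _.
  apply/matrixP => i j; rewrite !mxE; ring.
have cA : mcont T (fun s => - a^T - P s *m b).
  apply: mcontD; first exact: mcont_cst.
  by apply: mcontN; apply: mcontM => //; exact: mcont_cst.
apply: (linear_unique T0 cA hD (memT_seg T0)) => //.
by rewrite PT ham_YT mul0mx subr0.
Qed.

(** If X v = 0 then also Y v = P X v = 0, and [ham_inj] gives v = 0. *)
Lemma riccati_unit P : solves_terminal T riccati 0 P ->
  forall t, t \in `[0, T] -> ham_X t \in unitmx.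
Proof.
move=> sP t tT; rewrite -unitmx_tr -row_free_unit -kermx_eq0.
apply/negPn/negP => /rowV0Pn[v]; rewrite sub_kermx => /eqP vX /negP; apply.
have Xv : ham_X t *m v^T = 0 by rewrite -[LHS]trmxK trmx_mul trmxK vX trmx0.
have vT : v^T = 0.
  by apply: (ham_inj tT) => //; rewrite (riccati_ham_Y sP tT) -mulmxA Xv mulmx0.
by rewrite -[v]trmxK vT trmx0.
Qed.

Lemma singular_ham_X t : ham_X t \notin unitmx ->
  exists2 v : 'cV[R]_k, v != 0 & ham_X t *m v = 0.
Proof.
rewrite -unitmx_tr -row_free_unit -kermx_eq0 => /rowV0Pn[v]; rewrite sub_kermx => /eqP vX v0.
exists v^T; first by rewrite -(inj_eq trmx_inj) trmxK trmx0.
by rewrite -[LHS]trmxK trmx_mul trmxK vX trmx0.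
Qed.

(** Quotient rule for Y X^-1, with [A] the adjugate, [d] the determinant and [Gm] the inverse of X.
    The first identity assumed is the derivative of adj(X) X = det(X) 1; it makes the derivative of
    d^-1 A equal to - Gm X' Gm. *)
Lemma inverse_derivative_mx (X Y A X' Y' A' Gm : 'M[R]_k) (d d' : R) :
  d != 0 -> A' *m X + A *m X' = d' *: 1%:M -> A = d *: Gm ->
  Gm *m X = 1%:M -> X *m Gm = 1%:M ->
  Y' *m Gm + Y *m ((- d ^- 2 *: d') *: A + d^-1 *: A') = (Y' - Y *m Gm *m X') *m Gm.
Proof.
move=> d0 key AG GX XG.
have A'X : A' *m X = d' *: 1%:M - A *m X' by rewrite -key addrK.
suff E : ((- d ^- 2 *: d') *: A + d^-1 *: A') *m X = - (Gm *m X').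
  rewrite mulmxBl -[_ *m Gm *m X']mulmxA -[in RHS]mulmxA -mulmxN -mulNmx -E.
  by rewrite -[_ *m X *m Gm]mulmxA XG mulmx1.
rewrite mulmxDl -!scalemxAl A'X AG -!scalemxAl GX.
rewrite scalerBr !scalerA mulVf// scale1r addrA -scalerDl.
have -> : (- d ^- 2 *: d') * d + d^-1 * d' = 0 by rewrite /GRing.scale/=; field.
by rewrite scale0r sub0r.
Qed.

(** The solution is Y X^-1. Its symmetry is recorded as well, since completing the square relies on
    it. *)
Lemma riccati_exists : (forall t, t \in `[0, T] -> ham_X t \in unitmx) ->
  exists P, solves_terminal T riccati 0 P /\
    forall t, t \in `[0, T] -> (P t)^T = P t.
Proof.
move=> Xu.
(* The inverse by Cramer's rule, a form in which each factor has a derivative. *)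
pose G t := (\det (ham_X t))^-1 *: \adj (ham_X t).
have Xd t i j : derivable (fun t => ham_X t i j) t (1 : R) by case: (ham_X_deriv t i j).
have d0 t : t \in `[0, T] -> \det (ham_X t) != 0.
  by move=> /Xu; rewrite unitmxE unitfE.
have GX t : t \in `[0, T] -> G t *m ham_X t = 1%:M.
  by move=> tT; rewrite /G -scalemxAl mul_adj_mx scale_scalar_mx mulVf ?d0.
pose P t := ham_Y t *m G t.
have PX t : t \in `[0, T] -> P t *m ham_X t = ham_Y t.
  by move=> tT; rewrite /P -mulmxA GX// mulmx1.
have XG t : t \in `[0, T] -> ham_X t *m G t = 1%:M.
  by move=> tT; rewrite /G -scalemxAr mul_mx_adj scale_scalar_mx mulVf ?d0.
have dP t : t \in `[0, T] -> mderiv P t (riccati (P t)).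
  move=> tT.
  pose d' := 'D_1 (fun t => \det (ham_X t)) t.
  have hd : is_derive t (1 : R) (fun t => \det (ham_X t)) d' by split => //; exact: derivable_det.
  pose A' := \matrix_(i, j) 'D_1 (fun t => \adj (ham_X t) i j) t.
  have hA : mderiv (fun t => \adj (ham_X t)) t A'.
    by move=> i j; rewrite mxE; split => //; exact: derivable_adj.
  have hdi := is_deriveV (d0 t tT) hd.
  have hG := mderivZ hdi hA.
  have hP := mderivM (ham_Y_deriv t) hG.
  (* Both sides are the derivative of adj(X) X = det(X) 1, by the product rule on the left and
     entrywise on the right. *)
  have key : A' *m ham_X t + \adj (ham_X t) *m (a *m ham_X t + b *m ham_Y t) = d' *: 1%:M.
    have h1 := mderivM hA (ham_X_deriv t).
    have h2 : mderiv (fun t => \det (ham_X t) *: (1%:M : 'M[R]_k)) t (d' *: 1%:M).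
      have := mderivZ hd (mderiv_cst (1%:M : 'M[R]_k) t); apply: eq_mderiv => //.
      by move: (d' *: _) (\det _) => D e; rewrite scaler0 addr0.
    apply: (mderiv_uniq h1); apply: eq_mderiv h2 => // s.
    by rewrite mul_adj_mx scalemx1.
  apply: eq_mderiv hP => //.
  rewrite (inverse_derivative_mx _ _ (d0 t tT) key) ?GX ?XG//; last first.
    by rewrite /G scalerA divff ?d0// scale1r.
  rewrite -[RHS]mulmx1 -(XG t tT) mulmxA; congr (_ *m _).
  rewrite -/(P t) /riccati [in RHS]mulmxDl ![in RHS]mulmxBl ![in RHS]mulNmx -![_ *m P t *m _]mulmxA PX//.
  move: (P t) (ham_Y t) (ham_X t) => p y x.
  rewrite mulmxDr !mulmxA.
  by apply/matrixP => i j; rewrite !mxE; ring.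
exists P; split; first split.
- by apply/mcont_mx; apply: mderiv_mcont => t; exact: dP.
- move=> t tT; apply/is_derive_mderiv/dP.
  by move: tT; rewrite !in_itv/= => /andP[/ltW-> /ltW->].
- by rewrite /P ham_YT mul0mx.
move=> t tT; rewrite /P.
have hs := ham_sym tT.
have GtX : (G t)^T *m (ham_X t)^T = 1%:M by rewrite -trmx_mul XG// trmx1.
rewrite trmx_mul -[LHS]mulmx1 -(XG t tT) mulmxA -[_ *m _ *m ham_X t]mulmxA -hs.
by rewrite !mulmxA GtX mul1mx.
Qed.

End Hamiltonian.

(** * Kronecker products and reduction of the large Riccati equation to the small one *)

Section Kronecker.
Context {R : realType}.

Lemma trmxD m n (A B : 'M[R]_(m, n)) : (A + B)^T = A^T + B^T.
Proof. by apply/matrixP => i j; rewrite !mxE. Qed.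

Lemma trmxB m n (A B : 'M[R]_(m, n)) : (A - B)^T = A^T - B^T.
Proof. by apply/matrixP => i j; rewrite !mxE. Qed.

Lemma tensmxDl m n p q (A B : 'M[R]_(m, n)) (C : 'M[R]_(p, q)) :
  (A + B) *t C = A *t C + B *t C.
Proof. by apply/matrixP => i j; rewrite !mxE mulrDl. Qed.

Lemma tensmxDr m n p q (A : 'M[R]_(m, n)) (B C : 'M[R]_(p, q)) :
  A *t (B + C) = A *t B + A *t C.
Proof. by apply/matrixP => i j; rewrite !mxE mulrDr. Qed.

Lemma tensmxZl m n p q c (A : 'M[R]_(m, n)) (C : 'M[R]_(p, q)) :
  (c *: A) *t C = c *: (A *t C).
Proof. by apply/matrixP => i j; rewrite !mxE mulrA. Qed.

Lemma tensmxNr m n p q (A : 'M[R]_(m, n)) (C : 'M[R]_(p, q)) :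
  A *t (- C) = - (A *t C).
Proof. by apply/matrixP => i j; rewrite !mxE mulrN. Qed.

Lemma sum_mxtens m n (F : 'I_(m * n) -> R) :
  \sum_i F i = \sum_(i < m) \sum_(j < n) F (mxtens_index (i, j)).
Proof.
rewrite pair_bigA/= (reindex (@mxtens_index m n)).
  by apply: eq_bigr => -[].
by exists (@mxtens_unindex m n) => i _; [exact: mxtens_indexK|exact: mxtens_unindexK].
Qed.

Variable N : nat.

Lemma ones_tensE p q (M : 'M[R]_(p, q)) i j :
  ones_tens N M i j = M (mxtens_unindex i).2 j.
Proof.
rewrite /ones_tens castmxE/= !mxE mul1r; congr (M _ _); apply: val_inj => /=.
  by [].
by rewrite modn_small.
Qed.

Lemma ones_tens_mul p q r (M : 'M[R]_(p, q)) (X : 'M[R]_(q, r)) :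
  ones_tens N M *m X = ones_tens N (M *m X).
Proof.
apply/matrixP => i j; rewrite ones_tensE !mxE.
by apply: eq_bigr => k _; rewrite ones_tensE.
Qed.

Lemma ones_tensD p q (U V : 'M[R]_(p, q)) :
  ones_tens N (U + V) = ones_tens N U + ones_tens N V.
Proof. by apply/matrixP => i j; rewrite !(ones_tensE, mxE). Qed.

Lemma ones_tensN p q (U : 'M[R]_(p, q)) : ones_tens N (- U) = - ones_tens N U.
Proof. by apply/matrixP => i j; rewrite !(ones_tensE, mxE). Qed.

Lemma ones_tens0 p q : ones_tens N (0 : 'M[R]_(p, q)) = 0.
Proof. by apply/matrixP => i j; rewrite !(ones_tensE, mxE). Qed.

(** When [ones N] is an eigenvector of [B], the product of [B] and [M] preserves the diagonal 1 (x)
    R^q. It is used with the identity, 1 1^T, [p] and [1%:M - p], for the eigenvalues 1, N, 1 and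
    0. *)
Lemma tens_mul_ones_tens p q r (B : 'M[R]_N) (M : 'M[R]_(p, q)) (V : 'M[R]_(q, r)) c :
  B *m ones N = c *: ones N -> (B *t M) *m ones_tens N V = c *: ones_tens N (M *m V).
Proof.
move=> hB; apply/matrixP => i j; rewrite [in RHS]mxE ones_tensE [in LHS]mxE sum_mxtens.
have -> : c = \sum_(k < N) B (mxtens_unindex i).1 k.
  have /matrixP/(_ (mxtens_unindex i).1 0) := hB.
  rewrite !mxE mulr1 => <-; apply: eq_bigr => k _; by rewrite mxE mulr1.
rewrite mulr_suml; apply: eq_bigr => k _; rewrite mxE mulr_sumr.
by apply: eq_bigr => l _; rewrite ones_tensE !mxE !mxtens_indexK/= mulrA.
Qed.

Lemma ones_tens_tr_mul p q r (U : 'M[R]_(p, q)) (V : 'M[R]_(p, r)) :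
  (ones_tens N U)^T *m ones_tens N V = N%:R *: (U^T *m V).
Proof.
apply/matrixP => i j; rewrite !mxE sum_mxtens.
transitivity (\sum_(k < N) \sum_(l < p) U^T i l * V l j).
  apply: eq_bigr => k _; apply: eq_bigr => l _.
  by rewrite mxE !ones_tensE mxtens_indexK/= mxE.
by rewrite sumr_const card_ord mulr_natl.
Qed.

Lemma ones_tens_mul_tr p (X : 'M[R]_p) :
  ones_tens N 1%:M *m X *m (ones_tens N 1%:M)^T = (ones N *m (ones N)^T) *t X.
Proof.
rewrite ones_tens_mul mul1mx; apply/matrixP => i j; rewrite !mxE big_ord1 !mxE mul1r mul1r.
rewrite (bigD1 (mxtens_unindex j).2)//= mxE !ones_tensE mxE eqxx mulr1 big1 ?addr0//.
by move=> k /negbTE kj; rewrite !(mxE, ones_tensE) eq_sym kj mulr0.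
Qed.

Lemma ones_onesT_ones : (ones N *m (ones N)^T) *m ones N = N%:R *: ones N :> 'cV[R]_N.
Proof.
apply/matrixP => i j; rewrite -mulmxA mxE big_ord1 !mxE mul1r mulr1.
by under eq_bigr do rewrite !mxE mul1r; rewrite sumr_const card_ord.
Qed.

(** The weight of the tracking term when all agents are displaced by one common vector, which is
    then also the displacement of the average. *)
Definition Qtil n (Q Gamma : 'M[R]_n) : 'M[R]_n :=
  (1%:M - Gamma)^T *m Q *m (1%:M - Gamma).

Lemma QtilE n (Q Gamma : 'M[R]_n) : Qtil Q Gamma = Q - Psi_mx Q Gamma.
Proof.
rewrite /Qtil /Psi_mx trmxB trmx1 mulmxBr !mulmxBl !mulmx1 !mul1mx.
by apply/matrixP => i j; rewrite !mxE; ring.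
Qed.

Hypothesis N0 : (0 < N)%N.

Let Nn0 : N%:R != 0 :> R.
Proof. by rewrite pnatr_eq0 -lt0n. Qed.

Lemma Acheck_ones n q (A G : 'M[R]_n) (V : 'M[R]_(n, q)) :
  Acheck N A G *m ones_tens N V = ones_tens N ((A + G) *m V).
Proof.
rewrite /Acheck /repdiag mulmxDl -scalemxAl.
rewrite (@tens_mul_ones_tens _ _ _ _ _ _ 1) ?mul1mx ?scale1r//.
rewrite (tens_mul_ones_tens _ _ ones_onesT_ones) scalerA mulVf// scale1r.
by rewrite mulmxDl ones_tensD.
Qed.

Lemma Qhat_ones n q (Q Gamma : 'M[R]_n) (V : 'M[R]_(n, q)) :
  Qhat N Q Gamma *m ones_tens N V = ones_tens N (Qtil Q Gamma *m V).
Proof.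
rewrite /Qhat /repdiag mulmxBl -scalemxAl.
rewrite (@tens_mul_ones_tens _ _ _ _ _ _ 1) ?mul1mx ?scale1r//.
rewrite (tens_mul_ones_tens _ _ ones_onesT_ones) scalerA mulVf// scale1r.
by rewrite QtilE [in RHS]mulmxBl ones_tensD ones_tensN.
Qed.

Lemma qform_Qhat_ones n (Q Gamma : 'M[R]_n) (z : 'cV[R]_n) :
  qform (Qhat N Q Gamma) (ones_tens N z) = N%:R * qform (Qtil Q Gamma) z.
Proof.
by rewrite /qform -mulmxA Qhat_ones ones_tens_tr_mul mxE mulmxA.
Qed.

Lemma qform_repdiag_ones n (H : 'M[R]_n) (z : 'cV[R]_n) :
  qform (repdiag N H) (ones_tens N z) = N%:R * qform H z.
Proof.
rewrite /qform -mulmxA /repdiag (@tens_mul_ones_tens _ _ _ _ _ _ 1) ?mul1mx ?scale1r//.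
by rewrite ones_tens_tr_mul mxE mulmxA.
Qed.

Variables (T : R) (T0 : 0 <= T) (n : nat) (A G Gamma Q R2 H : 'M[R]_n).
Hypothesis R2u : R2 \in unitmx.

Definition riccati_iii (X : 'M[R]_(N * n)) :=
  - (Acheck N A G)^T *m X - X *m Acheck N A G
          + Qhat N Q Gamma
          + X *m ones_tens N 1%:M *m invmx (N%:R *: R2)
              *m (ones_tens N 1%:M)^T *m X.

Definition riccati_iv (X : 'M[R]_n) :=
  - (A + G)^T *m X - X *m (A + G) + X *m invmx R2 *m X
          + (1%:M - Gamma)^T *m Q *m (1%:M - Gamma).

Let E := ones_tens N (1%:M : 'M[R]_n).

Let AE : Acheck N A G *m E = E *m (A + G).
Proof. by rewrite /E Acheck_ones ones_tens_mul mul1mx mulmx1. Qed.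

Let invNR : invmx (N%:R *: R2) = N%:R^-1 *: invmx R2.
Proof. by rewrite invmxZ// unitmxZ ?unitfE. Qed.

(** The quadratic term contains E (N R2)^-1 E^T in its middle, so its compression by [E] is a
    product of two compressions. With [AE] this closes the equation for E^T PP E; the factor N^-1
    normalizes E^T E = N. *)
Lemma riccati_iii_iv PP : solves_terminal T riccati_iii (- repdiag N H) PP ->
  solves_terminal T riccati_iv (- H) (fun t => N%:R^-1 *: (E^T *m PP t *m E)).
Proof.
move=> [/mcont_mx cP dP PT]; split.
- apply/mcont_mx => i j.
  rewrite (_ : (fun _ => _) = (fun t => N%:R^-1 * (E^T *m PP t *m E) i j)); last first.
    by apply/funext => t; rewrite mxE.
  apply: within_continuousM; first by apply: continuous_subspaceT => x; exact: cst_continuous.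
  by apply: mcontM; [apply: mcontM => //|]; exact: mcont_cst.
- move=> t /dP/is_derive_mderiv h; apply/is_derive_mderiv.
  have := mderivZ (is_derive_cst (N%:R^-1 : R) t (1 : R)) (mderivMr E (mderivMl E^T h)).
  apply: eq_mderiv => //; rewrite scale0r add0r /riccati_iii /riccati_iv -/E invNR -/(Qtil Q Gamma).
  move: (PP t) => X.
  have EA : E^T *m (Acheck N A G)^T = (A + G)^T *m E^T by rewrite -trmx_mul AE trmx_mul.
  have QE : E^T *m Qhat N Q Gamma *m E = N%:R *: Qtil Q Gamma.
    by rewrite -mulmxA /E Qhat_ones ones_tens_tr_mul trmx1 mul1mx mulmx1.
  set Y := E^T *m X *m E.
  have e1 : E^T *m (- (Acheck N A G)^T *m X) *m E = - ((A + G)^T *m Y).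
    by rewrite mulNmx mulmxN mulNmx !mulmxA EA.
  have e2 : E^T *m (- (X *m Acheck N A G)) *m E = - (Y *m (A + G)).
    by rewrite mulmxN mulNmx -!mulmxA AE /Y -?mulmxA.
  have e4 : E^T *m (X *m E *m (N%:R^-1 *: invmx R2) *m E^T *m X) *m E
      = N%:R^-1 *: (Y *m invmx R2 *m Y).
    by rewrite -!scalemxAr -!scalemxAl -!scalemxAr -!scalemxAl /Y !mulmxA.
  move: e1 e2 QE e4; rewrite -/Y.
  move: (Acheck N A G) (Qhat N Q Gamma) (A + G) (Qtil Q Gamma) Y => Ac Qh F q Y e1 e2 e3 e4.
  rewrite !mulmxDr !mulmxDl e1 e2 e3 e4 /cst !scalerDr !scalerN !scalerA mulVf// scale1r.
  by rewrite mulNmx -!scalemxAr -!scalemxAl scalerA addrAC.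
- rewrite PT mulmxN mulNmx -mulmxA /E /repdiag (@tens_mul_ones_tens _ _ _ _ _ _ 1) ?mul1mx ?scale1r//.
  by rewrite ones_tens_tr_mul trmx1 mul1mx mulmx1 scalerN scalerA mulVf// scale1r.
Qed.

Let p : 'M[R]_N := N%:R^-1 *: (ones N *m (ones N)^T).

Let p_ones : p *m ones N = 1 *: ones N.
Proof. by rewrite /p -scalemxAl ones_onesT_ones scalerA mulVf. Qed.

Let p_sq : p *m p = p.
Proof. by rewrite {2}/p -scalemxAr mulmxA p_ones scale1r. Qed.

Let p_tr : p^T = p.
Proof. by rewrite /p linearZ/= trmx_mul trmxK. Qed.

Let cp_ones : (1%:M - p) *m ones N = 0 *: ones N.
Proof. by rewrite mulmxBl p_ones mul1mx scale1r subrr scale0r. Qed.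

Let pcp : p *m (1%:M - p) = 0.
Proof. by rewrite mulmxBr mulmx1 p_sq subrr. Qed.

Let cpp : (1%:M - p) *m p = 0.
Proof. by rewrite mulmxBl mul1mx p_sq subrr. Qed.

Let split1 m q (X : 'M[R]_(m, q)) : 1%:M *t X = p *t X + (1%:M - p) *t X.
Proof. by rewrite -tensmxDl addrC subrK. Qed.

Lemma mderiv_tens m (B : 'M[R]_m) k (F : R -> 'M[R]_k) t D :
  mderiv F t D -> mderiv (fun t => B *t F t) t (B *t D).
Proof.
move=> h i j; rewrite mxE (_ : (fun _ => _) = (fun t => B (mxtens_unindex i).1 (mxtens_unindex j).1 *
   F t (mxtens_unindex i).2 (mxtens_unindex j).2)); last first.
  by apply/funext => s; rewrite mxE.
have := is_deriveM (is_derive_cst (B (mxtens_unindex i).1 (mxtens_unindex j).1) t (1 : R))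
   (h (mxtens_unindex i).2 (mxtens_unindex j).2).
by rewrite scaler0 addr0.
Qed.

(* On the diagonal 1 (x) R^n the equation (iii) is (iv); on the complement it is
   the Lyapunov equation solved by S. *)
Lemma riccati_iv_iii P S : (forall t, t \in `[0, T] -> (P t)^T = P t) ->
  solves_terminal T riccati_iv (- H) P ->
  solves_terminal T (fun X => - A^T *m X - X *m A + Q) (- H) S ->
  solves_terminal T riccati_iii (- repdiag N H)
    (fun t => p *t P t + (1%:M - p) *t S t).
Proof.
move=> Psym [/mcont_mx cP dP PT] [/mcont_mx cS dS ST]; split.
- apply/mcont_mx; apply: mcontD => i j.
    rewrite (_ : (fun _ => _) = (fun t => p (mxtens_unindex i).1 (mxtens_unindex j).1 *
      P t (mxtens_unindex i).2 (mxtens_unindex j).2)).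
      by apply: within_continuousM; [apply: continuous_subspaceT => x; exact: cst_continuous|exact: cP].
    by apply/funext => s; rewrite mxE.
  rewrite (_ : (fun _ => _) = (fun t => (1%:M - p) (mxtens_unindex i).1 (mxtens_unindex j).1 *
      S t (mxtens_unindex i).2 (mxtens_unindex j).2)).
    by apply: within_continuousM; [apply: continuous_subspaceT => x; exact: cst_continuous|exact: cS].
  by apply/funext => s; rewrite mxE.
- move=> t tT; apply/is_derive_mderiv.
  have := mderivD (mderiv_tens p ((is_derive_mderiv _ _ _).1 (dP t tT)))
    (mderiv_tens (1%:M - p) ((is_derive_mderiv _ _ _).1 (dS t tT))).
  apply: eq_mderiv => //; rewrite /riccati_iii /riccati_iv -/(Qtil Q Gamma) invNR -/E.
  have {}Psym : (P t)^T = P t.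
    by apply: Psym; move: tT; rewrite !in_itv/= => /andP[/ltW-> /ltW->].
  move: (P t) (S t) Psym => X Y Xsym; set PP := _ *t X + _ *t Y.
  have PE : PP *m E = E *m X.
    rewrite /PP mulmxDl /E (tens_mul_ones_tens _ _ p_ones) (tens_mul_ones_tens _ _ cp_ones).
    by rewrite scale1r scale0r addr0 mulmx1 ones_tens_mul mul1mx.
  have EP : E^T *m PP = X *m E^T.
    have PPtE : PP^T *m E = E *m X^T.
      rewrite /PP trmxD !trmx_tens trmxB trmx1 p_tr.
      rewrite mulmxDl /E (tens_mul_ones_tens _ _ p_ones) (tens_mul_ones_tens _ _ cp_ones).
      by rewrite scale1r scale0r addr0 mulmx1 ones_tens_mul mul1mx.
    by rewrite -[LHS]trmxK trmx_mul trmxK PPtE trmx_mul trmxK.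
  (* The quadratic term acts on the diagonal alone, which is why the complement is left with a
     linear equation. *)
  have quad : PP *m E *m (N%:R^-1 *: invmx R2) *m E^T *m PP = p *t (X *m invmx R2 *m X).
    rewrite PE -scalemxAr -!scalemxAl -[_ *m E^T *m PP]mulmxA EP !mulmxA.
    by rewrite /p tensmxZl -ones_tens_mul_tr !mulmxA.
  have Ach : Acheck N A G = p *t (A + G) + (1%:M - p) *t A.
    by rewrite /Acheck /repdiag split1 tensmxDr -tensmxZl -/p addrAC.
  have Qh : Qhat N Q Gamma = p *t Qtil Q Gamma + (1%:M - p) *t Q.
    by rewrite /Qhat /repdiag split1 QtilE tensmxDr tensmxNr -tensmxZl -/p addrAC.
  have PA : PP *m Acheck N A G = p *t (X *m (A + G)) + (1%:M - p) *t (Y *m A).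
    rewrite Ach /PP mulmxDr !mulmxDl !tensmx_mul pcp cpp p_sq !tens0mx addr0 add0r.
    by rewrite [(1%:M - p) *m _]mulmxBr mulmx1 cpp subr0.
  have AP : (Acheck N A G)^T *m PP = p *t ((A + G)^T *m X) + (1%:M - p) *t (A^T *m Y).
    have -> : (Acheck N A G)^T = p *t (A + G)^T + (1%:M - p) *t A^T.
      by rewrite Ach [LHS]trmxD !trmx_tens trmxB trmx1 p_tr.
    rewrite /PP.
    rewrite mulmxDr !mulmxDl !tensmx_mul pcp cpp p_sq !tens0mx addr0 add0r.
    by rewrite [(1%:M - p) *m _]mulmxBr mulmx1 cpp subr0.
  rewrite quad Qh PA [_ *m PP]mulNmx AP !tensmxDr !tensmxNr !mulNmx !tensmxNr.
  move: (_ *t _) (_ *t (X *m _)) (_ *t Qtil _ _) (_ *t (X *m _ *m _)) => A1 A2 A3 A4.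
  move: (_ *t (_ *m Y)) (_ *t (Y *m _)) (_ *t Q) => B1 B2 B3.
  by apply/matrixP => i j; rewrite !mxE; ring.
- by rewrite PT ST -tensmxDl addrC subrK /repdiag tensmxNr.
Qed.

End Kronecker.

(** * Coercivity of positive definite forms *)

Section PositiveDefinite.
Context {R : realType}.

Lemma qform_sum k (M : 'M[R]_k) (z : 'cV[R]_k) :
  qform M z = \sum_i z i 0 * (M *m z) i 0.
Proof. by rewrite /qform -mulmxA mxE; apply: eq_bigr => i _; rewrite mxE. Qed.

Lemma pd_unitmx k (M : 'M[R]_k) : pd_mx M -> M \in unitmx.
Proof.
move=> Mpd; rewrite -unitmx_tr -row_free_unit -kermx_eq0.
apply/negPn/negP => /rowV0Pn[v]; rewrite sub_kermx => /eqP vX v0.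
have := Mpd v^T; rewrite -(inj_eq trmx_inj) trmxK trmx0 => /(_ v0).
rewrite /qform trmxK -mulmxA -[M *m _]trmxK trmx_mul trmxK vX trmx0 mulmx0 mxE.
by rewrite ltxx.
Qed.

Lemma sym_invmx k (M : 'M[R]_k) : M^T = M -> (invmx M)^T = invmx M.
Proof. by move=> Ms; rewrite trmx_inv Ms. Qed.

(* Cauchy-Schwarz for the form M, applied to z and M^-1 e_j, bounds (z j)^2. *)
Lemma pd_coercive k (M : 'M[R]_k) : M^T = M -> pd_mx M ->
  exists c : R, 0 < c /\ forall z, c * sqnorm z <= qform M z.
Proof.
move=> Ms Mpd; have Mu := pd_unitmx Mpd.
pose w (j : 'I_k) : 'cV[R]_k := invmx M *m delta_mx j 0.
have Mw j : M *m w j = delta_mx j 0 by rewrite /w mulmxA mulmxV// mul1mx.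
have qw j : qform M (w j) = w j j 0.
  by rewrite /qform -mulmxA Mw -colE !mxE.
have d0 j : delta_mx j 0 != 0 :> 'cV[R]_k.
  apply/eqP => /matrixP/(_ j 0); rewrite !mxE !eqxx => /eqP.
  by rewrite oner_eq0.
have w0 j : 0 < w j j 0.
  rewrite -qw; apply: Mpd; apply/eqP => wj.
  by have := Mw j; rewrite wj mulmx0 => /esym/eqP; rewrite (negbTE (d0 j)).
have key (z : 'cV[R]_k) (j : 'I_k) : z j 0 ^+ 2 <= w j j 0 * qform M z.
  (* The minimizer in [s] of [qform M (z - s *: w j)]. *)
  pose s := z j 0 / w j j 0.
  have h0 : 0 <= qform M (z - s *: w j).
    by have [->|/Mpd/ltW//] := eqVneq (z - s *: w j) 0; rewrite /qform mulmx0 mxE.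
  have zMw : (z^T *m M *m w j) 0 0 = z j 0.
    by rewrite -mulmxA Mw -colE !mxE.
  have wMz : ((w j)^T *m M *m z) 0 0 = z j 0.
    by rewrite -{1}Ms -trmx_mul Mw trmx_delta -rowE !mxE.
  have E : qform M (z - s *: w j) = qform M z - 2 * s * z j 0 + s ^+ 2 * w j j 0.
    have tE : (z - s *: w j)^T = z^T - s *: (w j)^T by apply/matrixP => x y; rewrite !mxE.
    rewrite {1}/qform tE !(mulmxBl, mulmxBr, =^~ scalemxAl, =^~ scalemxAr).
    rewrite -qw /qform; move: zMw wMz.
    move: (z^T *m M *m w j) ((w j)^T *m M *m z) (z^T *m M *m z) ((w j)^T *m M *m w j) => A1 A2 A3 A4 h1 h2.
    by rewrite !mxE h1 h2; ring.
  move: h0; rewrite E => h0.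
  have W := w0 j.
  have : 0 <= w j j 0 * (qform M z - 2 * s * z j 0 + s ^+ 2 * w j j 0).
    by rewrite mulr_ge0// ltW.
  have -> : w j j 0 * (qform M z - 2 * s * z j 0 + s ^+ 2 * w j j 0)
      = w j j 0 * qform M z - z j 0 ^+ 2.
    by rewrite /s; field; exact: lt0r_neq0.
  by rewrite subr_ge0.
(* One plus the trace of M^-1; the 1 keeps [C] positive in dimension 0. *)
pose C := 1 + \sum_j w j j 0.
have C0 : 0 < C by rewrite ltr_wpDr// sumr_ge0// => j _; exact: ltW.
exists C^-1; split; first by rewrite invr_gt0.
move=> z; rewrite ler_pdivrMl//.
have qz : 0 <= qform M z.
  by have [->|/Mpd/ltW//] := eqVneq z 0; rewrite /qform mulmx0 mxE.
rewrite /sqnorm /C mulrDl mul1r mulr_suml ler_wpDl//.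
by apply: ler_sum => j _; exact: key.
Qed.

End PositiveDefinite.

(** * Solvability of the Riccati equation, invertibility of X and the determinant *)

Section Equivalences.
Context {R : realType}.
Variables (T : R) (T0 : 0 <= T) (n : nat) (A G Gamma Q R2 H : 'M[R]_n).
Hypotheses (Qsym : Q^T = Q) (R2sym : R2^T = R2) (Hsym : H^T = H).
Hypothesis R2u : R2 \in unitmx.

Let a := A + G + invmx R2 *m H.
Let b := - invmx R2.
Let c := A21 A G Gamma Q R2 H.

Let bsym : b^T = b.
Proof. by rewrite /b linearN/= sym_invmx. Qed.

Let Qtsym : (Qtil Q Gamma)^T = Qtil Q Gamma.
Proof. by rewrite /Qtil !trmx_mul trmxK Qsym mulmxA. Qed.

Let csym : c^T = c.
Proof.
rewrite /c /A21 -/(Qtil Q Gamma); move: (A + G) (Qtil Q Gamma) Qtsym => F q qs.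
rewrite !trmxD !trmx_mul qs trmxK Hsym sym_invmx//.
by rewrite mulmxA -!addrA; congr (_ + (_ + _)); rewrite addrC.
Qed.

(** This identity is the origin of the entries of [bbA], which is [ham_mx a b c]: substituting P - H
    in the equation (iv) gives the coefficients a, b, c, and the terminal value becomes 0. *)
Let riccati_shift (X : 'M[R]_n) :
  riccati a b c (X + H) = riccati_iv A G Gamma Q R2 X.
Proof.
rewrite /riccati /riccati_iv /c /A21 -/(Qtil Q Gamma) /a /b.
rewrite [(_ + invmx R2 *m H)^T]trmxD trmx_mul Hsym sym_invmx//.
move: (A + G) (Qtil Q Gamma) (invmx R2) => F q r.
rewrite !(mulmxDl, mulmxDr, mulmxN, mulNmx, opprD, mulmxA).
apply/matrixP => i j; rewrite !mxE; ring.
Qed.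

Lemma mcont_addr k (F : R -> 'M[R]_k) (M : 'M[R]_k) :
  mcont T F -> mcont T (fun t => F t + M).
Proof. by move=> h; apply: mcontD => //; exact: mcont_cst. Qed.

Lemma solves_terminal_shift k (f g : 'M[R]_k -> 'M[R]_k) (PT M : 'M[R]_k) P :
  (forall X, g (X + M) = f X) -> solves_terminal T f PT P ->
  solves_terminal T g (PT + M) (fun t => P t + M).
Proof.
move=> fg [/mcont_mx cP dP PTe]; split; last by rewrite PTe.
  by apply/mcont_mx; exact: mcont_addr.
move=> t /dP/is_derive_mderiv h; apply/is_derive_mderiv.
have := mderivD h (mderiv_cst M t).
by apply: eq_mderiv => //; rewrite addr0 fg.
Qed.

Lemma riccati_iv_unit P : solves_terminal T (riccati_iv A G Gamma Q R2) (- H) P ->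
  forall t, t \in `[0, T] -> ham_X T a b c t \in unitmx.
Proof.
move=> /(solves_terminal_shift riccati_shift); rewrite addNr.
by move=> h; apply: (riccati_unit T0 bsym csym h).
Qed.

Lemma unit_riccati_iv : (forall t, t \in `[0, T] -> ham_X T a b c t \in unitmx) ->
  exists P, solves_terminal T (riccati_iv A G Gamma Q R2) (- H) P /\
    forall t, t \in `[0, T] -> (P t)^T = P t.
Proof.
move=> /(riccati_exists T0 bsym csym)[P [sP Psym]].
exists (fun t => P t - H); split.
  have := @solves_terminal_shift _ _ (riccati_iv A G Gamma Q R2) _ (- H) _ _ sP.
  rewrite add0r; apply => X; by rewrite -riccati_shift subrK.
by move=> t tT; rewrite trmxB Psym// Hsym.
Qed.

(** A Lyapunov equation is a Riccati equation with b = 0. Then X solves the homogeneous equation X'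
    = A X with X(T) = 1, so no vector in a kernel of X(t) can be nonzero; [c'] is the constant term
    after the shift by [H]. *)
Lemma lyapunov_exists :
  exists S, solves_terminal T (fun X => - A^T *m X - X *m A + Q) (- H) S.
Proof.
pose c' := Q + A^T *m H + H *m A.
have c'sym : c'^T = c'.
  by rewrite /c' !trmxD !trmx_mul trmxK Hsym Qsym addrAC.
have z : (0 : 'M[R]_n)^T = 0 by rewrite trmx0.
have hX : mprim T (fun t => A *m ham_X T A 0 c' t) (ham_X T A 0 c').
  apply: eq_mprim (ham_X_mprim T0 A z c'sym) => // t _.
  by rewrite mul0mx addr0.
have /(riccati_exists T0 z c'sym)[P [sP _]] :
    forall t, t \in `[0, T] -> ham_X T A 0 c' t \in unitmx.
  move=> t tT; apply/negPn/negP => /singular_ham_X[v v0 Xv].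
  have := linear_unique T0 (@mcont_cst _ T _ _ A)
     (eq_mprim (fun t _ => esym (mulmxA _ _ _)) (fun t _ => erefl) (mprimMr T0 v hX)) tT Xv (memT_seg T0).
  by rewrite ham_XT mul1mx => v00; rewrite v00 eqxx in v0.
exists (fun t => P t - H).
have := @solves_terminal_shift _ _ (fun X => - A^T *m X - X *m A + Q) _ (- H) _ _ sP.
rewrite add0r; apply => X; rewrite /riccati /c' !(mulmxBl, mulmxBr, mulmxN, mulNmx, mulmx0, mul0mx).
by apply/matrixP => i j; rewrite !mxE; ring.
Qed.

Lemma det_condition_unit :
  (forall t, t \in `[0, T] ->
     0 < \det (row_mx 0 1%:M *m expmx (t *: bbA A G Gamma Q R2 H)
               *m (row_mx 0 1%:M)^T : 'M[R]_n)) <->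
  (forall t, t \in `[0, T] -> ham_X T a b c t \in unitmx).
Proof.
have rev t : t \in `[0, T] -> T - t \in `[0, T].
  by rewrite !in_itv/= => /andP[t0 tT]; rewrite subr_ge0 tT gerBl t0.
have E t : row_mx 0 1%:M *m expmx (t *: bbA A G Gamma Q R2 H) *m (row_mx 0 1%:M)^T
    = ham_V a b c t by [].
split=> h t tT.
  rewrite unitmx_tr unitmxE unitfE lt0r_neq0//; exact: (h _ (rev t tT)).
have Vn0 s : s \in `[0, T] -> \det (ham_V a b c s) != 0.
  move=> sT; have := h _ (rev s sT); rewrite /ham_X subKr unitmx_tr unitmxE.
  by rewrite unitfE.
rewrite E ltNge; apply/negP => d0.
have dV s : derivable (fun s => \det (ham_V a b c s)) s 1.
  apply: derivable_det => i j.
  have /(_ i j)[] // := mderivMr (row_mx 0 1%:M)^T (mderivMl (row_mx 0 1%:M)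
    (is_derive_expmx (ham_mx a b c) s)).
have cV : {within `[0, t], continuous (fun s => \det (ham_V a b c s))}.
  apply: continuous_subspaceT => s; apply: differentiable_continuous.
  exact/derivable1_diffP.
move: (tT); rewrite in_itv/= => /andP[t0 tT'].
have v0 : Num.min (\det (ham_V a b c 0)) (\det (ham_V a b c t)) <= 0
    <= Num.max (\det (ham_V a b c 0)) (\det (ham_V a b c t)).
  by rewrite ham_V0 det1 ge_min le_max d0 ler01 orbT.
have [s st s0] := IVT t0 cV v0.
have /Vn0 : s \in `[0, T]; last by rewrite s0 eqxx.
by move: st; rewrite !in_itv/= => /andP[-> /le_trans ->].
Qed.

End Equivalences.

(** * The deterministic quadratic cost *)

Section SquareIntegrablePaths.
Context {R : realType}.
Notation mu := (@lebesgue_measure R).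
Variables (T : R) (T0 : 0 <= T).

Definition l2 {k : nat} (f : R -> 'cV[R]_k) : Prop :=
  (forall j, measurable_fun (`[0, T]%classic : set (measurableTypeR R)) (fun t => f t j 0)) /\
  mu.-integrable `[0, T] (EFin \o (fun t => sqnorm (f t))).

Let mI : measurable (`[0, T]%classic : set (measurableTypeR R)).
Proof. exact: measurable_itv. Qed.

Lemma sqnorm_ge0 k (z : 'cV[R]_k) : 0 <= sqnorm z.
Proof. by rewrite -sqF_sqnorm sqF_ge0. Qed.

Lemma sqnorm_ge k (z : 'cV[R]_k) j : z j 0 ^+ 2 <= sqnorm z.
Proof. by rewrite -sqF_sqnorm; exact: sqF_ge. Qed.

Lemma sqnorm_eq0 k (z : 'cV[R]_k) : sqnorm z = 0 -> z = 0.
Proof. by rewrite -sqF_sqnorm => /sqF_eq0. Qed.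

Lemma sqnormD k (y z : 'cV[R]_k) : sqnorm (y + z) <= 2 * sqnorm y + 2 * sqnorm z.
Proof.
rewrite /sqnorm !mulr_sumr -big_split/=; apply: ler_sum => j _; rewrite mxE.
have := sqr_ge0 (y j 0 - z j 0); lra.
Qed.

Lemma sqnormZ k c (z : 'cV[R]_k) : sqnorm (c *: z) = c ^+ 2 * sqnorm z.
Proof. by rewrite /sqnorm mulr_sumr; apply: eq_bigr => j _; rewrite mxE exprMn. Qed.

(** Crude, but the constant sees [A] only through the bound on its entries; it therefore holds
    uniformly along a bounded path of matrices. *)
Lemma sqnorm_mulmx_le p q (A : 'M[R]_(p, q)) (M : R) : (forall i j, `|A i j| <= M) ->
  forall z, sqnorm (A *m z) <= p%:R * (q%:R ^+ 2 * M ^+ 2) * sqnorm z.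
Proof.
move=> AM z; have s0 := sqnorm_ge0 z.
have cst_sum m (y : R) : y *+ m = \sum_(j < m) y by rewrite sumr_const card_ord.
rewrite -mulrA mulr_natl cst_sum.
apply: ler_sum => i _; rewrite -real_normK ?num_real//.
have -> : q%:R ^+ 2 * M ^+ 2 * sqnorm z = (q%:R * M * Num.sqrt (sqnorm z)) ^+ 2.
  by rewrite !exprMn sqr_sqrtr.
have E : `|(A *m z) i 0| <= q%:R * M * Num.sqrt (sqnorm z).
  rewrite mxE; apply: (le_trans (ler_norm_sum _ _ _)).
  rewrite -mulrA mulr_natl cst_sum.
  apply: ler_sum => j _; rewrite normrM; apply: ler_pM => //.
  by rewrite -sqrtr_sqr ler_wsqrtr// sqnorm_ge.
by rewrite lerXn2r// nnegrE// (le_trans _ E).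
Qed.

Lemma mx_bounded p q (A : 'M[R]_(p, q)) : exists M : R, forall i j, `|A i j| <= M.
Proof.
exists (\sum_i \sum_j `|A i j|) => i j.
rewrite (bigD1 i)//= (bigD1 j)//= -addrA lerDl addr_ge0// sumr_ge0// => k _.
by rewrite sumr_ge0.
Qed.

Lemma sqnorm_mulmx p q (A : 'M[R]_(p, q)) : exists M : R, 0 <= M /\
  forall z, sqnorm (A *m z) <= M * sqnorm z.
Proof.
have [B BP] := mx_bounded A.
exists (p%:R * (q%:R ^+ 2 * B ^+ 2)); split; last exact: sqnorm_mulmx_le.
by rewrite mulr_ge0// mulr_ge0// sqr_ge0.
Qed.

Lemma measurable_sqnorm d (X : measurableType d) (D : set X) k (f : X -> 'cV[R]_k) :
  (forall j, measurable_fun D (fun t => f t j 0)) ->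
  measurable_fun D (fun t => sqnorm (f t)).
Proof.
by move=> mf; apply: measurable_sum => j; apply: measurable_funX.
Qed.

Lemma measurable_mulmx d (X : measurableType d) (D : set X) p q (A : 'M[R]_(p, q))
    (f : X -> 'cV[R]_q) :
  (forall j, measurable_fun D (fun t => f t j 0)) ->
  forall i, measurable_fun D (fun t => (A *m f t) i 0).
Proof.
move=> mf i; under eq_fun do rewrite mxE.
by apply: measurable_sum => j; apply: measurable_funM.
Qed.

Lemma measurable_addmx d (X : measurableType d) (D : set X) p (f g : X -> 'cV[R]_p) :
  (forall j, measurable_fun D (fun t => f t j 0)) ->
  (forall j, measurable_fun D (fun t => g t j 0)) ->
  forall i, measurable_fun D (fun t => (f t + g t) i 0).
Proof.
move=> mf mg i; under eq_fun do rewrite mxE.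
exact: measurable_funD.
Qed.

Lemma l2_le k l (f : R -> 'cV[R]_k) (g : R -> 'cV[R]_l) (c : R) :
  (forall j, measurable_fun (`[0, T]%classic : set (measurableTypeR R)) (fun t => f t j 0)) ->
  (forall t, t \in `[0, T] -> sqnorm (f t) <= c * sqnorm (g t)) -> l2 g -> l2 f.
Proof.
move=> mf fg [_ ig]; split => //.
apply: (@rintegrable_le _ _ _ _ _ mI _ (fun t => c * sqnorm (g t))).
- exact: measurable_sqnorm.
- by move=> t tT; rewrite ger0_norm ?sqnorm_ge0// fg.
- exact: rintegrableZ.
Qed.

Lemma l2_mulmx p q (A : 'M[R]_(p, q)) f : l2 f -> l2 (fun t => A *m f t).
Proof.
move=> lf; have [M [_ hM]] := sqnorm_mulmx A.
apply: (l2_le _ _ lf); first by apply: measurable_mulmx; case: lf.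
by move=> t _; exact: hM.
Qed.

Lemma l2D k (f g : R -> 'cV[R]_k) : l2 f -> l2 g -> l2 (fun t => f t + g t).
Proof.
move=> [mf hf] [mg hg]; split; first exact: measurable_addmx.
apply: (@rintegrable_le _ _ _ _ _ mI _ (fun t => 2 * sqnorm (f t) + 2 * sqnorm (g t))).
- by apply: measurable_sqnorm; exact: measurable_addmx.
- by move=> t tT; rewrite ger0_norm ?sqnorm_ge0// sqnormD.
- by apply: rintegrableD => //; exact: rintegrableZ.
Qed.

Lemma l2_mcont k (f : R -> 'cV[R]_k) : mcont T f -> l2 f.
Proof.
move=> cf; split.
  by move=> j; apply: subspace_continuous_measurable_fun => //; exact: cf.
apply: continuous_compact_integrable; first exact: segment_compact.
by apply: within_continuous_sum => j; apply: within_continuousM; exact: cf.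
Qed.

Lemma l2_prod k l (f : R -> 'cV[R]_k) (g : R -> 'cV[R]_l) i j : l2 f -> l2 g ->
  mu.-integrable `[0, T] (EFin \o (fun t => f t i 0 * g t j 0)).
Proof.
move=> [mf hf] [mg hg].
apply: (@rintegrable_le _ _ _ _ _ mI _ (fun t => sqnorm (f t) + sqnorm (g t))).
- exact: measurable_funM.
- move=> t _; rewrite normrM.
  have := sqnorm_ge (f t) i; have := sqnorm_ge (g t) j.
  rewrite -[f t i 0 ^+ 2]real_normK ?num_real// -[g t j 0 ^+ 2]real_normK ?num_real//.
  have := sqr_ge0 (`|f t i 0| - `|g t j 0|).
  have := mulr_ge0 (normr_ge0 (f t i 0)) (normr_ge0 (g t j 0)).
  move: `|_| `|_| => u v; nra.
- exact: rintegrableD.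
Qed.

Lemma l2_L1 k (f : R -> 'cV[R]_k) i : l2 f ->
  mu.-integrable `[0, T] (EFin \o (fun t => f t i 0)).
Proof.
move=> lf; have l1 : l2 (fun=> const_mx 1 : 'cV[R]_1) by apply: l2_mcont; exact: mcont_cst.
have := l2_prod i 0 lf l1; apply: eq_integrable => // t _.
by rewrite /= mxE mulr1.
Qed.

Lemma l2_form k (M : 'M[R]_k) (f g : R -> 'cV[R]_k) : l2 f -> l2 g ->
  mu.-integrable `[0, T] (EFin \o (fun t => ((f t)^T *m M *m g t) 0 0)).
Proof.
move=> lf lg.
have : mu.-integrable `[0, T] (EFin \o (fun t => \sum_i f t i 0 * (M *m g t) i 0)).
  by apply: rintegrable_sum => // i; apply: l2_prod => //; exact: l2_mulmx.
apply: eq_integrable => // t _ /=; congr EFin.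
rewrite -mulmxA [in RHS]mxE; apply: eq_bigr => i _; by rewrite [in RHS]mxE.
Qed.

Lemma l2_qform k (M : 'M[R]_k) (f : R -> 'cV[R]_k) : l2 f ->
  mu.-integrable `[0, T] (EFin \o (fun t => qform M (f t))).
Proof. by move=> lf; exact: (l2_form M lf lf). Qed.

(** Since [F] vanishes at [t0], cutting it off before [t0] creates no jump, and the result is again
    absolutely continuous. *)
Lemma prim_cut (f F : R -> R) t0 : t0 \in `[0, T] -> prim T f F -> F t0 = 0 ->
  prim T (fun t => if t0 <= t then f t else 0) (fun t => if t0 <= t then F t else 0).
Proof.
move=> t0T pf F0.
have mind : measurable_fun (`[0, T]%classic : set (measurableTypeR R))
    (fun t => if t0 <= t then 1 else 0 : R).
  apply: measurable_funTS; apply: measurable_fun_ifT => //.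
  exact: measurable_fun_ler.
split.
  have b1 t : `[0, T]%classic t -> `|if t0 <= t then 1 else 0 : R| <= 1.
    by move=> _; case: ifP; rewrite ?normr1 ?normr0.
  have := rintegrableM_bounded mI mind b1 pf.1.
  by apply: eq_integrable => // t _ /=; case: ifP; rewrite ?mul1r ?mul0r.
move=> t tT.
have t00 : 0 <= t0 by move: t0T; rewrite in_itv/= => /andP[].
have -> : (if t0 <= 0 then F 0 else 0) = 0.
  case: ifP => // t0le; have e : t0 = 0 by apply/eqP; rewrite eq_le t0le.
  by rewrite -{2}F0 e.
rewrite add0r; case: ifPn => [t0t|]; last first.
  rewrite -ltNge => tt0; rewrite /Rintegral integral0_eq// => x /=.
  rewrite in_itv/= => /andP[_ xt]; rewrite ifN// -ltNge; exact: le_lt_trans tt0.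
rewrite -[LHS]subr0 -[X in _ - X]F0 (prim_itvB pf)//.
have -> : `[t0, t]%classic = `[0, t]%classic `&` `[t0, +oo[%classic.
  apply/seteqP; split => x /=; rewrite !in_itv/= ?andbT.
    by move=> /andP[t0x ->]; rewrite t0x (le_trans t00 t0x).
  by move=> [/andP[_ ->] ->].
rewrite Rintegral_mkcondr; apply: eq_Rintegral => x _.
by rewrite patchE mem_setE in_itv/= andbT.
Qed.

End SquareIntegrablePaths.

(** * Coercivity of the deterministic cost, and its failure at a conjugate point *)

Section Cost.
Context {R : realType}.
Notation mu := (@lebesgue_measure R).
Variables (T : R) (T0 : 0 <= T) (n : nat) (A G Gamma Q R2 H : 'M[R]_n).
Hypotheses (Qsym : Q^T = Q) (R2sym : R2^T = R2) (Hsym : H^T = H).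
Hypothesis R2pd : pd_mx R2.

Let R2u : R2 \in unitmx. Proof. exact: pd_unitmx. Qed.

Definition cost (f xi : R -> 'cV[R]_n) : R :=
  \int[mu]_(t in `[0, T]) (- qform (Qtil Q Gamma) (xi t) + qform R2 (f t))
  - qform H (xi T).

Definition driven (f xi : R -> 'cV[R]_n) : Prop :=
  mprim T (fun t => (A + G) *m xi t + f t) xi /\ xi 0 = 0.

Let mI : measurable (`[0, T]%classic : set (measurableTypeR R)).
Proof. exact: measurable_itv. Qed.

Lemma driven_l2 f xi : driven f xi -> l2 T xi.
Proof. by move=> [h _]; apply: l2_mcont => //; exact: mcont_prim h. Qed.

(* Completing the square with the Riccati solution turns the cost into the
   integral of |f + R2^-1 P xi|^2 weighted by R2. *)
Lemma cost_square P f xi : (forall t, t \in `[0, T] -> (P t)^T = P t) ->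
  solves_terminal T (riccati_iv A G Gamma Q R2) (- H) P -> l2 T f -> driven f xi ->
  cost f xi = \int[mu]_(t in `[0, T]) qform R2 (f t + invmx R2 *m P t *m xi t).
Proof.
move=> Psym [/mcont_mx cP dP PT] lf [hxi xi0].
have lxi := driven_l2 (conj hxi xi0).
have cR : mcont T (fun t => riccati_iv A G Gamma Q R2 (P t)).
  have cc M : mcont T (fun=> M : 'M[R]_n) := @mcont_cst _ T _ _ M.
  rewrite /riccati_iv; apply: mcontD => //; apply: mcontD; [apply: mcontD|].
  - exact: mcontM.
  - by apply: mcontN; exact: mcontM.
  - by apply: mcontM => //; exact: mcontM.
have hP : mprim T (fun t => riccati_iv A G Gamma Q R2 (P t)) P.
  by apply: mprim_C1 => // t /dP/is_derive_mderiv.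
(* The derivative of xi^T P xi. This function is 0 at time 0 and [- qform H (xi T)] at time T, so
   its integral [D] stands for the terminal cost. *)
have /(_ 0 0) := mprimM T0 (mprimM T0 (mprim_tr hxi) hP) hxi.
set D := fun t => fun_of_matrix _ _ _.
move=> [iD hD].
have HD : - qform H (xi T) = \int[mu]_(t in `[0, T]) D t.
  have e0 : ((xi 0)^T *m P 0 *m xi 0) 0 0 = 0 by rewrite xi0 mulmx0 mxE.
  have eT : ((xi T)^T *m P T *m xi T) 0 0 = - qform H (xi T).
    by rewrite PT mulmxN mulNmx mxE.
  by rewrite -eT (hD T (memT_seg T0)) e0 add0r.
rewrite /cost HD.
have i1 : mu.-integrable `[0, T]
    (EFin \o (fun t => - qform (Qtil Q Gamma) (xi t) + qform R2 (f t))).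
  by apply: rintegrableD => //; [apply: rintegrableN => //|]; exact: l2_qform.
rewrite -RintegralD//; apply: eq_Rintegral => t tT.
have {}tT : t \in `[0, T] by exact: set_mem tT.
rewrite /D /riccati_iv -/(Qtil Q Gamma) /qform.
have := Psym t tT.
move: (xi t) (f t) (P t) (Qtil Q Gamma) (A + G) => x g p q F ps.
rewrite !trmxD !trmx_mul ps sym_invmx//.
rewrite !(mulmxDl, mulmxDr, mulmxN, mulNmx, mulmxA).
rewrite -[_ *m R2 *m invmx R2]mulmxA mulmxV// mulmx1.
rewrite -[_ *m invmx R2 *m R2]mulmxA mulVmx// mulmx1.
rewrite !mxE; ring.
Qed.

(** The completed square controls g = f + K xi with K = R2^-1 P, not f itself. But xi solves the
    closed-loop equation with matrix A + G - K and forcing g, so the energy estimate bounds xi, and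
    with it f = g - K xi, by g. *)
Lemma cost_coercive P : (forall t, t \in `[0, T] -> (P t)^T = P t) ->
  solves_terminal T (riccati_iv A G Gamma Q R2) (- H) P ->
  exists delta : R, 0 < delta /\ forall f xi, l2 T f -> driven f xi ->
    delta * \int[mu]_(t in `[0, T]) sqnorm (f t) <= cost f xi.
Proof.
move=> Psym sP.
have cP : mcont T P by apply/mcont_mx; case: sP.
pose K t := invmx R2 *m P t.
have cK : mcont T K by apply: mcontM => //; exact: mcont_cst.
have [c [c0 hc]] := pd_coercive R2sym R2pd.
have cAK : mcont T (fun t => A + G - K t).
  by apply: mcontD; [exact: mcont_cst|exact: mcontN].
have [C [C0 hC]] := linear_energy_bound T0 cAK.
have [M [M0 KM]] := mcont_bounded T0 cK.
pose B : R := n%:R * (n%:R ^+ 2 * M ^+ 2).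
have B0 : 0 <= B by rewrite mulr_ge0// mulr_ge0// sqr_ge0.
(* From |f|^2 <= 2 |g|^2 + 2 |K xi|^2, where |K xi|^2 is at most B C times the integral of |g|^2 at
   each time; integration over [0, T] adds the factor T. *)
pose W : R := 2 + 2 * B * C * T.
have W0 : 0 < W by rewrite ltr_wpDr// !mulr_ge0// ltW.
exists (c / W); split; first by rewrite divr_gt0.
move=> f xi lf hd; rewrite (cost_square Psym sP lf hd).
have lxi := driven_l2 hd.
have [hxi xi0] := hd.
pose g t := f t + K t *m xi t.
have lK : l2 T (fun t => K t *m xi t).
  by apply: l2_mcont => //; apply: mcontM => //; exact: mcont_prim hxi.
have lg : l2 T g by exact: l2D.
have hg : mprim T (fun t => (A + G - K t) *m xi t + g t) xi.
  apply: eq_mprim hxi => // t _; rewrite /g mulmxBl.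
  by rewrite addrACA [in RHS]addrC addrACA; apply/matrixP => i j; rewrite !mxE; ring.
set S := \int[mu]_(t in `[0, T]) sqnorm (g t).
have hS t : t \in `[0, T] -> sqnorm (xi t) <= C * S by apply: hC => //; case: lg.
have S0 : 0 <= S by apply: Rintegral_ge0 => t _; exact: sqnorm_ge0.
have fS : \int[mu]_(t in `[0, T]) sqnorm (f t) <= W * S.
  have ic : mu.-integrable `[0, T] (EFin \o (fun=> 2 * B * C * S)).
    apply: continuous_compact_integrable; first exact: segment_compact.
    by apply: continuous_subspaceT => x; exact: cst_continuous.
  apply: (@le_trans _ _ (\int[mu]_(t in `[0, T]) (2 * sqnorm (g t) + 2 * B * C * S))).
    apply: le_Rintegral => //; first by case: lf.
      by apply: rintegrableD => //; apply: rintegrableZ => //; case: lg.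
    move=> t tT; rewrite (_ : f t = g t + (- K t) *m xi t); last by rewrite /g mulNmx addrK.
    apply: (le_trans (sqnormD _ _)); rewrite lerD2l.
    rewrite (_ : 2 * B * C * S = 2 * (B * (C * S))) ?ler_wpM2l ?mulrA//.
    rewrite mulNmx -scaleN1r sqnormZ sqrrN expr1n mul1r.
    apply: (le_trans (@sqnorm_mulmx_le _ _ _ _ M _ _)); first by move=> i j; exact: KM.
    by rewrite -/B -mulrA ler_wpM2l// hS.
  rewrite RintegralD//; last by apply: rintegrableZ => //; case: lg.
  rewrite RintegralZl//; last by case: lg.
  have -> : \int[mu]_(t in `[0, T]) (2 * B * C * S) = 2 * B * C * S * T.
    rewrite (@Rintegral_cst _ _ _ mu _ mI); congr (_ * _).
    rewrite [X in fine X](_ : _ = if 0 < T then (T%:E - 0%:E)%E else 0%E); last first.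
      by have := @lebesgue_measure_itv R `[0, T]; rewrite /= lte_fin.
    case: ifPn => [_|]; first by rewrite -EFinB/= subr0.
    by rewrite -leNgt => Tle; apply/eqP; rewrite eq_le T0 Tle.
  by rewrite le_eqVlt; apply/orP; left; apply/eqP; rewrite /W -/S; ring.
apply: (@le_trans _ _ (c * S)).
  rewrite -mulrA ler_wpM2l ?(ltW c0)// mulrC ler_pdivrMr// mulrC; exact: fS.
rewrite -RintegralZl//; last by case: lg.
apply: le_Rintegral => //.
- by apply: rintegrableZ => //; case: lg.
- exact: (l2_qform R2 lg).
Qed.

(* The Hamiltonian path through a kernel vector of X(t0), cut off before t0, is the
   extremal of a conjugate point. *)
Lemma conjugate_point t0 : t0 \in `[0, T] ->
  ham_X T (A + G + invmx R2 *m H) (- invmx R2) (A21 A G Gamma Q R2 H) t0 \notin unitmx ->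
  exists f xi, [/\ l2 T f, driven f xi, cost f xi = 0 &
    0 < \int[mu]_(t in `[0, T]) sqnorm (f t)].
Proof.
move=> t0T /singular_ham_X[v v0 Xv].
set a := A + G + _ in Xv; set b := - _ in Xv; set c := A21 _ _ _ _ _ _ in Xv.
pose X t := ham_X T a b c t; pose Y t := ham_Y T a b c t.
have bsym : b^T = b by rewrite /b linearN/= sym_invmx.
have csym : c^T = c.
  rewrite /c /A21 -/(Qtil Q Gamma).
  have qs : (Qtil Q Gamma)^T = Qtil Q Gamma by rewrite /Qtil !trmx_mul trmxK Qsym mulmxA.
  move: (A + G) (Qtil Q Gamma) qs => F q qs.
  rewrite !trmxD !trmx_mul qs trmxK Hsym sym_invmx//.
  by rewrite mulmxA -!addrA; congr (_ + (_ + _)); rewrite addrC.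
have hX : mprim T (fun t => a *m X t + b *m Y t) X by exact: ham_X_mprim.
have hY : mprim T (fun t => c *m X t - a^T *m Y t) Y by exact: ham_Y_mprim.
(* Subtracting [H *m x t] undoes the shift: [p] is the costate of the original problem, with p(T) =
   - H v, and [f0] is the extremal control - R2^-1 p. *)
pose x t := X t *m v; pose p t := Y t *m v - H *m x t.
pose f0 t := - (invmx R2 *m p t).
have hx : mprim T (fun t => (A + G) *m x t + f0 t) x.
  apply: eq_mprim (mprimMr T0 v hX) => // t _; rewrite /f0 /p /x /a /b.
  move: (X t) (Y t) (A + G) => xx yy F.
  rewrite !(mulmxDl, mulmxBr, mulNmx, opprD, opprK, mulmxA).
  apply/matrixP => i j; rewrite !mxE; ring.
have hp : mprim T (fun t => Qtil Q Gamma *m x t - (A + G)^T *m p t) p.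
  apply: eq_mprim (mprimB (mprimMr T0 v hY) (mprimMl T0 H hx)) => // t _.
  rewrite /f0 /p /x /a /c /A21 -/(Qtil Q Gamma).
  rewrite [(_ + invmx R2 *m H)^T]trmxD trmx_mul Hsym sym_invmx//.
  move: (X t) (Y t) (A + G) (Qtil Q Gamma) => xx yy F q.
  rewrite !(mulmxDl, mulmxDr, mulmxBl, mulmxBr, mulNmx, mulmxN, opprD, opprK, mulmxA).
  apply/matrixP => i j; rewrite !mxE; ring.
pose f t := if t0 <= t then f0 t else 0.
pose xi t := if t0 <= t then x t else 0.
have hxi : mprim T (fun t => (A + G) *m xi t + f t) xi.
  move=> i j; have xt0 : x t0 i j = 0 by rewrite /x /X Xv mxE.
  apply: eq_prim (prim_cut t0T (hx i j) xt0) => t _; rewrite /xi /f; case: ifP => // _.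
    by rewrite mulmx0 addr0 mxE.
  by rewrite mxE.
have xi0 : xi 0 = 0.
  rewrite /xi; case: ifP => [t00|_]; last by [].
  have e : t0 = 0 by apply/eqP; rewrite eq_le t00; move: t0T; rewrite in_itv/= => /andP[].
  by rewrite -e /x /X Xv.
have hd : driven f xi by split.
have cx : mcont T x by exact: mcont_prim hx.
have cp : mcont T p by exact: mcont_prim hp.
have lf0 : l2 T f0.
  by apply: l2_mcont => //; apply: mcontN; apply: mcontM => //; exact: mcont_cst.
have lf : l2 T f.
  apply: (@l2_le _ _ _ _ _ f0 1) => //.
    move=> j; rewrite (_ : (fun t => f t j 0) = fun t => if t0 <= t then f0 t j 0 else 0).
      apply: measurable_fun_if => //; first by apply: measurable_funTS; exact: measurable_fun_ler.
      apply: measurable_funS (lf0.1 j) => //; exact: subIsetl.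
    by apply/funext => t; rewrite /f; case: ifP; rewrite ?mxE.
  move=> t _; rewrite mul1r /f; case: ifP => // _.
  by rewrite /sqnorm big1 ?sqnorm_ge0// => j _; rewrite mxE expr0n.
have xiT : xi T = v.
  rewrite /xi ifT; last by move: t0T; rewrite in_itv/= => /andP[].
  by rewrite /x /X ham_XT mul1mx.
exists f, xi; split => //.
(* From [t0] on, the derivative of p^T xi is x^T Qtil x + p^T f0, the opposite of the running cost;
   before [t0] both vanish. The boundary value at T is the terminal cost, and the total is 0. *)
- have /(_ 0 0) := mprimM T0 (mprim_tr hp) hxi.
  set D := fun t => fun_of_matrix _ _ _.
  move=> [iD hD].
  have HD : - qform H v = \int[mu]_(t in `[0, T]) D t.
    have e0 : ((p 0)^T *m xi 0) 0 0 = 0 by rewrite xi0 mulmx0 mxE.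
    have eT : ((p T)^T *m xi T) 0 0 = - qform H v.
      have -> : p T = - (H *m v) by rewrite /p /x /X /Y ham_XT ham_YT mul0mx mul1mx sub0r.
      by rewrite xiT linearN/= trmx_mul Hsym mulNmx mxE.
    by rewrite -eT (hD T (memT_seg T0)) e0 add0r.
  rewrite /cost xiT (_ : qform H v = - \int[mu]_(s in `[0, T]) D s); last by rewrite -HD opprK.
  rewrite opprK -RintegralD//; last first.
    apply: rintegrableD => //; first apply: rintegrableN => //; apply: l2_qform => //.
    exact: driven_l2 hd.
  rewrite -[RHS](_ : \int[mu]_(s in `[0, T]) (fun=> 0) s = 0); last first.
    by rewrite /Rintegral integral0.
  apply: eq_Rintegral => t _; rewrite /D /xi /f /qform; case: ifP => _.
    have qs : (Qtil Q Gamma)^T = Qtil Q Gamma by rewrite /Qtil !trmx_mul trmxK Qsym mulmxA.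
    rewrite /f0; move: (x t) (p t) (Qtil Q Gamma) qs (A + G) => y z q qs F.
    have -> : (- (invmx R2 *m z))^T = - (z^T *m invmx R2).
      by rewrite linearN/= trmx_mul sym_invmx.
    rewrite trmxB !trmx_mul trmxK qs.
    rewrite !(mulmxBl, mulmxDr, mulmxBr, mulNmx, mulmxN, opprK, mulmxA).
    rewrite -[_ *m invmx R2 *m R2]mulmxA mulVmx// mulmx1.
    by rewrite !mxE; ring.
  by rewrite !(mulmx0, addr0) !mxE oppr0 !addr0.
- rewrite lt_neqAle Rintegral_ge0 ?andbT; last by move=> t _; exact: sqnorm_ge0.
  (* A control of zero energy would leave xi at rest by the energy estimate, whereas xi(T) = v. *)
  apply/negP => /eqP If0.
  have [C [C0 hC]] := linear_energy_bound T0 (@mcont_cst _ T _ _ (A + G)).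
  have := hC _ _ hxi xi0 lf.2 T (memT_seg T0).
  rewrite -If0 mulr0 xiT => sv; have : sqnorm v = 0 by apply/eqP; rewrite eq_le sv sqnorm_ge0.
  by move=> /sqnorm_eq0 vz; rewrite vz eqxx in v0.
Qed.

End Cost.

(** * Square-integrable processes *)

Section GaussianMoment.
Context {R : realType}.
Notation mu := (@lebesgue_measure R).

(** The change of variables is available for the Radon-Nikodym derivative of [normal_prob]; this
    derivative agrees almost everywhere with [normal_pdf], having the same integral over every
    measurable set. *)
Lemma ge0_integral_normal_prob (m s : R) (f : R -> \bar R) :
  (forall x, 0 <= f x)%E -> measurable_fun (setT : set (measurableTypeR R)) f ->
  (\int[normal_prob m s]_x f x = \int[mu]_x (f x * (normal_pdf m s x)%:E))%E.
Proof.
move=> f0 mf; have dom := normal_prob_dominates m s.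
rewrite -(Radon_Nikodym_SigmaFinite.change_of_variables dom)//.
have gi := Radon_Nikodym_SigmaFinite.f_integrable dom.
have pi := integrable_normal_pdf m s.
apply: ge0_ae_eq_integral => //.
- by apply: emeasurable_funM => //; exact: measurable_int gi.
- by apply: emeasurable_funM => //; exact: measurable_int pi.
- by move=> x _; rewrite mule_ge0// Radon_Nikodym_SigmaFinite.f_ge0.
- by move=> x _; rewrite mule_ge0// lee_fin normal_pdf_ge0.
apply: ae_eqe_mul2l; apply: integral_ae_eq => //.
  exact: measurable_int pi.
by move=> E _ mE; rewrite -Radon_Nikodym_SigmaFinite.f_integral.
Qed.

(** The factor x^2 is absorbed by doubling the standard deviation, so a second moment is bounded by
    the total mass of a density. With y = x^2 / (8 s^2) the exponent is - 4 y; one y is kept for the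
    wider density and y exp(- 3 y) <= 1 uses the rest. The constant 16 is 8 times 2, the wider peak
    being half as high. *)
Lemma sqr_normal_pdf_le (s x : R) : s != 0 ->
  x ^+ 2 * normal_pdf 0 s x <= 16 * s ^+ 2 * normal_pdf 0 (2 * s) x.
Proof.
move=> s0; have s20 : 2 * s != 0 by rewrite mulf_neq0.
have ss : 0 < s ^+ 2 by rewrite exprn_even_gt0.
rewrite !normal_pdfE// /normal_fun !subr0.
have -> : normal_peak (2 * s) = normal_peak s / 2.
  rewrite /normal_peak -invfM; congr (_^-1).
  rewrite (_ : (2 * s) ^+ 2 * pi *+ 2 = 2 ^+ 2 * (s ^+ 2 * pi *+ 2)); last by ring.
  by rewrite sqrtrM ?sqr_ge0// sqrtr_sqr ger0_norm// mulrC.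
set y := x ^+ 2 / (8 * s ^+ 2).
have y0 : 0 <= y by rewrite divr_ge0 ?sqr_ge0// mulr_ge0// ltW.
have -> : - x ^+ 2 / (s ^+ 2 *+ 2) = - y + - (3 * y) by rewrite /y; field.
have -> : - x ^+ 2 / ((2 * s) ^+ 2 *+ 2) = - y by rewrite /y; field.
have -> : x ^+ 2 = 8 * s ^+ 2 * y by rewrite /y; field.
rewrite expRD.
have E3 : y * expR (- (3 * y)) <= 1.
  rewrite expRN ler_pdivrMr ?expR_gt0// mul1r.
  apply: (@le_trans _ _ (1 + 3 * y)); first by lra.
  exact: expR_ge1Dx.
have p0 := normal_peak_ge0 s; have Ey := expR_ge0 (- y).
rewrite (_ : 8 * s ^+ 2 * y * _ = 8 * s ^+ 2 * normal_peak s * expR (- y) * (y * expR (- (3 * y)))); last by ring.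
rewrite (_ : 16 * _ * _ = 8 * s ^+ 2 * normal_peak s * expR (- y) * 1); last by field.
apply: ler_wpM2l => //; move: (s ^+ 2) (ltW ss) => q q0; by do ?apply: mulr_ge0.
Qed.

Lemma normal_second_moment (s : R) : s != 0 ->
  (\int[normal_prob 0 s]_x (x ^+ 2)%:E <= (16 * s ^+ 2)%:E)%E.
Proof.
move=> s0; rewrite ge0_integral_normal_prob//; last 2 first.
- by move=> x; rewrite lee_fin sqr_ge0.
- by apply/measurable_EFinP; exact: measurable_funX.
apply: (@le_trans _ _ (\int[mu]_x ((16 * s ^+ 2)%:E * (normal_pdf 0 (2 * s) x)%:E))%E).
  have mp (r : R) : measurable_fun setT (fun x => (normal_pdf 0 r x)%:E).
    by apply/measurable_EFinP; exact: measurable_normal_pdf.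
  apply: ge0_le_integral => //.
  - by move=> x _; rewrite -EFinM lee_fin mulr_ge0 ?sqr_ge0 ?normal_pdf_ge0.
  - apply: emeasurable_funM; last exact: mp.
    by apply/measurable_EFinP; exact: exprn_measurable.
  - by apply: emeasurable_funM => //; exact: mp.
  - by move=> x _; rewrite -!EFinM lee_fin; exact: sqr_normal_pdf_le.
rewrite integralZl//; last exact: integrable_normal_pdf.
by rewrite integral_normal_pdf mule1.
Qed.

End GaussianMoment.

(** * Second moments of Brownian motion at a fixed time *)

Section BrownianMoment.
Context {d0 : measure_display} {Omega : measurableType d0} {R : realType}.
Variable P : probability Omega R.

Lemma sigma_rv_measurable k (v : Omega -> 'cV[R]_k) : sigma_rv v `<=` measurable ->
  forall j, measurable_fun setT (fun w => v w j 0).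
Proof.
move=> sv j _ B mB; rewrite setTI; apply: sv; apply: sub_sigma_algebra.
by exists j => //=; exists B => //; rewrite setTI.
Qed.

Lemma brownian_second_moment (T : R) (d : nat) (W : @process _ Omega R d) t j :
  brownian_motion P T W -> t \in `[0, T] ->
  (\int[P]_w ((W t w j 0) ^+ 2)%:E <= (16 * t)%:E)%E.
Proof.
move=> bm; rewrite in_itv/= => /andP[t0 tT].
have T0 : 0 <= T := le_trans t0 tT.
have mW s : s \in `[0, T] -> measurable_fun setT (fun w => W s w j 0).
  by move=> sT; apply: sigma_rv_measurable; exact: bm_measurable bm _ sT.
have mWt := mW t _; have mW0 := mW 0 _.
have {}mWt : measurable_fun setT (fun w => W t w j 0) by apply: mWt; rewrite in_itv/= t0.
have {}mW0 : measurable_fun setT (fun w => W 0 w j 0) by apply: mW0; rewrite in_itv/= lexx.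
pose X w := (W t w - W 0 w) j 0.
have mX : measurable_fun setT X.
  rewrite (_ : X = fun w => W t w j 0 - W 0 w j 0); first exact: measurable_funB.
  by apply/funext => w; rewrite /X !mxE.
have -> : (\int[P]_w ((W t w j 0) ^+ 2)%:E = \int[P]_w ((X w) ^+ 2)%:E)%E.
  apply: ge0_ae_eq_integral => //.
  - by apply/measurable_EFinP; exact: measurable_funX.
  - by apply/measurable_EFinP; exact: measurable_funX.
  - by move=> w _; rewrite lee_fin sqr_ge0.
  - by move=> w _; rewrite lee_fin sqr_ge0.
  have := bm_start bm; apply: filterS => w W0 _.
  by rewrite /X W0 subr0.
(* At t = 0 the law is degenerate and the bound by a density does not apply; the increment is then
   identically 0. *)
move: t0; rewrite le_eqVlt => /predU1P[t0|t0].
  rewrite -t0 mulr0 (_ : (fun w => _) = cst 0%E) ?integral0//.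
  by apply/funext => w; rewrite /X -t0 subrr mxE expr0n.
have s0 : Num.sqrt (t - 0) != 0 by rewrite subr0 gt_eqF// sqrtr_gt0.
have := @normal_second_moment R _ s0.
rewrite sqr_sqrtr ?subr0 ?(ltW t0)//; apply: le_trans.
have mX' : measurable_fun setT (X : Omega -> measurableTypeR R) by exact: mX.
pose X_mixin := isMeasurableFun.Build _ _ _ _ _ mX'.
pose X_mfun : {mfun Omega >-> measurableTypeR R} := HB.pack (X : Omega -> measurableTypeR R) X_mixin.
have -> : (\int[P]_w ((X w) ^+ 2)%:E = \int[distribution P X_mfun]_x (x ^+ 2)%:E)%E.
  rewrite ge0_integral_pushforward//.
    by apply/measurable_EFinP; exact: measurable_funX.
  by move=> x _; rewrite lee_fin sqr_ge0.
have -> : (\int[distribution P X_mfun]_x (x ^+ 2)%:E =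
    \int[normal_prob 0 (Num.sqrt t)]_x (x ^+ 2)%:E)%E.
  apply: eq_measure_integral => B mB _.
  by have := bm_gaussian bm (lexx 0) t0 tT j mB; rewrite subr0.
exact: lexx.
Qed.

End BrownianMoment.

(** * Joint and iterated integrals over time and sample *)

Section ProductIntegrals.
Context {d0 : measure_display} {Omega : measurableType d0} {R : realType}.
Variable P : probability Omega R.
Variable (T : R).
Notation mu := (@lebesgue_measure R).
Implicit Types g h : R -> Omega -> R.

Definition strip : set (measurableTypeR R * Omega) := `[0, T] `*` setT.

(** [jointly_measurable] gives information on [0, T] only; functions are extended by zero off the
    strip before Fubini and Tonelli are applied on the whole product. *)
Definition pmeas g : Prop := measurable_fun strip (fun z => g z.1 z.2).

Definition pint g : Prop :=
  (mu \x P)%E.-integrable strip (EFin \o (fun z => g z.1 z.2)).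

Let mI : measurable (`[0, T]%classic : set (measurableTypeR R)).
Proof. exact: measurable_itv. Qed.

Lemma measurable_strip : measurable strip.
Proof. exact: measurableX. Qed.

Let mS := measurable_strip.

Lemma patch_strip g t w :
  ((fun z => g z.1 z.2) \_ strip) (t, w) = ((g ^~ w) \_ `[0, T]) t.
Proof.
rewrite !patchE; case: ifPn => [/set_mem[/= tI _]|].
  by rewrite mem_set.
rewrite notin_setE => tI; rewrite ifN// notin_setE => tI'; exact: tI.
Qed.

Lemma pmeas_restrict g : pmeas g -> measurable_fun setT ((fun z => g z.1 z.2) \_ strip).
Proof. by move=> mg; exact: ((measurable_restrictT (fun z => g z.1 z.2) mS).1 mg). Qed.

Lemma pmeas_path g w : pmeas g ->
  measurable_fun (`[0, T]%classic : set (measurableTypeR R)) (g ^~ w).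
Proof.
move=> mg; apply: (measurable_restrictT (g ^~ w) mI).2.
rewrite (_ : _ \_ _ = fun t => ((fun z => g z.1 z.2) \_ strip) (t, w)).
  exact: (measurableT_comp (pmeas_restrict mg) (measurable_pair2 w)).
by apply/funext => t; rewrite patch_strip.
Qed.

Lemma pmeas_slice g t : pmeas g -> t \in `[0, T] -> measurable_fun setT (g t).
Proof.
move=> mg tT; rewrite (_ : g t = fun w => ((fun z => g z.1 z.2) \_ strip) (t, w)).
  exact: (measurableT_comp (pmeas_restrict mg) (measurable_pair1 t)).
by apply/funext => w; rewrite patch_strip patchE mem_set.
Qed.

Lemma pint_pmeas g : pint g -> pmeas g.
Proof. by case/integrableP => /measurable_EFinP. Qed.

Lemma pint_le g h : pmeas g -> (forall t w, t \in `[0, T] -> `|g t w| <= h t w) ->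
  pint h -> pint g.
Proof.
by move=> mg gh; apply: rintegrable_le => // -[t w] [/= tT _]; exact: gh.
Qed.

Lemma pint_inner g w :
  (\int[mu]_(t in `[0%R, T]) (g t w)%:E =
   \int[mu]_t (EFin \o ((fun z => g z.1 z.2) \_ strip)) (t, w))%E.
Proof.
rewrite integral_mkcond; apply: eq_integral => t _.
by rewrite /= patch_strip !patchE; case: ifP.
Qed.

Let pint_restrict g : pint g ->
  (mu \x P)%E.-integrable setT (EFin \o ((fun z => g z.1 z.2) \_ strip)).
Proof. by move=> /(integrable_mkcond _ mS); rewrite restrict_EFin. Qed.

Lemma pint_ae g : pint g ->
  {ae P, forall w, mu.-integrable `[0, T] (EFin \o (g ^~ w))}.
Proof.
move=> /pint_restrict/ae_integrable2; apply: filterS => w h.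
apply/(integrable_mkcond _ mI); apply: eq_integrable h => // t _.
by rewrite /= patch_strip !patchE; case: ifP.
Qed.

Lemma pint_tonelli g : pmeas g -> (forall t w, t \in `[0, T] -> 0 <= g t w) ->
  (Eint P T g < +oo)%E -> pint g.
Proof.
move=> mg g0 Eg; apply/(integrable_mkcond _ mS); rewrite restrict_EFin.
have mg' := pmeas_restrict mg.
apply/integrable21ltyP; first exact/measurable_EFinP.
move: Eg; rewrite /Eint; congr (_ < _)%E; apply: eq_integral => w _.
rewrite pint_inner; apply: eq_integral => t _; rewrite /= ger0_norm//.
by rewrite patch_strip patchE; case: ifPn => // /set_mem; exact: g0.
Qed.

Definition tint g (w : Omega) : R := \int[mu]_(t in `[0, T]) g t w.

(** The extended inner integral is finite off a null set, where it equals the real-valued [tint].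
    [Eint] thereby becomes the expectation of a real random variable, which can be compared sample
    by sample. *)
Lemma pint_tint g : pint g -> P.-integrable setT (EFin \o tint g) /\
  (Eint P T g = \int[P]_w (tint g w)%:E)%E.
Proof.
move=> pg; have pg' := pint_restrict pg.
have iG : P.-integrable setT
    (fun w => \int[mu]_t (EFin \o ((fun z => g z.1 z.2) \_ strip)) (t, w))%E.
  have mG := measurable_fubini_G pg'.
  have mf := measurable_int _ pg'.
  apply/integrableP; split => //.
  have /(integrable21ltyP mu P mf) := pg'; apply: le_lt_trans.
  apply: ge0_le_integral => //.
  - exact: measurableT_comp.
  - have ma : measurable_fun setT (abse \o (EFin \o ((fun z => g z.1 z.2) \_ strip))).
      exact: measurableT_comp.
    apply: (@measurable_fun_fubini_tonelli_G _ _ _ _ R mu _ ma) => z; exact: abse_ge0.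
  - move=> w _; apply: le_abse_integral => //.
    exact: (measurableT_comp mf (measurable_pair2 w)).
have aG : ae_eq P setT (fun w => \int[mu]_t (EFin \o ((fun z => g z.1 z.2) \_ strip)) (t, w))%E
    (EFin \o tint g).
  have := pint_ae pg; apply: filterS => w iw _; rewrite -pint_inner /=.
  by rewrite /tint /Rintegral fineK//; exact: integrable_fin_num.
have mt : measurable_fun setT (EFin \o tint g).
  apply: measurableT_comp => //; rewrite /tint /Rintegral.
  apply: measurableT_comp; first exact: fine_measurable.
  rewrite (_ : (fun w => _) = (fun w => \int[mu]_t (EFin \o ((fun z => g z.1 z.2) \_ strip)) (t, w))%E).
    exact: measurable_int iG.
  by apply/funext => w; rewrite pint_inner.
split.
  apply/integrableP; split => //.
  case/integrableP: iG => mG; apply: le_lt_trans.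
  rewrite le_eqVlt; apply/orP; left; apply/eqP; apply: ge0_ae_eq_integral => //.
  - by apply: measurableT_comp.
  - by apply: measurableT_comp.
  - by move: aG; apply: filterS => w h /h /= ->.
rewrite /Eint; under eq_integral do rewrite pint_inner.
apply: ae_eq_integral => //; exact: measurable_int iG.
Qed.

(* By Tonelli applied to the positive and negative parts. *)
Lemma pmeas_indefinite g : pmeas g ->
  pmeas (fun t w => \int[mu]_(s in `[0, t]) g s w).
Proof.
move=> mg; have mg' := pmeas_restrict mg.
pose K := fun z : (measurableTypeR R * Omega) * measurableTypeR R =>
  if z.2 <= z.1.1 then ((fun z => g z.1 z.2) \_ strip) (z.2, z.1.2) else 0.
have mK : measurable_fun setT K.
  apply: measurable_fun_ifT => //.
    apply: measurable_fun_ler; first exact: measurable_snd.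
    exact: (measurableT_comp (@measurable_fst _ _ (measurableTypeR R) Omega) (@measurable_fst _ _ (measurableTypeR R * Omega)%type (measurableTypeR R))).
  apply: (measurableT_comp mg'); apply/measurable_fun_pairP; split.
    exact: measurable_snd.
  exact: (measurableT_comp (@measurable_snd _ _ (measurableTypeR R) Omega) (@measurable_fst _ _ (measurableTypeR R * Omega)%type (measurableTypeR R))).
have mF : measurable_fun setT (fun z => \int[mu]_s (EFin \o K) (z, s))%E.
  rewrite (_ : (fun z => _) = (fun z => \int[mu]_s ((EFin \o K)^\+)%E (z, s)) \-
     (fun z => \int[mu]_s ((EFin \o K)^\-)%E (z, s)))%E; last first.
    apply/funext => z; rewrite integralE.
    congr (_ - _)%E; apply: eq_integral => s _; first by rewrite !funeposE.
    by rewrite !funenegE.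
  have mE : measurable_fun setT (EFin \o K) by apply/measurable_EFinP.
  apply: emeasurable_funB.
    refine (@measurable_fun_fubini_tonelli_F _ _ _ _ R mu ((EFin \o K)^\+)%E _ _).
      exact: measurable_funepos.
    by move=> x; exact: funepos_ge0.
  refine (@measurable_fun_fubini_tonelli_F _ _ _ _ R mu ((EFin \o K)^\-)%E _ _).
    exact: measurable_funeneg.
  by move=> x; exact: funeneg_ge0.
apply: (@eq_measurable_fun _ _ _ _ _ (fun z => fine (\int[mu]_s (EFin \o K) (z, s)))%E).
  move=> [t w] /set_mem[/= tT _]; rewrite /Rintegral [in RHS]integral_mkcond.
  congr fine; apply: eq_integral => s _; rewrite /K/= patch_strip !patchE !mem_seg.
  move: tT; rewrite in_itv/= => /andP[t0 tT].
  have [st|ts] := leP s t; last by rewrite andbF.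
  by rewrite andbT (le_trans st tT) andbT; case: ifP.
apply: measurable_funTS.
by apply: measurableT_comp; [exact: fine_measurable|exact: mF].
Qed.

(** Brings the expectation inside, where moment bounds at fixed times can be used. *)
Lemma Eint_swap g : pmeas g -> (forall t w, t \in `[0, T] -> 0 <= g t w) ->
  (Eint P T g = \int[mu]_(t in `[0%R, T]) \int[P]_w (g t w)%:E)%E.
Proof.
move=> mg g0; have mg' := pmeas_restrict mg.
have h0 z : (0 <= (EFin \o ((fun z => g z.1 z.2) \_ strip)) z)%E.
  by rewrite lee_fin patchE; case: ifPn => // /set_mem[/= zT _]; exact: g0.
have mE : measurable_fun setT (EFin \o ((fun z => g z.1 z.2) \_ strip)) by apply/measurable_EFinP.
rewrite /Eint; under eq_integral do rewrite pint_inner.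
rewrite -(@fubini_tonelli _ _ _ _ R mu P _ mE h0) [RHS]integral_mkcond; apply: eq_integral => t _.
rewrite patchE; case: ifPn => tT.
  by apply: eq_integral => w _; rewrite /= patch_strip patchE tT.
by apply: integral0_eq => w _; rewrite /= patch_strip patchE (negbTE tT).
Qed.

End ProductIntegrals.

(** * State equations *)

Section PathwiseEquations.
Context {R : realType}.
Notation mu := (@lebesgue_measure R).
Variables (T : R) (T0 : 0 <= T).

Definition l1 {k} (b : R -> 'cV[R]_k) : Prop :=
  forall j, mu.-integrable `[0, T] (EFin \o (fun t => b t j 0)).

(** The equation of [solves_sde] for one fixed sample; additive noise lets the equation be treated
    as a deterministic one. *)
Definition sol_path {k} (z0 : 'cV[R]_k) (b M z : R -> 'cV[R]_k) : Prop :=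
  forall t, t \in `[0, T] ->
    z t = z0 + \col_j (\int[mu]_(s in `[0, t]) (b s j 0)) + M t.

Lemma l2_l1 k (b : R -> 'cV[R]_k) : l2 T b -> l1 b.
Proof. by move=> lb j; exact: l2_L1. Qed.

Lemma l1_mprim k (b : R -> 'cV[R]_k) : l1 b ->
  mprim T b (fun t => \col_j (\int[mu]_(s in `[0, t]) (b s j 0))).
Proof.
move=> lb i j; rewrite ord1; split; first exact: lb.
by move=> t tT; rewrite !mxE set_itv1 Rintegral_set1 add0r.
Qed.

(** The common initial value and noise cancel, so the difference is absolutely continuous although
    the two paths in general are not. *)
Lemma sol_path_sub k (z0 : 'cV[R]_k) b b' M z z' : l1 b -> l1 b' ->
  sol_path z0 b M z -> sol_path z0 b' M z' ->
  mprim T (fun t => b t - b' t) (fun t => z t - z' t) /\ z 0 - z' 0 = 0.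
Proof.
move=> lb lb' hz hz'; split.
  apply: eq_mprim (mprimB (l1_mprim lb) (l1_mprim lb')) => // t tT.
  rewrite hz// hz'//; apply/matrixP => i j; rewrite !mxE; ring.
rewrite hz ?hz' ?mem0_seg//; apply/matrixP => i j; rewrite !mxE.
by rewrite set_itv1 !Rintegral_set1; ring.
Qed.

Lemma l2_linear k r n (A : 'M[R]_(n, k)) (B : 'M[R]_(n, r)) (x : R -> 'cV[R]_k) (u : R -> 'cV[R]_r) :
  l2 T x -> l2 T u -> l2 T (fun t => A *m x t + B *m u t).
Proof. by move=> lx lu; apply: l2D; apply: l2_mulmx. Qed.

Section agents.
Variables (N n r : nat) (A G : 'M[R]_n) (B : 'M[R]_(n, r)).
Implicit Types (X Y : 'I_N -> R -> 'cV[R]_n) (u : 'I_N -> R -> 'cV[R]_r).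

Definition avg (x : 'I_N -> 'cV[R]_n) : 'cV[R]_n := N%:R^-1 *: \sum_(i < N) x i.

Definition agent_drift X u (f : R -> 'cV[R]_n) (i : 'I_N) (t : R) : 'cV[R]_n :=
  A *m X i t + B *m u i t + G *m avg (X ^~ t) + f t.

Lemma mcont_avg X : (forall i, mcont T (X i)) -> mcont T (fun t => avg (X ^~ t)).
Proof.
move=> cX i j; rewrite (_ : (fun _ => _) = (fun t => N%:R^-1 * \sum_(k < N) X k t i j)).
  apply: within_continuousM; first by apply: continuous_subspaceT => x; exact: cst_continuous.
  by apply: within_continuous_sum => k; exact: cX.
by apply/funext => t; rewrite mxE summxE.
Qed.

Lemma l2_agent_drift X u f i : (forall i, mcont T (X i)) -> (forall i, l2 T (u i)) ->
  l2 T f -> l2 T (agent_drift X u f i).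
Proof.
move=> cX lu lf; apply: l2D => //; apply: l2D.
  by apply: l2_linear => //; exact: l2_mcont.
by apply: l2_mulmx; apply: l2_mcont; exact: mcont_avg.
Qed.

(** The displacements of two agents see the same average and the same f - g, so their difference D
    solves D' = A D from 0 and vanishes. The average displacement is then the common one, which
    turns the drift into A + G. *)
Lemma agents_diff X Y u f g (z0 : 'I_N -> 'cV[R]_n) M (i0 : 'I_N) :
  (0 < N)%N ->
  (forall i, mcont T (X i)) -> (forall i, mcont T (Y i)) ->
  (forall i, l2 T (u i)) -> l2 T f -> l2 T g ->
  (forall i, sol_path (z0 i) (agent_drift X u f i) (M i) (X i)) ->
  (forall i, sol_path (z0 i) (agent_drift Y u g i) (M i) (Y i)) ->
  driven T A G (fun t => f t - g t) (fun t => X i0 t - Y i0 t) /\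
  forall i t, t \in `[0, T] -> X i t - Y i t = X i0 t - Y i0 t.
Proof.
move=> N0 cX cY lu lf lg hX hY.
have h i := sol_path_sub (l2_l1 (l2_agent_drift i cX lu lf)) (l2_l1 (l2_agent_drift i cY lu lg)) (hX i) (hY i).
have avgB t : avg (X ^~ t) - avg (Y ^~ t) = avg (fun i => X i t - Y i t).
  by rewrite /avg -scalerBr -sumrB.
have drift i t : agent_drift X u f i t - agent_drift Y u g i t =
    A *m (X i t - Y i t) + G *m avg (fun i => X i t - Y i t) + (f t - g t).
  rewrite /agent_drift -avgB !mulmxBr; apply/matrixP => a b; rewrite !mxE; ring.
have same i t : t \in `[0, T] -> X i t - Y i t = X i0 t - Y i0 t.
  move=> tT; apply/eqP; rewrite -subr_eq0; apply/eqP.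
  have hd : mprim T (fun t => A *m ((X i t - Y i t) - (X i0 t - Y i0 t)))
      (fun t => (X i t - Y i t) - (X i0 t - Y i0 t)).
    apply: eq_mprim (mprimB (h i).1 (h i0).1) => // s _.
    rewrite !drift [RHS]mulmxBr; apply/matrixP => a b; rewrite !mxE; ring.
  apply: (linear_unique T0 (@mcont_cst _ T _ _ A) hd (mem0_seg T0)) => //.
  by rewrite (h i).2 (h i0).2 subr0.
split => //; split; last exact: (h i0).2.
apply: eq_mprim (h i0).1 => // t tT; rewrite drift.
have -> : avg (fun i => X i t - Y i t) = X i0 t - Y i0 t.
  rewrite /avg (eq_bigr (fun=> X i0 t - Y i0 t)); last by move=> i _; exact: same.
  rewrite sumr_const card_ord -[X in _ *: X]scaler_nat scalerA mulVf ?scale1r//.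
  by rewrite pnatr_eq0 -lt0n.
by rewrite -mulmxDl.
Qed.

End agents.

Lemma driven_ones N n (A G : 'M[R]_n) f xi (y : R -> 'cV[R]_(N * n)) :
  (0 < N)%N -> l2 T f -> driven T A G f xi -> mcont T y ->
  sol_path 0 (fun t => Acheck N A G *m y t + ones_tens N (f t)) (fun=> 0) y ->
  forall t, t \in `[0, T] -> y t = ones_tens N (xi t).
Proof.
move=> N0 lf [hxi xi0] cy hy t tT.
have lb : l1 (fun t => Acheck N A G *m y t + ones_tens N (f t)).
  apply: l2_l1; apply: l2D; first by apply: l2_mulmx; exact: l2_mcont.
  rewrite (_ : (fun t => _) = fun t => ones_tens N 1%:M *m f t); first exact: l2_mulmx.
  by apply/funext => s; rewrite ones_tens_mul mul1mx.
have hy' : mprim T (fun t => Acheck N A G *m y t + ones_tens N (f t)) y.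
  apply: eq_mprim (l1_mprim lb) => // s sT.
  by rewrite (hy s sT) add0r addr0.
have hE : mprim T (fun t => Acheck N A G *m ones_tens N (xi t) + ones_tens N (f t))
    (fun t => ones_tens N (xi t)).
  apply: eq_mprim (mprimMl T0 (ones_tens N 1%:M) hxi) => // s _.
    by rewrite ones_tens_mul mul1mx Acheck_ones// ones_tensD.
  by rewrite ones_tens_mul mul1mx.
apply/eqP; rewrite -subr_eq0; apply/eqP.
have hd : mprim T (fun t => Acheck N A G *m (y t - ones_tens N (xi t)))
    (fun t => y t - ones_tens N (xi t)).
  apply: eq_mprim (mprimB hy' hE) => // s _; rewrite mulmxBr.
  by rewrite opprD addrACA subrr addr0.
apply: (linear_unique T0 (@mcont_cst _ T _ _ (Acheck N A G)) hd (mem0_seg T0)) => //.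
rewrite xi0 ones_tens0 subr0 (hy _ (mem0_seg T0)) add0r addr0.
by apply/matrixP => i j; rewrite !mxE set_itv1 Rintegral_set1.
Qed.

(* The bound is pathwise: the noise M is only used through the paths m = z0 + M. *)
Lemma sol_path_bound k (A : 'M[R]_k) : exists C : R, 0 <= C /\
  forall z0 (g M z : R -> 'cV[R]_k), mcont T z -> l2 T g ->
    sol_path z0 (fun t => A *m z t + g t) M z ->
    forall t, t \in `[0, T] ->
    sqnorm (z t) <= 2 * sqnorm (z0 + M t) +
      C * (\int[mu]_(s in `[0, T]) sqnorm (z0 + M s) + \int[mu]_(s in `[0, T]) sqnorm (g s)).
Proof.
have [C [C0 hC]] := linear_energy_bound T0 (@mcont_cst _ T _ _ A).
have [B [B0 hB]] := sqnorm_mulmx A.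
exists (2 * C * (2 * B + 2)); split.
  by rewrite !mulr_ge0 ?addr_ge0 ?mulr_ge0// ltW.
move=> z0 g M z cz lg hz t tT.
have lb : l2 T (fun t => A *m z t + g t).
  by apply: l2D => //; apply: l2_mulmx; exact: l2_mcont.
pose y t := \col_j (\int[mu]_(s in `[0, t]) ((A *m z s + g s) j 0)) : 'cV[R]_k.
have hy : mprim T (fun t => A *m z t + g t) y by exact: l1_mprim (l2_l1 lb).
have ze s : s \in `[0, T] -> z s = y s + (z0 + M s).
  by move=> sT; rewrite (hz s sT) /y addrAC addrC.
(* No regularity of [M] is given; on [0, T] it is recovered from the continuity of [z] and [y],
   whose difference is [z0 + M]. *)
have lm : l2 T (fun t => z0 + M t).
  have : l2 T (fun t => z t - y t).
    apply: l2_mcont; apply: mcontD => //; apply: mcontN; exact: mcont_prim hy.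
  move=> lzy; have [mzy izy] := lzy.
  split.
    move=> j; apply: eq_measurable_fun (mzy j) => s /set_mem sT.
    by rewrite ze// [y s + _]addrC addrK.
  apply: eq_integrable izy => // s /set_mem sT /=.
  by rewrite ze// [y s + _]addrC addrK.
have lAm : l2 T (fun t => A *m (z0 + M t)) by exact: l2_mulmx.
have lh : l2 T (fun t => A *m (z0 + M t) + g t) by exact: l2D.
have hy' : mprim T (fun t => A *m y t + (A *m (z0 + M t) + g t)) y.
  apply: eq_mprim hy => // s sT; rewrite ze// mulmxDr -addrA; congr (_ + _).
have y0 : y 0 = 0.
  by apply/matrixP => i j; rewrite !mxE set_itv1 Rintegral_set1.
have := hC _ _ hy' y0 lh.2 t tT => yb.
rewrite ze//; apply: (le_trans (sqnormD _ _)); rewrite addrC lerD2l.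
have mI := measurable_seg 0 T.
have hI : \int[mu]_(s in `[0, T]) sqnorm (A *m (z0 + M s) + g s) <=
    (2 * B + 2) * (\int[mu]_(s in `[0, T]) sqnorm (z0 + M s) + \int[mu]_(s in `[0, T]) sqnorm (g s)).
  have im := lm.2; have ig := lg.2.
  rewrite -RintegralD// -RintegralZl//; last exact: rintegrableD.
  apply: le_Rintegral => //; first exact: lh.2.
    by apply: rintegrableZ => //; exact: rintegrableD.
  move=> s sT; apply: (le_trans (sqnormD _ _)).
  have := hB (z0 + M s); have := sqnorm_ge0 (z0 + M s); have := sqnorm_ge0 (g s).
  have := mulr_ge0 B0 (sqnorm_ge0 (g s)).
  move: (sqnorm (A *m _)) (sqnorm (z0 + _)) (sqnorm (g s)) => q1 q2 q3; nra.
rewrite -!mulrA ler_wpM2l//; apply: (le_trans yb); rewrite ler_wpM2l//.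
exact: ltW.
Qed.

End PathwiseEquations.

(** * Processes square integrable in time and sample, and admissible controls *)

Section SquareIntegrableProcesses.
Context {d0 : measure_display} {Omega : measurableType d0} {R : realType}.
Variables (P : probability Omega R) (T : R) (T0 : 0 <= T).
Notation mu := (@lebesgue_measure R).

Lemma measurable_fun_qform d (X : measurableType d) (D : set X) k (M : 'M[R]_k) (f : X -> 'cV[R]_k) :
  (forall j, measurable_fun D (fun t => f t j 0)) ->
  measurable_fun D (fun t => qform M (f t)).
Proof.
move=> mf; under eq_fun do rewrite qform_sum.
by apply: measurable_sum => i; apply: measurable_funM => //; exact: measurable_mulmx.
Qed.

Lemma qform_bound k (M : 'M[R]_k) : exists C : R, 0 <= C /\
  forall z, `|qform M z| <= C * sqnorm z.
Proof.
have [B [B0 hB]] := sqnorm_mulmx M; exists (1 + B); split; first by rewrite addr_ge0.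
move=> z; rewrite qform_sum; apply: (le_trans (ler_norm_sum _ _ _)).
apply: (@le_trans _ _ (sqnorm z + sqnorm (M *m z))).
  rewrite /sqnorm -big_split/=; apply: ler_sum => i _; rewrite normrM.
  rewrite -[z i 0 ^+ 2]real_normK ?num_real// -[(M *m z) i 0 ^+ 2]real_normK ?num_real//.
  have := sqr_ge0 (`|z i 0| - `|(M *m z) i 0|).
  have := mulr_ge0 (normr_ge0 (z i 0)) (normr_ge0 ((M *m z) i 0)).
  move: `|_| `|_| => u v; nra.
by rewrite mulrDl mul1r lerD2l.
Qed.

Lemma integrable_ae_le (f h : Omega -> R) : measurable_fun setT f ->
  (forall w, 0 <= f w) -> {ae P, forall w, f w <= h w} ->
  P.-integrable setT (EFin \o h) -> P.-integrable setT (EFin \o f).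
Proof.
move=> mf f0 fh ih; apply/integrableP; split; first exact/measurable_EFinP.
have /integrableP[mh hoo] := ih.
apply: le_lt_trans hoo; apply: ae_ge0_le_integral => //.
- by apply: measurableT_comp => //; exact/measurable_EFinP.
- exact: measurableT_comp.
move: fh; apply: filterS => w fhw _ /=.
by rewrite lee_fin ger0_norm//; apply: (le_trans fhw); exact: ler_norm.
Qed.

Lemma measurable_inner (g : R -> Omega -> R) : pmeas T g ->
  (forall t w, t \in `[0, T] -> 0 <= g t w) ->
  measurable_fun setT (fun w => \int[mu]_(t in `[0%R, T]) (g t w)%:E)%E.
Proof.
move=> mg g0; under eq_fun do rewrite pint_inner.
have mg' := pmeas_restrict mg.
refine (@measurable_fun_fubini_tonelli_G _ _ _ _ R mu
  (EFin \o ((fun z => g z.1 z.2) \_ (strip T))) _ _); first exact/measurable_EFinP.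
by move=> z; rewrite lee_fin patchE; case: ifPn => // /set_mem[/= zT _]; exact: g0.
Qed.

(** Pathwise estimates hold for all times at once but only for almost every sample. The domination
    is therefore made inside the iterated integral rather than pointwise on the strip. *)
Lemma pint_ae_le (g h : R -> Omega -> R) : pmeas T g ->
  (forall t w, t \in `[0, T] -> 0 <= g t w) ->
  {ae P, forall w, forall t, t \in `[0, T] -> g t w <= h t w} ->
  pint P T h -> pint P T g.
Proof.
move=> mg g0 gh ph.
have ph' : pint P T (fun t w => `|h t w|).
  by have := integrable_norm ph.
have mh := pint_pmeas ph'.
have [it Et] := pint_tint ph'.
apply: pint_tonelli => //.
apply: (@le_lt_trans _ _ (Eint P T (fun t w => `|h t w|))).
  apply: ae_ge0_le_integral => //.
  - by move=> w _; apply: integral_ge0 => t tT; rewrite lee_fin g0.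
  - exact: measurable_inner.
  - by move=> w _; apply: integral_ge0 => t tT; rewrite lee_fin.
  - exact: measurable_inner.
  move: gh; apply: filterS => w ghw _; apply: ge0_le_integral => //.
  - by move=> t tT; rewrite lee_fin g0.
  - by apply/measurable_EFinP; exact: pmeas_path.
  - by apply/measurable_EFinP; exact: (pmeas_path w mh).
  - by move=> t tT; rewrite lee_fin; apply: (le_trans (ghw t tT)); exact: ler_norm.
rewrite Et ltey_eq; apply/orP; left; exact: integrable_fin_num.
Qed.

Lemma pint_omega (c : Omega -> R) : P.-integrable setT (EFin \o c) ->
  pint P T (fun _ w => c w).
Proof.
move=> ic.
have mc : measurable_fun setT c by apply/measurable_EFinP; case/integrableP: ic.
have pm : pmeas T (fun _ w => c w).
  by rewrite /pmeas; apply: measurable_funTS; exact: (measurableT_comp mc (@measurable_snd _ _ (measurableTypeR R) Omega)).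
have ic' := integrable_norm ic.
have pm' : pmeas T (fun _ w => `|c w|) by exact: (measurableT_comp _ pm).
apply: (pint_le (h := fun _ w => `|c w|)) => //.
apply: pint_tonelli => //; rewrite /Eint.
under eq_integral do rewrite integral_cst//=.
rewrite ge0_integralZr//.
- apply: lte_mul_pinfty; first exact: integral_ge0.
    exact: integrable_fin_num.
  by have := @lebesgue_measure_itv R `[0, T]; rewrite /= => ->; case: ifP => // _; rewrite -EFinB ltry.
- by apply/measurable_EFinP; exact: measurableT_comp.
Qed.

Definition pl2 {k} (Z : @process _ Omega R k) : Prop :=
  jointly_measurable T Z /\ pint P T (fun t w => sqnorm (Z t w)).

Lemma pmeas_sqnorm k (Z : @process _ Omega R k) : jointly_measurable T Z ->
  pmeas T (fun t w => sqnorm (Z t w)).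
Proof. by move=> mZ; apply: measurable_sqnorm => j; exact: mZ. Qed.

Lemma pmeas_qform k (M : 'M[R]_k) (Z : @process _ Omega R k) : jointly_measurable T Z ->
  pmeas T (fun t w => qform M (Z t w)).
Proof. by move=> mZ; apply: measurable_fun_qform => j; exact: mZ. Qed.

Lemma jm_mulmx p q (A : 'M[R]_(p, q)) (Z : @process _ Omega R q) :
  jointly_measurable T Z -> jointly_measurable T (fun t w => A *m Z t w).
Proof. by move=> mZ j; apply: measurable_mulmx => i; exact: mZ. Qed.

Lemma jmD k (Y Z : @process _ Omega R k) :
  jointly_measurable T Y -> jointly_measurable T Z ->
  jointly_measurable T (fun t w => Y t w + Z t w).
Proof. by move=> mY mZ j; apply: measurable_addmx => i; [exact: mY|exact: mZ]. Qed.

Lemma jmZ k (a : R) (Z : @process _ Omega R k) :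
  jointly_measurable T Z -> jointly_measurable T (fun t w => a *: Z t w).
Proof.
move=> mZ j; apply: (eq_measurable_fun (fun z => a * Z z.1 z.2 j 0)).
  by move=> z _; rewrite mxE.
by apply: measurable_funM => //; exact: mZ.
Qed.

Lemma jmB k (Y Z : @process _ Omega R k) :
  jointly_measurable T Y -> jointly_measurable T Z ->
  jointly_measurable T (fun t w => Y t w - Z t w).
Proof.
move=> mY mZ; rewrite (_ : (fun t w => _) = fun t w => Y t w + (-1) *: Z t w).
  by apply: jmD => //; exact: jmZ.
by apply/funext => t; apply/funext => w; rewrite scaleN1r.
Qed.

Lemma jm_sum k (I : Type) (s : seq I) (Z : I -> @process _ Omega R k) :
  (forall i, jointly_measurable T (Z i)) ->
  jointly_measurable T (fun t w => \sum_(i <- s) Z i t w).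
Proof.
move=> mZ j; apply: (eq_measurable_fun (fun z => \sum_(i <- s) Z i z.1 z.2 j 0)).
  by move=> z _; rewrite summxE.
by apply: measurable_sum => i; exact: mZ.
Qed.

Lemma jm_cst k (z : 'cV[R]_k) : jointly_measurable T (fun _ (_ : Omega) => z).
Proof. by move=> j; exact: measurable_cst. Qed.

Lemma pl2_le k l (Y : @process _ Omega R k) (Z : @process _ Omega R l) (c : R) :
  jointly_measurable T Y ->
  (forall t w, t \in `[0, T] -> sqnorm (Y t w) <= c * sqnorm (Z t w)) ->
  pl2 Z -> pl2 Y.
Proof.
move=> mY YZ [mZ iZ]; split => //.
apply: (pint_le (h := fun t w => c * sqnorm (Z t w))); first exact: pmeas_sqnorm.
  by move=> t w tT; rewrite ger0_norm ?sqnorm_ge0// YZ.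
exact: (rintegrableZ (measurable_strip T) c iZ).
Qed.

Lemma pl2_mulmx p q (A : 'M[R]_(p, q)) (Z : @process _ Omega R q) :
  pl2 Z -> pl2 (fun t w => A *m Z t w).
Proof.
move=> lZ; have [B [_ hB]] := sqnorm_mulmx A.
by apply: (pl2_le _ _ lZ); [apply: jm_mulmx; case: lZ|move=> t w _; exact: hB].
Qed.

Lemma pl2Z k (a : R) (Z : @process _ Omega R k) : pl2 Z -> pl2 (fun t w => a *: Z t w).
Proof.
move=> lZ; apply: (pl2_le (c := a ^+ 2) _ _ lZ); first by apply: jmZ; case: lZ.
by move=> t w _; rewrite sqnormZ.
Qed.

Lemma pl2D k (Y Z : @process _ Omega R k) : pl2 Y -> pl2 Z ->
  pl2 (fun t w => Y t w + Z t w).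
Proof.
move=> [mY iY] [mZ iZ]; split; first exact: jmD.
apply: (pint_le (h := fun t w => 2 * sqnorm (Y t w) + 2 * sqnorm (Z t w))).
- by apply: pmeas_sqnorm; exact: jmD.
- by move=> t w _; rewrite ger0_norm ?sqnorm_ge0// sqnormD.
- have mS := measurable_strip (Omega := Omega) T.
  exact: (rintegrableD mS (rintegrableZ mS 2 iY) (rintegrableZ mS 2 iZ)).
Qed.

Lemma pl2B k (Y Z : @process _ Omega R k) : pl2 Y -> pl2 Z ->
  pl2 (fun t w => Y t w - Z t w).
Proof.
move=> lY lZ; rewrite (_ : (fun t w => _) = fun t w => Y t w + (-1) *: Z t w).
  by apply: pl2D => //; exact: pl2Z.
by apply/funext => t; apply/funext => w; rewrite scaleN1r.
Qed.

Lemma pl2_cst k (z : 'cV[R]_k) : pl2 (fun _ _ => z).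
Proof.
split; first exact: jm_cst.
have : P.-integrable setT (EFin \o cst (sqnorm z)) by exact: finite_measure_integrable_cst.
exact: pint_omega.
Qed.

Lemma pl2_sum k (I : Type) (s : seq I) (Z : I -> @process _ Omega R k) :
  (forall i, pl2 (Z i)) -> pl2 (fun t w => \sum_(i <- s) Z i t w).
Proof.
move=> lZ; elim: s => [|i s IH].
  rewrite (_ : (fun t w => _) = fun _ _ => 0); first exact: pl2_cst.
  by apply/funext => t; apply/funext => w; rewrite big_nil.
rewrite (_ : (fun t w => _) = fun t w => Z i t w + \sum_(j <- s) Z j t w); first exact: pl2D.
by apply/funext => t; apply/funext => w; rewrite big_cons.
Qed.

Lemma pl2_ae_eq k (Y Z : @process _ Omega R k) : jointly_measurable T Y -> pl2 Z ->
  {ae P, forall w, forall t, t \in `[0, T] -> Y t w = Z t w} -> pl2 Y.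
Proof.
move=> mY [mZ iZ] YZ; split => //; apply: (pint_ae_le _ _ _ iZ).
- exact: pmeas_sqnorm.
- by move=> t w _; exact: sqnorm_ge0.
- by move: YZ; apply: filterS => w h t tT; rewrite h.
Qed.

Lemma pl2_path k (Z : @process _ Omega R k) : pl2 Z -> {ae P, forall w, l2 T (Z ^~ w)}.
Proof.
move=> [mZ iZ]; have := pint_ae iZ; apply: filterS => w iw; split => // j.
exact: (@pmeas_path _ _ _ T (fun t w => Z t w j 0) w (mZ j)).
Qed.

Lemma pint_qform k (M : 'M[R]_k) (Z : @process _ Omega R k) : pl2 Z ->
  pint P T (fun t w => qform M (Z t w)).
Proof.
move=> [mZ iZ]; have [C [_ hC]] := qform_bound M.
apply: (pint_le (h := fun t w => C * sqnorm (Z t w))); first exact: pmeas_qform.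
  by move=> t w _; exact: hC.
exact: (rintegrableZ (measurable_strip T) C iZ).
Qed.

Lemma pint_Eint_lt (g : R -> Omega -> R) : pint P T g -> (Eint P T g < +oo)%E.
Proof.
move=> pg; have [it ->] := pint_tint pg.
by rewrite ltey_eq; apply/orP; left; exact: integrable_fin_num.
Qed.

Section admissibility.
Variables (N n d : nat) (x0 : 'I_N -> Omega -> 'cV[R]_n) (W : 'I_N -> @process _ Omega R d).

Lemma admissible_pl2 k (f : @process _ Omega R k) : admissible P T x0 W f -> pl2 f.
Proof.
case=> mf _ ff; split => //; apply: pint_tonelli => //; first exact: pmeas_sqnorm.
by move=> t w _; exact: sqnorm_ge0.
Qed.

(** Rephrases adaptedness as measurability on the space equipped with the generated sigma-algebra,
    so that the closure of measurable functions under sums and multiples can be used. *)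
Lemma sigma_rv_subP k (v : Omega -> 'cV[R]_k) (C : set_system Omega) :
  sigma_rv v `<=` <<s C >> <->
  forall j, measurable_fun (setT : set (g_sigma_algebraType C)) (fun w => v w j 0).
Proof.
split=> [sv j _ B mB|mv].
  rewrite setTI; apply: sv; apply: sub_sigma_algebra.
  by exists j => //; exists B => //; rewrite setTI.
apply: smallest_sub; first exact: smallest_sigma_algebra.
move=> A [j _ [B mB <-]]; exact: (mv j measurableT B mB).
Qed.

Lemma admissible_comb k (f g : @process _ Omega R k) (a b : R) :
  admissible P T x0 W f -> admissible P T x0 W g ->
  admissible P T x0 W (fun t w => a *: f t w + b *: g t w).
Proof.
move=> af ag; have lf := admissible_pl2 af; have lg := admissible_pl2 ag.
have [mh ih] := pl2D (pl2Z a lf) (pl2Z b lg).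
split => //; last exact: pint_Eint_lt.
move=> t tT; apply/sigma_rv_subP => j.
have /sigma_rv_subP sf := adm_adapted af tT.
have /sigma_rv_subP sg := adm_adapted ag tT.
rewrite (_ : (fun w => _) = (fun w => a * f t w j 0 + b * g t w j 0)).
  by apply: measurable_funD; apply: measurable_funM.
by apply/funext => w; rewrite !mxE.
Qed.

Lemma admissible_deterministic k (f : R -> 'cV[R]_k) : l2 T f ->
  admissible P T x0 W (fun t _ => f t).
Proof.
move=> [mf ff]; have mZ : jointly_measurable T (fun t (_ : Omega) => f t).
  move=> j.
  have mfr : measurable_fun setT ((fun t => f t j 0) \_ `[0, T]).
    exact: ((measurable_restrictT (fun t => f t j 0) (measurable_seg 0 T)).1 (mf j)).
  apply: (@eq_measurable_fun _ _ _ _ _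
    (((fun t => f t j 0) \_ `[0, T]) \o (@fst (measurableTypeR R) Omega))).
    by move=> [t w] /set_mem[/= tT _]; rewrite /= patchE mem_set.
  by apply: measurable_funTS; apply: measurableT_comp => //; exact: measurable_fst.
split => //.
  move=> t tT; apply/sigma_rv_subP => j; exact: measurable_cst.
rewrite /Eint integral_cst//= probability_setT mule1.
by rewrite ltey_eq; apply/orP; left; exact: integrable_fin_num.
Qed.

End admissibility.
End SquareIntegrableProcesses.

(** * All agents as one system *)

Section Stack.
Context {R : realType}.
Variables (N n : nat).

Definition stack (x : 'I_N -> 'cV[R]_n) : 'cV[R]_(N * n) :=
  \col_k x (mxtens_unindex k).1 (mxtens_unindex k).2 0.

Lemma sqnorm_stack x : sqnorm (stack x) = \sum_i sqnorm (x i).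
Proof.
rewrite /sqnorm sum_mxtens; apply: eq_bigr => i _; apply: eq_bigr => j _.
by rewrite mxE mxtens_indexK.
Qed.

Lemma stackD x y : stack x + stack y = stack (fun i => x i + y i).
Proof. by apply/matrixP => i j; rewrite !mxE. Qed.

(** The coupling through the average becomes part of one linear drift, so the estimate for a single
    equation covers all agents at once. *)
Lemma Acheck_stack (A G : 'M[R]_n) x :
  Acheck N A G *m stack x = stack (fun i => A *m x i + G *m avg x).
Proof.
apply/matrixP => k j; rewrite ord1 {j} mxE [RHS]mxE sum_mxtens.
set a := (mxtens_unindex k).1; set b := (mxtens_unindex k).2.
transitivity (\sum_i \sum_l ((i == a)%:R * (A b l * x i l 0) + N%:R^-1 * (G b l * x i l 0))).
  apply: eq_bigr => i _; apply: eq_bigr => l _.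
  rewrite !mxE big_ord1 !mxE !mxtens_indexK/= -/a -/b !mul1r eq_sym; ring.
under eq_bigr do rewrite big_split/=.
rewrite big_split/= [RHS]mxE; congr (_ + _).
  rewrite (bigD1 a)//= [X in _ + X]big1 ?addr0; last first.
    by move=> i /negbTE ia; rewrite big1// => l _; rewrite ia mul0r.
  by rewrite mxE; apply: eq_bigr => l _; rewrite eqxx mul1r.
rewrite exchange_big mxE; apply: eq_bigr => l _; rewrite mxE summxE.
by rewrite mulrCA !mulr_sumr; apply: eq_bigr => i _; ring.
Qed.

End Stack.

(** * Second moments of the states *)

Section Moments.
Context {d0 : measure_display} {Omega : measurableType d0} {R : realType}.
Variables (P : probability Omega R) (T : R) (T0 : 0 <= T).
Notation mu := (@lebesgue_measure R).
Variables (N n r d : nat) (A G : 'M[R]_n) (B : 'M[R]_(n, r)) (sigma : 'M[R]_(n, d)).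
Variables (W : 'I_N -> @process d0 Omega R d) (x0 : 'I_N -> Omega -> 'cV[R]_n).
Hypothesis W_bm : forall i, brownian_motion P T (W i).
Hypothesis x0_measurable : forall i, sigma_rv (x0 i) `<=` measurable.
Hypothesis x0_square_integrable : forall i, ('E_P[fun w => sqnorm (x0 i w)] < +oo)%E.
Variables (u : 'I_N -> @process d0 Omega R r) (f : @process d0 Omega R n).
Hypothesis u_pl2 : forall i, pl2 P T (u i).
Hypothesis f_pl2 : pl2 P T f.
Variable X : 'I_N -> @process d0 Omega R n.
Hypothesis X_state : state_eq P T A G B sigma x0 W u f X.

Lemma state_paths : {ae P, forall w, forall i,
  mcont T (X i ^~ w) /\
  sol_path T (x0 i w)
    (agent_drift A G B (fun i => X i ^~ w) (fun i => u i ^~ w) (f ^~ w) i)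
    (fun t => sigma *m W i t w) (X i ^~ w)}.
Proof.
apply: filter_forall => i; have [_] := X_state i; apply: filterS => w [cX hX].
by split; [apply/mcont_mx|].
Qed.

Let mW i t : t \in `[0, T] -> forall j, measurable_fun setT (fun w => W i t w j 0).
Proof. by move=> tT; apply: sigma_rv_measurable; exact: bm_measurable (W_bm i) t tT. Qed.

Let mx0 i j : measurable_fun setT (fun w => x0 i w j 0).
Proof. exact: sigma_rv_measurable. Qed.

Definition noise i t w : 'cV[R]_n := x0 i w + sigma *m W i t w.

Let measurable_noise i t : t \in `[0, T] ->
  forall j, measurable_fun setT (fun w => noise i t w j 0).
Proof.
move=> tT; apply: measurable_addmx => //; apply: measurable_mulmx; exact: mW.
Qed.

(** Initial state and Brownian part are bounded separately, the latter component by component; the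
    bound is uniform in time so that it can be integrated over [0, T]. *)
Lemma noise_moment i : exists C : R, forall t, t \in `[0, T] ->
  (\int[P]_w (sqnorm (noise i t w))%:E <= C%:E)%E.
Proof.
have [M [M0 hM]] := sqnorm_mulmx sigma.
have x0fin : (\int[P]_w (sqnorm (x0 i w))%:E)%E \is a fin_num.
  have := x0_square_integrable i; rewrite unlock => h.
  by rewrite ge0_fin_numE// integral_ge0// => w _; rewrite lee_fin sqnorm_ge0.
exists (2 * fine (\int[P]_w (sqnorm (x0 i w))%:E)%E + 2 * M * (\sum_(j < d) 16 * T)).
move=> t tT.
have ms k (v : Omega -> 'cV[R]_k) : (forall j, measurable_fun setT (fun w => v w j 0)) ->
    measurable_fun setT (fun w => (sqnorm (v w))%:E).
  by move=> mv; apply/measurable_EFinP; exact: measurable_sqnorm.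
have mx := ms _ _ (mx0 i); have mw := ms _ _ (mW i tT).
apply: (@le_trans _ _ (\int[P]_w (2%:E * (sqnorm (x0 i w))%:E + (2 * M)%:E * (sqnorm (W i t w))%:E))%E).
  apply: ge0_le_integral => //.
  - by move=> w _; rewrite lee_fin sqnorm_ge0.
  - exact: ms (measurable_noise i tT).
  - by apply: emeasurable_funD; apply: measurable_funeM.
  move=> w _; rewrite -!EFinM -EFinD lee_fin; apply: (le_trans (sqnormD _ _)).
  by rewrite lerD2l -mulrA ler_wpM2l.
rewrite ge0_integralD//; last 4 first.
- by move=> w _; rewrite mule_ge0// lee_fin sqnorm_ge0.
- exact: measurable_funeM.
- by move=> w _; rewrite mule_ge0// lee_fin ?sqnorm_ge0// mulr_ge0.
- exact: measurable_funeM.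
rewrite !ge0_integralZl//; last 3 first.
- by move=> w _; rewrite lee_fin sqnorm_ge0.
- by rewrite lee_fin mulr_ge0.
- by move=> w _; rewrite lee_fin sqnorm_ge0.
rewrite [leRHS]EFinD [X in (_ <= X + _)%E]EFinM fineK// leeD2l//.
rewrite [leRHS]EFinM; apply: lee_pmul => //.
- by rewrite lee_fin mulr_ge0.
- by apply: integral_ge0 => w _; rewrite lee_fin sqnorm_ge0.
rewrite /sqnorm; under eq_integral do rewrite -sumEFin.
rewrite ge0_integral_sum//; last 2 first.
- by move=> j; apply/measurable_EFinP; apply: measurable_funX; exact: mW.
- by move=> j w _; rewrite lee_fin sqr_ge0.
rewrite -sumEFin; apply: lee_sum => j _.
apply: (le_trans (brownian_second_moment j (W_bm i) tT)).
by rewrite lee_fin ler_wpM2l//; move: tT; rewrite in_itv/= => /andP[].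
Qed.

(* A jointly measurable version of the noise, which W itself is not assumed to be. *)
Definition noise_version i t w : 'cV[R]_n :=
  X i t w - \col_j \int[mu]_(s in `[0, t])
    (A *m X i s w + B *m u i s w + G *m average X s w + f s w) j 0.

Let jm_drift i : jointly_measurable T
  (fun s w => A *m X i s w + B *m u i s w + G *m average X s w + f s w).
Proof.
have mX k : jointly_measurable T (X k) by have [] := X_state k.
apply: jmD; last by case: f_pl2.
apply: jmD; last by apply: jm_mulmx; apply: jmZ; exact: jm_sum.
by apply: jmD; apply: jm_mulmx => //; case: (u_pl2 i).
Qed.

Lemma jm_noise_version i : jointly_measurable T (noise_version i).
Proof.
apply: jmB; first by have [] := X_state i.
move=> j.
apply: (eq_measurable_fun (fun z : measurableTypeR R * Omega => \int[mu]_(s in `[0, z.1])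
    (A *m X i s z.2 + B *m u i s z.2 + G *m average X s z.2 + f s z.2) j 0)).
  by move=> z _; rewrite [in RHS]mxE.
exact: (@pmeas_indefinite _ _ _ T (fun s w =>
  (A *m X i s w + B *m u i s w + G *m average X s w + f s w) j 0) (jm_drift i j)).
Qed.

Lemma noise_versionE : {ae P, forall w, forall i t, t \in `[0, T] ->
  noise_version i t w = noise i t w}.
Proof.
have := state_paths; apply: filterS => w h i t tT.
have [_ /(_ t tT) hX] := h i; rewrite /noise_version hX /noise.
by rewrite addrAC addrK.
Qed.

Lemma noise_version_slice i t : t \in `[0, T] ->
  (\int[P]_w (sqnorm (noise_version i t w))%:E =
   \int[P]_w (sqnorm (noise i t w))%:E)%E.
Proof.
move=> tT; apply: ge0_ae_eq_integral => //.
- apply/measurable_EFinP; apply: measurable_sqnorm => j.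
  exact: (@pmeas_slice _ _ _ T (fun t w => noise_version i t w j 0) t (jm_noise_version i j) tT).
- by apply/measurable_EFinP; apply: measurable_sqnorm => j; exact: measurable_noise.
- by move=> w _; rewrite lee_fin sqnorm_ge0.
- by move=> w _; rewrite lee_fin sqnorm_ge0.
by have := noise_versionE; apply: filterS => w h _; rewrite h.
Qed.

Lemma noise_version_pl2 i : pl2 P T (noise_version i).
Proof.
have mn := jm_noise_version i; split => //.
have pm := pmeas_sqnorm mn.
have g0 t w : t \in `[0, T] -> 0 <= sqnorm (noise_version i t w).
  by move=> _; exact: sqnorm_ge0.
apply: pint_tonelli => //; rewrite Eint_swap//.
have [C hC] := noise_moment i.
have C0 : 0 <= C.
  rewrite -lee_fin; apply: le_trans (hC 0 (mem0_seg T0)).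
  by apply: integral_ge0 => w _; rewrite lee_fin sqnorm_ge0.
apply: (@le_lt_trans _ _ (\int[mu]_(t in `[0%R, T]) C%:E)%E); last first.
  have mI := measurable_seg 0 T.
  rewrite integral_cst//= lte_mul_pinfty//.
  by have := @lebesgue_measure_itv R `[0, T]; rewrite /= => ->; case: ifP => // _; rewrite -EFinB ltry.
apply: ge0_le_integral => //.
- by move=> t _; apply: integral_ge0 => w _; rewrite lee_fin sqnorm_ge0.
- have mI := measurable_seg 0 T.
  have mr := pmeas_restrict pm.
  have h : measurable_fun setT (fun t => \int[P]_w
     (EFin \o ((fun z => sqnorm (noise_version i z.1 z.2)) \_ (strip T))) (t, w))%E.
    refine (@measurable_fun_fubini_tonelli_F _ _ _ _ R P
     (EFin \o ((fun z => sqnorm (noise_version i z.1 z.2)) \_ (strip T))) _ _); first exact/measurable_EFinP.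
    by move=> z; rewrite lee_fin patchE; case: ifPn => // _; exact: sqnorm_ge0.
  apply: (eq_measurable_fun (fun t => \int[P]_w
     (EFin \o ((fun z => sqnorm (noise_version i z.1 z.2)) \_ (strip T))) (t, w))%E).
    move=> t tT; apply: eq_integral => w _.
    by rewrite /= (patch_strip T (fun t w => sqnorm (noise_version i t w))) patchE tT.
  exact: measurable_funTS.
- by move=> t tT; rewrite noise_version_slice//; exact: hC.
Qed.

Lemma noise_version_integrable i t : t \in `[0, T] ->
  P.-integrable setT (EFin \o (fun w => sqnorm (noise_version i t w))).
Proof.
move=> tT; apply/integrableP; split.
  apply/measurable_EFinP; apply: measurable_sqnorm => j.
  exact: (@pmeas_slice _ _ _ T (fun t w => noise_version i t w j 0) t (jm_noise_version i j) tT).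
under eq_integral do rewrite /= ger0_norm ?sqnorm_ge0//.
rewrite noise_version_slice//; have [C hC] := noise_moment i.
exact: le_lt_trans (hC t tT) (ltry _).
Qed.

Let input i t w := B *m u i t w + f t w.

Let input_pl2 i : pl2 P T (input i).
Proof. by apply: pl2D => //; exact: pl2_mulmx. Qed.

(** [sol_path_bound] for the stacked system. The right-hand side is written with [noise_version]
    rather than [noise] so that its time integrals are measurable in the sample. *)
Lemma state_bound : exists C : R, 0 <= C /\
  {ae P, forall w, forall i t, t \in `[0, T] ->
    sqnorm (X i t w) <= 2 * \sum_k sqnorm (noise_version k t w) +
      C * (tint T (fun t w => \sum_k sqnorm (noise_version k t w)) w +
           tint T (fun t w => \sum_k sqnorm (input k t w)) w)}.
Proof.
have [C [C0 hC]] := sol_path_bound T0 (Acheck N A G); exists C; split => //.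
have hu : {ae P, forall w, forall i, l2 T (u i ^~ w)}.
  by apply: filter_forall => i; exact: pl2_path.
have hf := pl2_path f_pl2.
near=> w => i t tT.
have hX : forall i, mcont T (X i ^~ w) /\
  sol_path T (x0 i w)
    (agent_drift A G B (fun i => X i ^~ w) (fun i => u i ^~ w) (f ^~ w) i)
    (fun t => sigma *m W i t w) (X i ^~ w).
  by near: w; exact: state_paths.
have hn : forall i t, t \in `[0, T] -> noise_version i t w = noise i t w.
  by near: w; exact: noise_versionE.
have luw : forall i, l2 T (u i ^~ w) by near: w.
have lfw : l2 T (f ^~ w) by near: w.
pose Z t := stack (fun i => X i t w).
pose g t := stack (fun i => input i t w).
pose z0 := stack (fun i => x0 i w).
pose M t := stack (fun i => sigma *m W i t w).
have cZ : mcont T Z.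
  move=> a b; rewrite (_ : (fun _ => _) = fun t => X (mxtens_unindex a).1 t w (mxtens_unindex a).2 0).
    exact: (hX _).1.
  by apply/funext => s; rewrite mxE.
have lg : l2 T g.
  have li k : l2 T (input k ^~ w) by apply: l2D => //; exact: l2_mulmx.
  split.
    move=> a; rewrite (_ : (fun _ => _) = fun t => input (mxtens_unindex a).1 t w (mxtens_unindex a).2 0).
      exact: (li _).1.
    by apply/funext => s; rewrite mxE.
  rewrite (_ : (fun t => _) = fun t => \sum_k sqnorm (input k t w)); last first.
    by apply/funext => s; rewrite sqnorm_stack.
  by apply: rintegrable_sum => // k; case: (li k).
have hZ : sol_path T z0 (fun t => Acheck N A G *m Z t + g t) M Z.
  move=> s sT; apply/matrixP => a b; rewrite ord1 {b}.
  have := (hX (mxtens_unindex a).1).2 s sT => /matrixP/(_ (mxtens_unindex a).2 0).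
  rewrite !mxE => ->; congr (_ + _ + _); apply: eq_Rintegral => x _.
  rewrite /Z /g Acheck_stack stackD [RHS]mxE; congr (fun_of_matrix _ _ _).
  by rewrite /agent_drift /input addrA; congr (_ + _); exact: addrAC.
have := hC _ _ _ _ cZ lg hZ t tT.
have E1 s : s \in `[0, T] -> sqnorm (z0 + M s) = \sum_k sqnorm (noise_version k s w).
  move=> sT; rewrite /z0 /M stackD sqnorm_stack.
  by apply: eq_bigr => k _; rewrite hn.
rewrite E1// /tint.
have -> : \int[mu]_(s in `[0, T]) sqnorm (z0 + M s) =
    \int[mu]_(s in `[0, T]) (\sum_k sqnorm (noise_version k s w)).
  by apply: eq_Rintegral => s /set_mem sT; exact: E1.
have -> : \int[mu]_(s in `[0, T]) sqnorm (g s) =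
    \int[mu]_(s in `[0, T]) (\sum_k sqnorm (input k s w)).
  by apply: eq_Rintegral => s _; rewrite /g sqnorm_stack.
apply: le_trans; rewrite /Z sqnorm_stack (bigD1 i)//= lerDl.
by apply: sumr_ge0 => k _; exact: sqnorm_ge0.
Unshelve. all: by end_near. Qed.

Let pint_sum_sqnorm (Y : 'I_N -> @process d0 Omega R n) : (forall i, pl2 P T (Y i)) ->
  pint P T (fun t w => \sum_k sqnorm (Y k t w)).
Proof.
move=> lY.
exact: (rintegrable_sum (measurable_strip T) _ (fun k => (lY k).2)).
Qed.

Lemma state_pl2 i : pl2 P T (X i).
Proof.
have mX : jointly_measurable T (X i) by have [] := X_state i.
split => //; have [C [C0 hC]] := state_bound.
have p1 := pint_sum_sqnorm noise_version_pl2.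
have p2 := pint_sum_sqnorm input_pl2.
have i1 := (pint_tint p1).1; have i2 := (pint_tint p2).1.
have ic := rintegrableZ measurableT C (rintegrableD measurableT i1 i2).
have mS := measurable_strip (Omega := Omega) T.
have pc := pint_omega T ic.
have ph := rintegrableD mS (rintegrableZ mS 2 p1) pc.
apply: (pint_ae_le _ _ _ ph).
- exact: pmeas_sqnorm.
- by move=> t w _; exact: sqnorm_ge0.
- by move: hC; apply: filterS => w h t tT; exact: h.
Qed.

(** Square integrability over the strip says nothing about the single time T. The bound of
    [state_bound] holds at every time and the noise has a finite moment at T, which gives the
    terminal cost a finite expectation. *)
Lemma state_terminal i : P.-integrable setT (EFin \o (fun w => sqnorm (X i T w))).
Proof.
have mX : jointly_measurable T (X i) by have [] := X_state i.
have [C [C0 hC]] := state_bound.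
have p1 := pint_sum_sqnorm noise_version_pl2.
have p2 := pint_sum_sqnorm input_pl2.
have i1 := (pint_tint p1).1; have i2 := (pint_tint p2).1.
have ic := rintegrableZ measurableT C (rintegrableD measurableT i1 i2).
have iT := rintegrable_sum measurableT (index_enum 'I_N)
  (fun k => noise_version_integrable k (memT_seg T0)).
have ih := rintegrableD measurableT (rintegrableZ measurableT 2 iT) ic.
apply: (integrable_ae_le _ _ _ ih).
- apply: measurable_sqnorm => j.
  exact: (@pmeas_slice _ _ _ T (fun t w => X i t w j 0) T (mX j) (memT_seg T0)).
- by move=> w; exact: sqnorm_ge0.
- by move: hC; apply: filterS => w h; exact: (h i T (memT_seg T0)).
Qed.

End Moments.

(** * Convexity of the social cost *)

Section Expectation.
Context {d0 : measure_display} {Omega : measurableType d0} {R : realType}.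
Variables (P : probability Omega R).
Implicit Types a b : Omega -> R.

Definition EE a : R := \int[P]_(w in setT) a w.

Lemma EE_fin a : P.-integrable setT (EFin \o a) ->
  (\int[P]_w (a w)%:E = (EE a)%:E)%E.
Proof. by move=> ia; rewrite /EE /Rintegral fineK//; exact: integrable_fin_num. Qed.

Lemma EE_ge0 a : P.-integrable setT (EFin \o a) -> {ae P, forall w, 0 <= a w} ->
  0 <= EE a.
Proof.
move=> ia a0; rewrite -lee_fin -EE_fin//.
have ma : measurable_fun setT a by apply/measurable_EFinP; case/integrableP: ia.
rewrite (ae_eq_integral (fun w => `|a w|%:E))//.
- by apply: integral_ge0 => w _; rewrite lee_fin.
- exact/measurable_EFinP.
- by apply/measurable_EFinP; exact: measurableT_comp.
by move: a0; apply: filterS => w aw _; rewrite ger0_norm.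
Qed.

Lemma ae_eq_EE a b : P.-integrable setT (EFin \o a) -> P.-integrable setT (EFin \o b) ->
  {ae P, forall w, a w = b w} -> EE a = EE b.
Proof.
move=> ia ib ab; rewrite /EE /Rintegral; congr fine; apply: ae_eq_integral => //.
- by case/integrableP: ia.
- by case/integrableP: ib.
by move: ab; apply: filterS => w h _; rewrite h.
Qed.

Lemma EE_B a b : P.-integrable setT (EFin \o a) -> P.-integrable setT (EFin \o b) ->
  EE (fun w => a w - b w) = EE a - EE b.
Proof. by move=> ia ib; rewrite /EE RintegralB. Qed.

Lemma EE_D a b : P.-integrable setT (EFin \o a) -> P.-integrable setT (EFin \o b) ->
  EE (fun w => a w + b w) = EE a + EE b.
Proof. by move=> ia ib; rewrite /EE RintegralD. Qed.

Lemma EE_Z c a : P.-integrable setT (EFin \o a) -> EE (fun w => c * a w) = c * EE a.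
Proof. by move=> ia; rewrite /EE RintegralZl. Qed.

Lemma EE_affine p q a b c : P.-integrable setT (EFin \o a) ->
  P.-integrable setT (EFin \o b) -> P.-integrable setT (EFin \o c) ->
  EE (fun w => p * a w + q * b w - c w) = p * EE a + q * EE b - EE c.
Proof.
move=> ia ib ic; have pa := rintegrableZ measurableT p ia.
have qb := rintegrableZ measurableT q ib.
by rewrite EE_B// ?EE_D ?EE_Z//; exact: rintegrableD.
Qed.

Lemma integrable_qform_terminal (T : R) k (M : 'M[R]_k) (Y : @process d0 Omega R k) :
  jointly_measurable T Y -> T \in `[0, T] ->
  P.-integrable setT (EFin \o (fun w => sqnorm (Y T w))) ->
  P.-integrable setT (EFin \o (fun w => qform M (Y T w))).
Proof.
move=> mY TT iY; have [C [_ hC]] := qform_bound M.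
apply: (rintegrable_le measurableT (g := fun w => C * sqnorm (Y T w))).
- exact: (@pmeas_slice _ _ _ T (fun t w => qform M (Y t w)) T (pmeas_qform M mY) TT).
- by move=> w _; exact: hC.
- exact: rintegrableZ.
Qed.

End Expectation.

(** * Convexity defects of quadratic forms *)

Section ConvexCombination.
Context {R : realType}.

(** An identity valid for indefinite forms too: the defect of convexity is the form itself on the
    difference, so convexity of the cost becomes a sign condition on its second variation. *)
Lemma qform_convex k (M : 'M[R]_k) (a : R) (y z : 'cV[R]_k) :
  a * qform M y + (1 - a) * qform M z - qform M (a *: y + (1 - a) *: z) =
  a * (1 - a) * qform M (y - z).
Proof.
rewrite /qform; set b := 1 - a.
have -> : (a *: y + b *: z)^T = a *: y^T + b *: z^T by apply/matrixP => i j; rewrite !mxE.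
have -> : (y - z)^T = y^T - z^T by apply/matrixP => i j; rewrite !mxE.
rewrite !(mulmxDl, mulmxDr, mulmxN, mulNmx) -!scalemxAl -!scalemxAr.
move: (y^T *m M *m y) (y^T *m M *m z) (z^T *m M *m y) (z^T *m M *m z) => A1 A2 A3 A4.
by rewrite !mxE /b; ring.
Qed.

Lemma sqnorm_qform k (z : 'cV[R]_k) : sqnorm z = qform 1%:M z.
Proof. by rewrite qform_sum; apply: eq_bigr => i _; rewrite mul1mx expr2. Qed.

Lemma sqnorm_convex k (a : R) (y z : 'cV[R]_k) :
  a * sqnorm y + (1 - a) * sqnorm z - sqnorm (a *: y + (1 - a) *: z) =
  a * (1 - a) * sqnorm (y - z).
Proof. by rewrite !sqnorm_qform qform_convex. Qed.

Lemma qform_mulmx k (M A : 'M[R]_k) (z : 'cV[R]_k) :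
  qform M (A *m z) = qform (A^T *m M *m A) z.
Proof. by rewrite /qform trmx_mul !mulmxA. Qed.

End ConvexCombination.

(** * Uniform convexity and coercivity of the social cost *)

Section SocialCost.
Context {d0 : measure_display} {Omega : measurableType d0} {R : realType}.
Variables (P : probability Omega R) (T : R) (T0 : 0 <= T).
Notation mu := (@lebesgue_measure R).
Variables (N n r d : nat) (N0 : (0 < N)%N).
Variables (A G Gamma : 'M[R]_n) (B : 'M[R]_(n, r)) (sigma : 'M[R]_(n, d)).
Variables (eta : 'cV[R]_n) (Q R2 H : 'M[R]_n).
Variables (W : 'I_N -> @process d0 Omega R d) (x0 : 'I_N -> Omega -> 'cV[R]_n).
Hypothesis W_bm : forall i, brownian_motion P T (W i).
Hypothesis x0_measurable : forall i, sigma_rv (x0 i) `<=` measurable.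
Hypothesis x0_square_integrable : forall i, ('E_P[fun w => sqnorm (x0 i w)] < +oo)%E.
Variables (u : 'I_N -> @process d0 Omega R r).
Hypothesis u_adm : forall i, admissible P T x0 W (u i).
Variable x : @process d0 Omega R n -> 'I_N -> @process d0 Omega R n.
Hypothesis x_state : forall f, admissible P T x0 W f ->
  state_eq P T A G B sigma x0 W u f (x f).
Implicit Types f g : @process d0 Omega R n.

Notation adm f := (admissible P T x0 W f).

Let i0 : 'I_N := Ordinal N0.

Let u_pl2 i : pl2 P T (u i). Proof. exact: admissible_pl2. Qed.

Let xl2 f i : adm f -> pl2 P T (x f i).
Proof.
move=> af; exact: (state_pl2 T0 W_bm x0_measurable x0_square_integrable u_pl2
  (admissible_pl2 af) (x_state af)).
Qed.

Let xT f i : adm f -> P.-integrable setT (EFin \o (fun w => sqnorm (x f i T w))).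
Proof.
move=> af; exact: (state_terminal T0 W_bm x0_measurable x0_square_integrable u_pl2
  (admissible_pl2 af) (x_state af)).
Qed.

Definition tracking f i t w : 'cV[R]_n := x f i t w - Gamma *m average (x f) t w - eta.

Let tracking_pl2 f i : adm f -> pl2 P T (tracking f i).
Proof.
move=> af; apply: pl2B => //; last exact: pl2_cst.
apply: pl2B; first exact: xl2.
by apply: pl2_mulmx => //; apply: pl2Z => //; apply: pl2_sum => // k; exact: xl2.
Qed.

Definition running f i t w : R := - qform Q (tracking f i t w) + qform R2 (f t w).

Let running_pint f i : adm f -> pint P T (running f i).
Proof.
move=> af; have mS := measurable_strip (Omega := Omega) T.
exact: (rintegrableD mS (rintegrableN mS (pint_qform Q (tracking_pl2 i af)))
  (pint_qform R2 (admissible_pl2 af))).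
Qed.

(** The cost realized on one sample, so that costs can be compared almost surely before expectations
    are taken. *)
Definition Lcost f w : R :=
  2^-1 * \sum_(i < N) (tint T (running f i) w - qform H (x f i T w)).

Definition Dcost f w : R := tint T (fun t w => sqnorm (f t w)) w.

Let iterm f i : adm f ->
  P.-integrable setT (EFin \o (fun w => tint T (running f i) w - qform H (x f i T w))).
Proof.
move=> af; apply: rintegrableB => //; first exact: (pint_tint (running_pint i af)).1.
apply: (integrable_qform_terminal _ _ (memT_seg T0)); last exact: xT.
by case: (xl2 i af).
Qed.

Lemma Lcost_integrable f : adm f -> P.-integrable setT (EFin \o Lcost f).
Proof.
by move=> af; apply: rintegrableZ => //; apply: rintegrable_sum => // i; exact: iterm.
Qed.

Lemma Dcost_integrable f : adm f -> P.-integrable setT (EFin \o Dcost f).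
Proof. by move=> af; exact: (pint_tint (admissible_pl2 af).2).1. Qed.

(** This is where the moments of the states are used: every integral in the definition is finite, so
    the extended-real sum is a real number. *)
Lemma Jsoc_EE f : adm f -> Jsoc P T Gamma eta Q R2 H (x f) f = (EE P (Lcost f))%:E.
Proof.
move=> af; rewrite /Lcost EE_Z; last by apply: rintegrable_sum => // i; exact: iterm.
rewrite /EE Rintegral_sum//; last by move=> i; exact: iterm.
rewrite EFinM -sumEFin /Jsoc; congr (_ * _)%E; apply: eq_bigr => i _.
have [ia Ea] := pint_tint (running_pint i af).
have ib : P.-integrable setT (EFin \o (fun w => qform H (x f i T w))).
  apply: (integrable_qform_terminal _ _ (memT_seg T0)); last exact: xT.
  by case: (xl2 i af).
rewrite RintegralB// EFinB; congr (_ - _)%E.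
  by rewrite [LHS]Ea EE_fin.
by rewrite unlock EE_fin.
Qed.

Lemma Dcost_EE f : adm f -> (Eint P T (fun t w => sqnorm (f t w)) = (EE P (Dcost f))%:E)%E.
Proof.
move=> af; have [ia Ea] := pint_tint (admissible_pl2 af).2.
by rewrite Ea EE_fin.
Qed.

Definition xidiff f g t w : 'cV[R]_n := x f i0 t w - x g i0 t w.

Lemma xidiff_driven f g : adm f -> adm g -> {ae P, forall w,
  driven T A G (fun t => f t w - g t w) (fun t => xidiff f g t w) /\
  forall i t, t \in `[0, T] -> x f i t w - x g i t w = xidiff f g t w}.
Proof.
move=> af ag.
have hu : {ae P, forall w, forall i, l2 T (u i ^~ w)}.
  by apply: filter_forall => i; exact: pl2_path.
have hf := pl2_path (admissible_pl2 af); have hg := pl2_path (admissible_pl2 ag).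
have sf := state_paths (x_state af); have sg := state_paths (x_state ag).
near=> w.
have luw : forall i, l2 T (u i ^~ w) by near: w.
have lfw : l2 T (f ^~ w) by near: w.
have lgw : l2 T (g ^~ w) by near: w.
have hX : forall i, mcont T (x f i ^~ w) /\
  sol_path T (x0 i w)
    (agent_drift A G B (fun i => x f i ^~ w) (fun i => u i ^~ w) (f ^~ w) i)
    (fun t => sigma *m W i t w) (x f i ^~ w) by near: w.
have hY : forall i, mcont T (x g i ^~ w) /\
  sol_path T (x0 i w)
    (agent_drift A G B (fun i => x g i ^~ w) (fun i => u i ^~ w) (g ^~ w) i)
    (fun t => sigma *m W i t w) (x g i ^~ w) by near: w.
exact: (agents_diff T0 i0 N0 (fun i => (hX i).1) (fun i => (hY i).1) luw lfw lgw
   (fun i => (hX i).2) (fun i => (hY i).2)).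
Unshelve. all: by end_near. Qed.

Definition comb (a : R) f g : @process d0 Omega R n := fun t w => a *: f t w + (1 - a) *: g t w.

Lemma comb_adm a f g : adm f -> adm g -> adm (comb a f g).
Proof. exact: admissible_comb. Qed.

(** [x] merely selects a solution for each control, so its affine dependence on the control is a
    uniqueness statement and holds off a null set: relative to the state under g, both sides have
    displacements solving the same linear equation. *)
Lemma state_comb a f g : adm f -> adm g -> {ae P, forall w, forall i t, t \in `[0, T] ->
  x (comb a f g) i t w = a *: x f i t w + (1 - a) *: x g i t w}.
Proof.
move=> af ag; have ah := comb_adm a af ag.
have h1 := xidiff_driven af ag; have h2 := xidiff_driven ah ag.
near=> w => i t tT.
have [[d1 z1] e1] : driven T A G (fun t => f t w - g t w) (fun t => xidiff f g t w) /\
  forall i t, t \in `[0, T] -> x f i t w - x g i t w = xidiff f g t w by near: w.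
have [[d2 z2] e2] : driven T A G (fun t => comb a f g t w - g t w)
    (fun t => xidiff (comb a f g) g t w) /\
  forall i t, t \in `[0, T] -> x (comb a f g) i t w - x g i t w = xidiff (comb a f g) g t w by near: w.
have hd : mprim T (fun t => (A + G) *m (xidiff (comb a f g) g t w - a *: xidiff f g t w))
    (fun t => xidiff (comb a f g) g t w - a *: xidiff f g t w).
  apply: eq_mprim (mprimB d2 (mprimZ a d1)) => // s _.
  move: (xidiff f g s w) (xidiff (comb a f g) g s w) (A + G) => y1 y2 M.
  rewrite (mulmxBr M) -scalemxAr /comb scalerDr.
  move: (M *m _) (M *m _) (f s w) (g s w) => {M}{y1 y2}y1 y2 y3 y4.
  by apply/matrixP => k l; rewrite !mxE; ring.
have hz : xidiff (comb a f g) g 0 w - a *: xidiff f g 0 w = 0.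
  by rewrite z1 z2 scaler0 subr0.
have := linear_unique T0 (@mcont_cst _ T _ _ (A + G)) hd (mem0_seg T0) hz tT.
rewrite -(e1 i t tT) -(e2 i t tT) => /eqP; rewrite subr_eq0 => /eqP E.
rewrite -[LHS](subrK (x g i t w)) E scalerBr scalerBl scale1r.
by rewrite addrAC addrA.
Unshelve. all: by end_near. Qed.

(** The factor [N] counts the agents, which all undergo the displacement [xidiff f g]. *)
Definition Ncost f g w : R :=
  N%:R * cost T Gamma Q R2 H (fun t => f t w - g t w) (fun t => xidiff f g t w).

(* The second-order part of the cost along a segment is the deterministic
   quadratic cost of the state difference, path by path. *)
Lemma Lcost_convexity a f g : adm f -> adm g -> {ae P, forall w,
  a * Lcost f w + (1 - a) * Lcost g w - Lcost (comb a f g) w =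
    a * (1 - a) * (2^-1 * Ncost f g w) /\
  a * Dcost f w + (1 - a) * Dcost g w - Dcost (comb a f g) w =
    a * (1 - a) * \int[mu]_(t in `[0, T]) sqnorm (f t w - g t w)}.
Proof.
move=> af ag; have ah := comb_adm a af ag.
have h1 := xidiff_driven af ag; have h2 := state_comb a af ag.
have hf := pl2_path (admissible_pl2 af); have hg := pl2_path (admissible_pl2 ag).
have tf : {ae P, forall w, forall i, l2 T (tracking f i ^~ w)}.
  by apply: filter_forall => i; apply: pl2_path; exact: tracking_pl2.
have tg : {ae P, forall w, forall i, l2 T (tracking g i ^~ w)}.
  by apply: filter_forall => i; apply: pl2_path; exact: tracking_pl2.
have th : {ae P, forall w, forall i, l2 T (tracking (comb a f g) i ^~ w)}.
  by apply: filter_forall => i; apply: pl2_path; exact: tracking_pl2.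
have hh := pl2_path (admissible_pl2 ah).
near=> w.
have [_ e1] : driven T A G (fun t => f t w - g t w) (fun t => xidiff f g t w) /\
  forall i t, t \in `[0, T] -> x f i t w - x g i t w = xidiff f g t w by near: w.
have e2 : forall i t, t \in `[0, T] ->
  x (comb a f g) i t w = a *: x f i t w + (1 - a) *: x g i t w by near: w.
have lf : l2 T (f ^~ w) by near: w.
have lg : l2 T (g ^~ w) by near: w.
have lh : l2 T (comb a f g ^~ w) by near: w.
have ltf : forall i, l2 T (tracking f i ^~ w) by near: w.
have ltg : forall i, l2 T (tracking g i ^~ w) by near: w.
have lth : forall i, l2 T (tracking (comb a f g) i ^~ w) by near: w.
have mI := measurable_seg 0 T.
have avgh t : t \in `[0, T] -> average (x (comb a f g)) t w =
    a *: average (x f) t w + (1 - a) *: average (x g) t w.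
  move=> tT; rewrite /average (eq_bigr _ (fun i _ => e2 i t tT)) big_split/=.
  by rewrite -!scaler_sumr scalerDr !scalerA ![N%:R^-1 * _]mulrC.
have avgd t : t \in `[0, T] -> average (x f) t w - average (x g) t w = xidiff f g t w.
  move=> tT; rewrite /average -scalerBr -sumrB (eq_bigr _ (fun i _ => e1 i t tT)).
  rewrite sumr_const card_ord -[X in _ *: X]scaler_nat scalerA mulVf ?scale1r//.
  by rewrite pnatr_eq0 -lt0n.
have trh i t : t \in `[0, T] -> tracking (comb a f g) i t w =
    a *: tracking f i t w + (1 - a) *: tracking g i t w.
  move=> tT; rewrite /tracking e2// avgh// mulmxDr -!scalemxAr.
  move: (Gamma *m _) (Gamma *m _) (x f i t w) (x g i t w) => y1 y2 y3 y4.
  by apply/matrixP => k l; rewrite !mxE; ring.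
have trd i t : t \in `[0, T] -> tracking f i t w - tracking g i t w =
    (1%:M - Gamma) *m xidiff f g t w.
  move=> tT; rewrite mulmxBl mul1mx -{1}(e1 i t tT) -(avgd t tT) mulmxBr /tracking.
  move: (Gamma *m _) (Gamma *m _) (x f i t w) (x g i t w) => y1 y2 y3 y4.
  by apply/matrixP => k l; rewrite !mxE; ring.
have irun h i : l2 T (h ^~ w) -> l2 T (tracking h i ^~ w) ->
    mu.-integrable `[0, T] (EFin \o (fun t => running h i t w)).
  by move=> l1 l2'; apply: rintegrableD => //; [apply: rintegrableN => //|]; exact: l2_qform.
split.
  rewrite /Lcost /Ncost mulrCA [(1 - a) * _]mulrCA -mulrDr -mulrBr [in RHS]mulrCA; congr (_ * _).
  rewrite !mulr_sumr -big_split/= -sumrB.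
  rewrite mulrCA mulr_natl -[N in X in _ = X](card_ord N) -sumr_const.
  apply: eq_bigr => i _.
  have Er : a * tint T (running f i) w + (1 - a) * tint T (running g i) w -
      tint T (running (comb a f g) i) w = a * (1 - a) * \int[mu]_(t in `[0, T])
      (- qform (Qtil Q Gamma) (xidiff f g t w) + qform R2 (f t w - g t w)).
    have if' := irun f i lf (ltf i); have ig' := irun g i lg (ltg i).
    have ih' := irun _ i lh (lth i).
    rewrite /tint -!RintegralZl// -?RintegralD// -?RintegralB//; last 4 first.
    - by apply: rintegrableD => //; exact: rintegrableZ.
    - exact: rintegrableZ.
    - exact: rintegrableZ.
    - have : mu.-integrable `[0, T] (EFin \o (fun t => - qform Q (tracking f i t w - tracking g i t w)
          + qform R2 (f t w - g t w))).
        apply: rintegrableD => //; [apply: rintegrableN => //|]; apply: l2_qform => //.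
          have : l2 T (fun t => tracking f i t w + (-1%:M) *m tracking g i t w).
            by apply: l2D => //; exact: l2_mulmx.
          by under eq_fun do rewrite mulNmx mul1mx.
        have : l2 T (fun t => f t w + (-1%:M) *m g t w).
          by apply: l2D => //; exact: l2_mulmx.
        by under eq_fun do rewrite mulNmx mul1mx.
      apply: eq_integrable => // t /set_mem tT /=.
      by rewrite trd// qform_mulmx.
    apply: eq_Rintegral => t /set_mem tT.
    rewrite /running trh// -[qform (Qtil _ _) _]qform_mulmx -(trd i t tT).
    rewrite [RHS]mulrDr mulrN -!qform_convex /comb; ring.
  have Eh : a * qform H (x f i T w) + (1 - a) * qform H (x g i T w) -
      qform H (x (comb a f g) i T w) = a * (1 - a) * qform H (xidiff f g T w).
    by rewrite e2 ?memT_seg// qform_convex e1 ?memT_seg.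
  rewrite /cost [RHS]mulrBr -Er -Eh; ring.
rewrite /Dcost /tint -!RintegralZl//; last 3 first.
- exact: lg.2.
- have : l2 T (fun t => f t w + (-1%:M) *m g t w).
    by apply: l2D => //; exact: l2_mulmx.
  by under eq_fun do rewrite mulNmx mul1mx; case.
- exact: lf.2.
have sf : mu.-integrable `[0, T] (EFin \o (fun t => a * sqnorm (f t w))).
  by apply: rintegrableZ => //; case: lf.
have sg : mu.-integrable `[0, T] (EFin \o (fun t => (1 - a) * sqnorm (g t w))).
  by apply: rintegrableZ => //; case: lg.
rewrite -RintegralD// -RintegralB//; last 2 first.
- exact: rintegrableD.
- by case: lh.
by apply: eq_Rintegral => t _; rewrite sqnorm_convex.
Unshelve. all: by end_near. Qed.

Let penalized (delta : R) f : \bar R :=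
  (Jsoc P T Gamma eta Q R2 H (x f) f - delta%:E * Eint P T (fun t w => sqnorm (f t w)))%E.

Let penalizedE delta f : adm f ->
  penalized delta f = (EE P (Lcost f) - delta * EE P (Dcost f))%:E.
Proof. by move=> af; rewrite /penalized Jsoc_EE// Dcost_EE// -EFinM -EFinB. Qed.

Let gap a f g w := a * Lcost f w + (1 - a) * Lcost g w - Lcost (comb a f g) w.
Let dgap a f g w := a * Dcost f w + (1 - a) * Dcost g w - Dcost (comb a f g) w.

Let igap a f g : adm f -> adm g -> P.-integrable setT (EFin \o gap a f g).
Proof.
move=> af ag; apply: rintegrableB => //; last by apply: Lcost_integrable; exact: comb_adm.
by apply: rintegrableD => //; apply: rintegrableZ => //; exact: Lcost_integrable.
Qed.

Let idgap a f g : adm f -> adm g -> P.-integrable setT (EFin \o dgap a f g).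
Proof.
move=> af ag; apply: rintegrableB => //; last by apply: Dcost_integrable; exact: comb_adm.
by apply: rintegrableD => //; apply: rintegrableZ => //; exact: Dcost_integrable.
Qed.

(** All penalized costs are finite, so the extended-real inequality of [convex_on] may be rearranged
    into the sign of an expected defect. *)
Let convex_gap delta a f g : adm f -> adm g ->
  (penalized delta (comb a f g) <= a%:E * penalized delta f + (1 - a)%:E * penalized delta g)%E =
  (0 <= EE P (gap a f g) - delta * EE P (dgap a f g)).
Proof.
move=> af ag; have ah := comb_adm a af ag.
rewrite !penalizedE// -!EFinM -EFinD lee_fin -subr_ge0; congr (0 <= _).
have EL := EE_affine a (1 - a) (Lcost_integrable af) (Lcost_integrable ag) (Lcost_integrable ah).
have ED := EE_affine a (1 - a) (Dcost_integrable af) (Dcost_integrable ag) (Dcost_integrable ah).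
by rewrite /gap /dgap EL ED; ring.
Qed.

Lemma coercive_uniformly_convex (delta : R) : 0 < delta ->
  (forall (f xi : R -> 'cV[R]_n), l2 T f -> driven T A G f xi ->
    delta * \int[mu]_(t in `[0, T]) sqnorm (f t) <= cost T Gamma Q R2 H f xi) ->
  uniformly_convex P T [set f | adm f] (fun f => Jsoc P T Gamma eta Q R2 H (x f) f).
Proof.
(* The factor 1/2 is the one in front of the social cost; [N] comes from the equal contributions of
   the agents. *)
move=> delta0 coer; exists (2^-1 * (N%:R * delta)).
  by rewrite !mulr_gt0// ltr0n.
move=> f g a af ag a0 a1.
rewrite -/(penalized _ f) -/(penalized _ g) -/(comb a f g) -/(penalized _ (comb a f g)).
rewrite convex_gap// -EE_Z ?idgap// -EE_B ?igap//; last by apply: rintegrableZ => //; exact: idgap.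
apply: EE_ge0; first by apply: rintegrableB; [|exact: igap|apply: rintegrableZ => //; exact: idgap].
have h1 := Lcost_convexity a af ag; have h2 := xidiff_driven af ag.
have hf := pl2_path (admissible_pl2 af); have hg := pl2_path (admissible_pl2 ag).
near=> w.
have [e1 e2] : gap a f g w = a * (1 - a) * (2^-1 * Ncost f g w) /\
  dgap a f g w = a * (1 - a) * \int[mu]_(t in `[0, T]) sqnorm (f t w - g t w) by near: w.
have [dr _] : driven T A G (fun t => f t w - g t w) (fun t => xidiff f g t w) /\
  forall i t, t \in `[0, T] -> x f i t w - x g i t w = xidiff f g t w by near: w.
have lf : l2 T (f ^~ w) by near: w.
have lg : l2 T (g ^~ w) by near: w.
have lfg : l2 T (fun t => f t w - g t w).
  have : l2 T (fun t => f t w + (-1%:M) *m g t w).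
    by apply: l2D => //; exact: l2_mulmx.
  by under eq_fun do rewrite mulNmx mul1mx.
have := coer _ _ lfg dr; rewrite e1 e2 /Ncost.
set I := \int[mu]_(t in _) _; set C := cost _ _ _ _ _ _ _ => h.
rewrite [X in 0 <= X](_ : _ = a * (1 - a) * (2^-1 * N%:R * (C - delta * I))); last by field.
by rewrite !mulr_ge0// ?subr_ge0// invr_ge0.
Unshelve. all: by end_near. Qed.

(** Convexity between f and the zero control suffices, because the defect is a quadratic form in
    their difference. The process [y] is an arbitrary solution and is identified almost surely with
    the repeated displacement [xidiff f z]. *)
Lemma uniformly_convex_coercive :
  uniformly_convex P T [set f | adm f] (fun f => Jsoc P T Gamma eta Q R2 H (x f) f) ->
  exists2 delta : R, 0 < delta &
     forall f, adm f -> forall y : @process d0 Omega R (N * n),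
     solves_sde P T (fun=> 0)
       (fun t w => Acheck N A G *m y t w + ones_tens N (f t w))
       (fun _ _ => 0) y ->
     (delta%:E * Eint P T (fun t w => sqnorm (f t w))
      <= Eint P T (fun t w =>
           - qform (Qhat N Q Gamma) (y t w) + N%:R * qform R2 (f t w))%R
         - 'E_P[fun w => qform (repdiag N H) (y T w)])%E.
Proof.
(* At the midpoint of f and 0 the factor a (1 - a) is 1/4, so the defect of the cost is 1/8 of
   [Ncost] and that of the energy 1/4 of the integral of |f|^2. Multiplication by 8 leaves [Ncost]
   against 2 [delta] times this integral. *)
move=> [delta delta0 conv]; exists (2 * delta); first by rewrite mulr_gt0.
move=> f af y [my hy].
have a0 : adm (fun _ _ => 0 : 'cV[R]_n).
  by apply: admissible_deterministic; apply: l2_mcont; exact: mcont_cst.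
set z : @process d0 Omega R n := fun _ _ => 0 in a0.
have half01 : 0 <= 2^-1 :> R by rewrite invr_ge0.
have half1 : 2^-1 <= 1 :> R by rewrite invf_le1// ler1n.
have := conv f z 2^-1 af a0 half01 half1.
rewrite -/(penalized _ f) -/(penalized _ z) -/(comb 2^-1 f z) -/(penalized _ (comb 2^-1 f z)).
rewrite convex_gap// => key.
have lxi : pl2 P T (xidiff f z) by apply: pl2B; exact: xl2.
have h1 := Lcost_convexity 2^-1 af a0; have h2 := xidiff_driven af a0.
have hf := pl2_path (admissible_pl2 af).
have yE : {ae P, forall w, forall t, t \in `[0, T] -> y t w = ones_tens N (xidiff f z t w)}.
  near=> w => t tT.
  have [dr _] : driven T A G (fun t => f t w - z t w) (fun t => xidiff f z t w) /\
    forall i t, t \in `[0, T] -> x f i t w - x z i t w = xidiff f z t w by near: w.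
  have lf : l2 T (f ^~ w) by near: w.
  have [cy sy] : {within `[0, T], continuous (y ^~ w)} /\
    forall t, t \in `[0, T] ->
      y t w = 0 + \col_j (\int[mu]_(s in `[0, t])
        ((Acheck N A G *m y s w + ones_tens N (f s w)) j 0)) + 0 by near: w.
  have dr0 : driven T A G (f ^~ w) (fun t => xidiff f z t w).
    by have := dr; rewrite (_ : (fun t => f t w - z t w) = f ^~ w)//; apply/funext => s; rewrite subr0.
  exact: (driven_ones T0 N0 lf dr0 ((mcont_mx T (y ^~ w)).1 cy) sy tT).
have ly : pl2 P T y.
  apply: (pl2_ae_eq my (pl2_mulmx (ones_tens N 1%:M) lxi)).
  by move: yE; apply: filterS => w h t tT; rewrite h// ones_tens_mul mul1mx.
have mS := measurable_strip (Omega := Omega) T.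
have py : pint P T (fun t w => - qform (Qhat N Q Gamma) (y t w) + N%:R * qform R2 (f t w)).
  exact: (rintegrableD mS (rintegrableN mS (pint_qform _ ly))
    (rintegrableZ mS N%:R (pint_qform R2 (admissible_pl2 af)))).
have ixT : P.-integrable setT (EFin \o (fun w => sqnorm (xidiff f z T w))).
  apply: (rintegrable_le measurableT (g := fun w => 2 * sqnorm (x f i0 T w) + 2 * sqnorm (x z i0 T w))).
  - apply: (@pmeas_slice _ _ _ T (fun t w => sqnorm (xidiff f z t w)) T _ (memT_seg T0)).
    by apply: pmeas_sqnorm; case: lxi.
  - move=> w _; rewrite ger0_norm ?sqnorm_ge0// /xidiff -scaleN1r.
    apply: (le_trans (sqnormD _ _)); rewrite sqnormZ sqrrN expr1n mul1r; exact: lexx.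
  - by apply: rintegrableD => //; apply: rintegrableZ => //; exact: xT.
have iyT : P.-integrable setT (EFin \o (fun w => qform (repdiag N H) (y T w))).
  apply: integrable_qform_terminal => //; first exact: memT_seg.
  have [C [C0 hC]] := sqnorm_mulmx (ones_tens N (1%:M : 'M[R]_n)).
  apply: (integrable_ae_le _ _ _ (rintegrableZ measurableT C ixT)).
  - apply: (@pmeas_slice _ _ _ T (fun t w => sqnorm (y t w)) T _ (memT_seg T0)).
    exact: pmeas_sqnorm.
  - by move=> w; exact: sqnorm_ge0.
  - move: yE; apply: filterS => w h.
    by have := hC (xidiff f z T w); rewrite ones_tens_mul mul1mx -h ?memT_seg.
have [it Et] := pint_tint py.
rewrite Et unlock !EE_fin// -EFinB Dcost_EE// -EFinM lee_fin -EE_B//.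
have ib := rintegrableB measurableT it iyT.
have jf := Dcost_integrable af.
move: key; rewrite -EE_Z ?idgap// -EE_B ?igap//; last by apply: rintegrableZ => //; exact: idgap.
move=> key; rewrite -subr_ge0 -EE_Z// -EE_B//; last exact: rintegrableZ.
rewrite (_ : EE P _ = 8 * EE P (fun w => gap 2^-1 f z w - delta * dgap 2^-1 f z w)).
  by rewrite mulr_ge0.
have ik : P.-integrable setT (EFin \o (fun w => gap 2^-1 f z w - delta * dgap 2^-1 f z w)).
  by apply: rintegrableB; [|exact: igap|apply: rintegrableZ => //; exact: idgap].
rewrite -EE_Z//; apply: ae_eq_EE.
- by apply: rintegrableB => //; exact: rintegrableZ.
- exact: rintegrableZ.
near=> w.
have [e1 e2] : gap 2^-1 f z w = 2^-1 * (1 - 2^-1) * (2^-1 * Ncost f z w) /\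
  dgap 2^-1 f z w = 2^-1 * (1 - 2^-1) * \int[mu]_(t in `[0, T]) sqnorm (f t w - z t w) by near: w.
have ye : forall t, t \in `[0, T] -> y t w = ones_tens N (xidiff f z t w) by near: w.
have fz t : f t w - z t w = f t w by exact: subr0.
have -> : tint T (fun t w => - qform (Qhat N Q Gamma) (y t w) + N%:R * qform R2 (f t w)) w
   - qform (repdiag N H) (y T w) = Ncost f z w.
  rewrite /Ncost /cost mulrBr ye ?memT_seg// qform_repdiag_ones; congr (_ - _).
  have lw : l2 T (f ^~ w) by near: w.
  have lxw : l2 T (fun t => xidiff f z t w) by near: w; exact: pl2_path.
  rewrite /tint -RintegralZl//.
    by apply: eq_Rintegral => t /set_mem tT; rewrite ye// qform_Qhat_ones// subr0 mulrDr mulrN.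
  apply: rintegrableD => //; first by apply: rintegrableN => //; exact: l2_qform.
  have lfz : l2 T (fun t => f t w - z t w) by rewrite (funext fz).
  exact: l2_qform.
have -> : Dcost f w = \int[mu]_(t in `[0, T]) sqnorm (f t w - z t w).
  by apply: eq_Rintegral => t _; rewrite fz.
by rewrite e1 e2; field.
Unshelve. all: by end_near. Qed.

(* The extremal of a conjugate point is deterministic, hence admissible. *)
Lemma coercive_unit : Q^T = Q -> R2^T = R2 -> H^T = H -> pd_mx R2 ->
  (exists2 delta : R, 0 < delta &
     forall f, adm f -> forall y : @process d0 Omega R (N * n),
     solves_sde P T (fun=> 0)
       (fun t w => Acheck N A G *m y t w + ones_tens N (f t w))
       (fun _ _ => 0) y ->
     (delta%:E * Eint P T (fun t w => sqnorm (f t w))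
      <= Eint P T (fun t w =>
           - qform (Qhat N Q Gamma) (y t w) + N%:R * qform R2 (f t w))%R
         - 'E_P[fun w => qform (repdiag N H) (y T w)])%E) ->
  forall t, t \in `[0, T] ->
    ham_X T (A + G + invmx R2 *m H) (- invmx R2) (A21 A G Gamma Q R2 H) t \in unitmx.
Proof.
move=> Qs R2s Hs R2pd [delta delta0 coer] t tT; apply/negPn/negP => sing.
have [f [xi [lf [hxi xi0] c0 If]]] := conjugate_point T0 Qs R2s Hs R2pd tT sing.
pose y (t : R) := ones_tens N (xi t).
have hy : mprim T (fun t => Acheck N A G *m y t + ones_tens N (f t)) y.
  apply: eq_mprim (mprimMl T0 (ones_tens N 1%:M) hxi) => // s _.
    by rewrite ones_tens_mul mul1mx Acheck_ones// ones_tensD.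
  by rewrite ones_tens_mul mul1mx.
have y0 : y 0 = 0 by rewrite /y xi0 ones_tens0.
have cy : mcont T y by exact: mcont_prim hy.
have ay := admissible_deterministic P x0 W (l2_mcont cy).
have sy : solves_sde P T (fun=> 0)
    (fun t (_ : Omega) => Acheck N A G *m y t + ones_tens N (f t)) (fun _ _ => 0) (fun t _ => y t).
  split; first exact: adm_measurable ay.
  apply: nearW => w; split; first exact/mcont_mx.
  move=> s sT; rewrite add0r addr0; apply/matrixP => i j; rewrite ord1 mxE.
  by rewrite ((hy i 0).2 s sT) y0 mxE add0r.
have := coer _ (admissible_deterministic P x0 W lf) _ sy.
have lxi : l2 T xi by apply: l2_mcont; exact: mcont_prim hxi.
have mI := measurable_seg 0 T.
have Edet (h : R -> R) : mu.-integrable `[0, T] (EFin \o h) ->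
    Eint P T (fun t _ => h t) = (\int[mu]_(t in `[0, T]) h t)%:E.
  move=> ih; rewrite /Eint integral_cst//= probability_setT mule1.
  by rewrite /Rintegral fineK//; exact: integrable_fin_num.
rewrite (Edet (fun t => sqnorm (f t)) lf.2).
have ir : mu.-integrable `[0, T]
    (EFin \o (fun t => - qform (Qhat N Q Gamma) (y t) + N%:R * qform R2 (f t))).
  apply: rintegrableD => //; first by apply: rintegrableN => //; apply: l2_qform; exact: l2_mcont.
  by apply: rintegrableZ => //; exact: l2_qform.
rewrite (Edet (fun t => - qform (Qhat N Q Gamma) (y t) + N%:R * qform R2 (f t)) ir).
rewrite unlock integral_cst//= probability_setT mule1 -EFinB -EFinM lee_fin leNgt => /negP; apply.
have -> : \int[mu]_(t in `[0, T]) (- qform (Qhat N Q Gamma) (y t) + N%:R * qform R2 (f t))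
    - qform (repdiag N H) (y T) = N%:R * cost T Gamma Q R2 H f xi.
  rewrite /cost mulrBr /y qform_repdiag_ones; congr (_ - _); rewrite -RintegralZl//.
    by apply: eq_Rintegral => s _; rewrite qform_Qhat_ones// mulrDr mulrN.
  by apply: rintegrableD => //; [apply: rintegrableN => //|]; exact: l2_qform.
by rewrite c0 mulr0 mulr_gt0.
Qed.

End SocialCost.

Theorem proposition2p2 (R : realType) (d0 : measure_display)
  (Omega : measurableType d0) (P : probability Omega R)
  (T : R) (hT : 0 < T) (N n r d : nat) (hN : (0 < N)%N)
  (A G Gamma : 'M[R]_n) (B : 'M[R]_(n, r)) (sigma : 'M[R]_(n, d))
  (eta : 'cV[R]_n) (Q R2 H : 'M[R]_n)
  (Qsym : symmetric_mx Q) (R2sym : symmetric_mx R2) (Hsym : symmetric_mx H)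
  (Qpsd : psd_mx Q) (R2pd : pd_mx R2) (Hpsd : psd_mx H)
  (W : 'I_N -> @process d0 Omega R d) (x0 : 'I_N -> Omega -> 'cV[R]_n)
  (W_bm : forall i, brownian_motion P T (W i))
  (x0_measurable : forall i, sigma_rv (x0 i) `<=` measurable)
  (indep : mutual_indep P (fun k : 'I_N + 'I_N =>
     match k with
     | inl i => sigma_process `[0, T] (W i)
     | inr i => sigma_rv (x0 i)
     end))
  (x0_square_integrable : forall i, ('E_P[fun w => sqnorm (x0 i w)] < +oo)%E)
  (x0_common_mean : exists m : 'cV[R]_n, forall i j,
     ('E_P[fun w => x0 i w j ord0] = (m j ord0)%:E)%E)
  (u : 'I_N -> @process d0 Omega R r)
  (u_adm : forall i, admissible P T x0 W (u i))
  (* x f is the family of agents' states driven by f *)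
  (x : @process d0 Omega R n -> 'I_N -> @process d0 Omega R n)
  (x_state : forall f, admissible P T x0 W f ->
     state_eq P T A G B sigma x0 W u f (x f)) :
  [<->
   (* (i) *)
   uniformly_convex P T [set f | admissible P T x0 W f]
     (fun f => Jsoc P T Gamma eta Q R2 H (x f) f);
   (* (ii) *)
   exists2 delta : R, 0 < delta &
     forall f, admissible P T x0 W f ->
     forall y : @process d0 Omega R (N * n),
     solves_sde P T (fun=> 0)
       (fun t w => Acheck N A G *m y t w + ones_tens N (f t w))
       (fun _ _ => 0) y ->
     (delta%:E * Eint P T (fun t w => sqnorm (f t w))
      <= Eint P T (fun t w =>
           - qform (Qhat N Q Gamma) (y t w) + N%:R * qform R2 (f t w))%R
         - 'E_P[fun w => qform (repdiag N H) (y T w)])%E;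
   (* (iii) *)
   exists PP : R -> 'M[R]_(N * n),
     solves_terminal T
       (fun X => - (Acheck N A G)^T *m X - X *m Acheck N A G
          + Qhat N Q Gamma
          + X *m ones_tens N 1%:M *m invmx (N%:R *: R2)
              *m (ones_tens N 1%:M)^T *m X)
       (- repdiag N H) PP;
   (* (iv) *)
   exists PP : R -> 'M[R]_n,
     solves_terminal T
       (fun X => - (A + G)^T *m X - X *m (A + G) + X *m invmx R2 *m X
          + (1%:M - Gamma)^T *m Q *m (1%:M - Gamma))
       (- H) PP;
   (* (v) *)
   forall t, t \in `[0, T] ->
     0 < \det (row_mx 0 1%:M *m expmx (t *: bbA A G Gamma Q R2 H)
               *m (row_mx 0 1%:M)^T : 'M[R]_n)
  ].
Proof.
have T0 := ltW hT; have R2u := pd_unitmx R2pd.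
have Psol := unit_riccati_iv T0 Qsym R2sym Hsym.
have det_unit := det_condition_unit T A G Gamma Q R2 H.
do !split.
- exact: (uniformly_convex_coercive T0 hN W_bm x0_measurable x0_square_integrable
    u_adm x_state).
(* Coercivity yields the solution of (iv) first; the solution of (iii) is assembled from it and from
   a Lyapunov solution on the complement of the diagonal. *)
- move=> /(coercive_unit T0 hN Qsym R2sym Hsym R2pd)/Psol[P0 [sP Psym]].
  have [S sS] := lyapunov_exists T0 A Qsym Hsym.
  by eexists; exact: (riccati_iv_iii hN R2u Psym sP sS).
- by move=> [PP /(riccati_iii_iv hN R2u) sP]; eexists; exact: sP.
- by move=> [P0 sP]; apply/det_unit => t; exact: (riccati_iv_unit T0 Qsym R2sym Hsym sP).
(* The solution is rebuilt from the Hamiltonian system because completing the square takes a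
   symmetric one. *)
- move=> /det_unit/Psol[P0 [sP Psym]].
  have [delta [delta0 coer]] := cost_coercive T0 R2sym R2pd Psym sP.
  exact: (coercive_uniformly_convex T0 hN _ W_bm x0_measurable x0_square_integrable
    u_adm x_state delta0 coer).
Qed.
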